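(* There exists an absolute constant $C>0$ such that the following holds. Let $n,k\in\mathbb{N}$, let $X$ be distributed according to an $(n,k)$-Generalized Multinomial Distribution with mean vector $\mu$ and covariance matrix $\Sigma$, and let $Y\sim\mathcal{N}(\mu,\Sigma)$. Let $\sigma^2$ be the minimum eigenvalue of $\Sigma$. Then $$d_{\mathrm{TV}}\left(X,\lfloor Y\rceil\right)\le C\,\frac{k^{7/2}}{\sigma^{1/10}}.$$
   Context: A $k$-Categorical Random Variable ($k$-CRV) is a random vector supported on the standard basis $\{e_1,\dots,e_k\}$ of $\mathbb{R}^k$. An $(n,k)$-Poisson Multinomial Distribution (PMD) is the distribution of a sum of $n$ independent (not necessarily identically distributed) $k$-CRVs. An $(n,k)$-Generalized Multinomial Distribution (GMD) is the distribution obtained from an $(n,k)$-PMD by projecting out one fixed coordinate (i.e., keeping all but one coordinate). For a random vector $Y$, $\lfloor Y\rceil$ denotes the random vector obtained by rounding each coordinate of $Y$ to the nearest integer. $d_{\mathrm{TV}}(P,Q)=\sup_A|P(A)-Q(A)|$ is the total variation distance. *)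

(* Defs.v *)
From HB Require Import structures.
From mathcomp Require Import all_boot all_order all_algebra.
From mathcomp Require Import all_classical all_reals all_analysis.
Set Implicit Arguments.
Unset Strict Implicit.
Unset Printing Implicit Defensive.
Import Order.TTheory GRing.Theory Num.Theory.
Import numFieldNormedType.Exports.
Local Open Scope classical_set_scope.
Local Open Scope ring_scope.

(* MathComp-Analysis. A random vector of R^m is a measurable function into
   m.-tuple R, whose sigma-algebra is generated by the coordinates; a law is
   compared with another one on measurable sets only, since measures are total
   functions carrying no information on the other sets. *)

Definition mutually_independent (R : realType) (d : measure_display)
    (T : measurableType d) (P : probability T R) (d' : measure_display)
    (T' : measurableType d') (n : nat) (X : 'I_n -> {RV P >-> T'}) : Prop :=
  forall (J : {set 'I_n}) (A : 'I_n -> set T'),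
    (forall i, measurable (A i)) ->
    P (\bigcap_(i in [set` J]) (X i @^-1` A i)) =
      (\prod_(i in J) P (X i @^-1` A i))%E.

Definition std_basis (R : realType) (k : nat) (j : 'I_k) : k.-tuple R :=
  [tuple (i == j)%:R | i < k].

Definition is_CRV (R : realType) (d : measure_display) (T : measurableType d)
    (P : probability T R) (k : nat) (X : {RV P >-> k.-tuple R}) : Prop :=
  P (X @^-1` range (@std_basis R k)) = 1%E.

Definition sum_vec (R : realType) (T : Type) (n k : nat)
    (X : 'I_n -> T -> k.-tuple R) (w : T) : k.-tuple R :=
  [tuple \sum_(i < n) tnth (X i w) j | j < k].

Definition is_PMD (R : realType) (n k : nat)
    (nu : set (k.-tuple R) -> \bar R) : Prop :=
  exists (d : measure_display) (T : measurableType d) (P : probability T R)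
         (X : 'I_n -> {RV P >-> k.-tuple R}),
    [/\ mutually_independent X,
        forall i, is_CRV (X i) &
        forall A, measurable A -> nu A = pushforward P (sum_vec X) A].

Definition drop_coord (R : realType) (k : nat) (i0 : 'I_k)
    (x : k.-tuple R) : (k.-1).-tuple R :=
  [tuple tnth x (lift i0 j) | j < k.-1].

Definition is_GMD (R : realType) (n k : nat)
    (nu : set ((k.-1).-tuple R) -> \bar R) : Prop :=
  exists (i0 : 'I_k) (rho : set (k.-tuple R) -> \bar R),
    is_PMD n rho /\
    forall A, measurable A -> nu A = rho (drop_coord i0 @^-1` A).

Definition mean_vec (R : realType) (d : measure_display) (T : measurableType d)
    (P : probability T R) (m : nat) (X : T -> m.-tuple R) : 'rV[R]_m :=
  \row_j fine 'E_P[fun w => tnth (X w) j].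

Definition cov_mx (R : realType) (d : measure_display) (T : measurableType d)
    (P : probability T R) (m : nat) (X : T -> m.-tuple R) : 'M[R]_m :=
  \matrix_(i, j) fine (covariance P (fun w => tnth (X w) i)
                                    (fun w => tnth (X w) j)).

Definition affine_tuple (R : realType) (l m : nat) (mu : 'rV[R]_m)
    (A : 'M[R]_(l, m)) (z : 'rV[R]_l) : m.-tuple R :=
  [tuple (mu + z *m A) 0 j | j < m].

(* N(mu, Sigma) is the law of mu + Z A, where A^T A = Sigma and Z is a row
   vector of i.i.d. standard normal variables; Sigma may be singular. *)
Definition is_mvnormal (R : realType) (m : nat) (mu : 'rV[R]_m)
    (Sigma : 'M[R]_m) (nu : set (m.-tuple R) -> \bar R) : Prop :=
  exists (l : nat) (A : 'M[R]_(l, m)),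
    A^T *m A = Sigma /\
    exists (d : measure_display) (T : measurableType d) (P : probability T R)
           (Z : 'I_l -> {RV P >-> R}),
      [/\ mutually_independent Z,
          forall i (B : set R), measurable B ->
            distribution P (Z i) B = normal_prob 0 1 B &
          forall B, measurable B ->
            nu B = pushforward P
                     (fun w => affine_tuple mu A (\row_i Z i w)) B].

Definition is_min_eigenvalue (R : realType) (m : nat) (S : 'M[R]_m)
    (a : R) : Prop :=
  eigenvalue S a /\ forall b, eigenvalue S b -> a <= b.

(* Half-integers are rounded up. *)
Definition round_vec (R : realType) (m : nat) (x : m.-tuple R) : m.-tuple R :=
  [tuple (Num.floor (tnth x j + 2^-1))%:~R | j < m].

Definition dTV (R : realType) (d : measure_display) (T : measurableType d)
    (P Q : set T -> \bar R) : \bar R :=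
  ereal_sup [set `|P A - Q A|%E | A in [set A : set T | measurable A]].

(* Main.v *)
(* Write Sigma = A^T A, |u|^2 = u Sigma^-1 u^T and G_e f(x) for the
   expectation of f(x + e Z A), with Z standard Gaussian. Let f be the indicator
   of a set of rounded points, s = sigma^(1/10) >= 1 and e = 1/s. Three steps
   lead from E f(X) to G_1 f(mu) = P(round Y in S).
   (1) E f(X) is close to E G_e f(X). Resampling one of the categorical variables
   gives a score function of variance |u|^2, so moving X by e_a - e_b changes
   expectations of [-1,1]-valued functions by at most sqrt k |e_a - e_b|, and a
   larger integer vector is a flow along such differences, with weights
   w_ab = sum_i p_ia p_ib since 2 Sigma = sum_ab w_ab (e_a-e_b)^T (e_a-e_b).
   (2) E G_e f(X) is close to G_1 G_e f(mu), by Lindeberg's replacement argument: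
   the Cameron-Martin formula bounds the third order Taylor remainder of G_e f at
   x by a multiple of (|u|/e)^3, and the summands have size O(1/sigma).
   (3) G_1 G_e f = G_e G_1 f is close to G_1 f, which is Lipschitz for |.|. *)

Require Import Defs.
From HB Require Import structures.
From mathcomp Require Import all_boot all_order all_algebra.
From mathcomp Require Import all_classical all_reals all_analysis.
From mathcomp Require Import measurable_realfun ring lra.
Set Implicit Arguments.
Unset Strict Implicit.
Unset Printing Implicit Defensive.
Import Order.TTheory GRing.Theory Num.Theory.
Import numFieldNormedType.Exports HBNNSimple.
Local Open Scope classical_set_scope.
Local Open Scope ring_scope.

(** Step (1) depends on [f] being a function of the rounded point: X has integer coordinates, so
    rounding X + v translates X by the rounding of v, and only integer moves must be paid for. The
    flow carrying such a move has real values; flooring them leaves an error of order k^2 in each of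
    the k - 1 coordinates, repaired by unit moves. Together with the factor sqrt k of the score
    bound, this k^3 is the origin of k^(7/2). A unit move has length |e_a - e_b| <= 2 / sigma, so
    for bounded k the three steps cost orders e + 1 / sigma, 1 / (sigma e^3) and e; with e = 1 / s
    and sigma = s^10 none exceeds the order of 1 / s. The obstacle in step (2) is that a Gaussian
    replacing a single summand would need a square root of its own, possibly singular, covariance,
    while only the factor A of the total covariance is given. Each summand is therefore replaced by
    a sum of many small independent copies, and these are regrouped into copies of the whole sum, to
    which A applies. *)

Section density.
Local Open Scope ereal_scope.
Context d (T : measurableType d) (R : realType).
Variables (mu nu : {measure set T -> \bar R}) (p : T -> \bar R).
Hypothesis p0 : forall x, 0 <= p x.
Hypothesis mp : measurable_fun setT p.
Hypothesis nuE : forall A, measurable A -> nu A = \int[mu]_(x in A) p x.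

(** Simple functions come first, where the hypothesis on sets applies value by value, then monotone
    convergence on both sides. The density is extended-real valued, so the points where it is
    infinite are treated apart. *)
Lemma ge0_integral_density (g : T -> \bar R) :
  (forall x, 0 <= g x) -> measurable_fun setT g ->
  \int[nu]_x g x = \int[mu]_x (g x * p x).
Proof.
move=> g0 mg.
pose g_ := nnsfun_approx measurableT mg.
have gE x : g x = limn (fun n => (g_ n x)%:E).
  apply/esym/cvg_lim => //; exact: cvg_nnsfun_approx.
have nd x : {homo (fun n => g_ n x) : a b / (a <= b)%N >-> (a <= b)%R}.
  by move=> a b ab; exact/lefP/nd_nnsfun_approx.
have simple (h : {nnsfun T >-> R}) :
    \int[nu]_x (h x)%:E = \int[mu]_x ((h x)%:E * p x).
  rewrite integralT_nnsfun sintegralE.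
  transitivity (\int[mu]_x \sum_(r \in range h) (r%:E * (\1_(h @^-1` [set r]) x)%:E * p x)).
    rewrite ge0_integral_fsum//=; last 2 first.
    - move=> r; apply: emeasurable_funM => //; apply: emeasurable_funM => //.
      apply/measurable_EFinP; exact: measurable_indic.
    - move=> r x _; have [r0|r0] := leP 0%R r.
        by rewrite !mule_ge0// lee_fin.
      rewrite preimage_nnfun0// indic0 mule0 mul0e//.
    apply: eq_fsbigr => r _.
    have [r0|r0] := leP 0%R r; last first.
      rewrite preimage_nnfun0// measure0 mule0 integral0_eq// => x _.
      by rewrite indic0 mule0 mul0e.
    under eq_integral do rewrite -muleA.
    rewrite ge0_integralZl//; last 2 first.
    - apply: emeasurable_funM => //.
      apply/measurable_EFinP; exact: measurable_indic.
    - by move=> x _; rewrite mule_ge0// lee_fin.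
    rewrite nuE// integral_mkcond; congr (_ * _); apply: eq_integral => x _.
    by rewrite epatch_indic/= muleC.
  apply: eq_integral => x _.
  have := fimfunE h x => {1}->.
  rewrite -fsumEFin// ge0_mule_fsuml; last first.
    move=> r; have [r0|r0] := leP 0%R r; first by rewrite lee_fin mulr_ge0.
    by rewrite preimage_nnfun0// indic0 mulr0.
  by apply: eq_fsbigr => r _; rewrite EFinM.
transitivity (\int[nu]_x limn (fun n => (g_ n x)%:E)); first by apply: eq_integral.
rewrite monotone_convergence//=; last 3 first.
- by move=> n; apply/measurable_EFinP.
- by move=> n x _; rewrite lee_fin.
- by move=> x _ a b ab; rewrite lee_fin; exact: nd.
transitivity (limn (fun n => \int[mu]_x ((g_ n x)%:E * p x))).
  by congr (limn _); apply/funext => n; rewrite simple.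
rewrite -monotone_convergence//=; last 3 first.
- by move=> n; apply: emeasurable_funM => //; apply/measurable_EFinP.
- by move=> n x _; rewrite mule_ge0// lee_fin.
- by move=> x _ a b ab; rewrite lee_wpmul2r// lee_fin; exact: nd.
apply: eq_integral => x _; rewrite gE.
have cg : cvgn (fun n => (g_ n x)%:E).
  apply/cvg_ex; exists (g x); exact: cvg_nnsfun_approx.
have [px|px] := boolP (p x \is a fin_num).
  by rewrite limeMr.
(* With an infinite factor the limit of the products is found directly: they all vanish if g x = 0,
   and they are eventually +oo if g x > 0. *)
have -> : p x = +oo.
  by apply/eqP; move: px; rewrite ge0_fin_numE// ltey negbK.
have [g0x|g0x] := eqVneq (g x) 0.
  rewrite -gE g0x mul0e; apply/cvg_lim => //.
  have -> : (fun n => (g_ n x)%:E * +oo) = cst 0; last exact: cvg_cst.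
  apply/funext => n /=; have -> : g_ n x = 0%R; last by rewrite mul0e.
  apply/eqP; rewrite eq_le; apply/andP; split => //.
  rewrite -lee_fin -[leRHS]g0x gE; apply: lime_ge => //.
  by near=> k; rewrite lee_fin; apply: nd; near: k; exists n.
have gx : 0 < g x by rewrite lt0e g0x g0.
rewrite -gE gt0_muley//; apply/cvg_lim => //.
have [N gN] : exists N, (0 < g_ N x)%R.
  apply/not_existsP => H; move: g0x; rewrite gE.
  rewrite (_ : (fun n => _) = cst 0) ?lim_cst ?eqxx//.
  apply/funext => n /=; congr EFin; apply/eqP; rewrite eq_le; apply/andP; split => //.
  by rewrite leNgt; apply/negP/H.
apply: (cvg_near_cst +oo); near=> n.
rewrite gt0_muley//.
rewrite lte_fin (lt_le_trans gN)//; apply: nd.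
by near: n; exists N.
Unshelve. all: by end_near. Qed.

End density.


(** * Push-forwards, and the Lebesgue and Gaussian measures on the line *)

Definition push_measure d d' (T1 : measurableType d) (T2 : measurableType d')
    (R : realType) (m : {measure set T1 -> \bar R}) (f : T1 -> T2)
    (mf : measurable_fun setT f) : {measure set T2 -> \bar R} :=
  measure_function_pushforward__canonical__measure_function_Measure m mf.

Lemma ge0_integral_push_measure d d' (T1 : measurableType d) (T2 : measurableType d')
    (R : realType) (m : {measure set T1 -> \bar R}) (f : T1 -> T2)
    (mf : measurable_fun setT f) (g : T2 -> \bar R) :
  (forall x, 0 <= g x)%E -> measurable_fun setT g ->
  (\int[push_measure m mf]_x g x = \int[m]_x g (f x))%E.
Proof. by move=> g0 mg; rewrite ge0_integral_pushforward. Qed.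

Lemma integral_cst_prob d (T : measurableType d) (R : realType)
    (P : probability T R) (c : \bar R) : (\int[P]_x c = c)%E.
Proof.
rewrite (integral_cst P measurableT c).
by rewrite -[RHS]mule1; congr (_ * _)%E; exact: (@probability_setT _ _ _ P).
Qed.

Section realmeasures.
Context (R : realType).

(* lebesgue_measure and normal_prob 0 1, declared on the default display of R
   instead of that of measurableTypeR R. *)
Definition lebR : set R -> \bar R := @lebesgue_measure R.

Let lebR0 : lebR set0 = 0%E.
Proof. exact: measure0. Qed.

Let lebR_ge0 A : (0 <= lebR A)%E.
Proof. exact: measure_ge0. Qed.

Let lebR_sigma_additive : semi_sigma_additive lebR.
Proof. exact: (@measure_semi_sigma_additive _ _ _ (@lebesgue_measure R)). Qed.

HB.instance Definition _ := isMeasure.Build _ _ _ lebR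
  lebR0 lebR_ge0 lebR_sigma_additive.

Let lebR_sigma_finite : sigma_finite setT lebR.
Proof. exact: (@sigma_finiteT _ _ _ (@lebesgue_measure R)). Qed.

HB.instance Definition _ := Measure_isSigmaFinite.Build _ _ _ lebR
  lebR_sigma_finite.

Definition gaussR : set R -> \bar R := normal_prob (0 : R) 1.

Let gaussR0 : gaussR set0 = 0%E.
Proof. exact: measure0. Qed.

Let gaussR_ge0 A : (0 <= gaussR A)%E.
Proof. exact: measure_ge0. Qed.

Let gaussR_sigma_additive : semi_sigma_additive gaussR.
Proof. exact: (@measure_semi_sigma_additive _ _ _ (normal_prob (0 : R) 1)). Qed.

HB.instance Definition _ := isMeasure.Build _ _ _ gaussR
  gaussR0 gaussR_ge0 gaussR_sigma_additive.

Let gaussR_setT : gaussR [set: R] = 1%E.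
Proof. exact: (@probability_setT _ _ _ (normal_prob (0 : R) 1)). Qed.

HB.instance Definition _ := Measure_isProbability.Build _ _ _ gaussR gaussR_setT.

Let idR (x : measurableTypeR R) : R := x.

Let measurable_idR : measurable_fun setT idR.
Proof. by move=> _ Y mY; rewrite setTI. Qed.

(** The two displays of R have the same measurable sets, so the identity map [idR] between them
    carries one integral to the other. *)
Lemma ge0_integral_lebR (g : R -> \bar R) (A : set R) :
  measurable A -> (forall x, 0 <= g x)%E -> measurable_fun setT g ->
  (\int[lebR]_(x in A) g x = \int[lebesgue_measure]_(x in A) g x)%E.
Proof.
move=> mA g0 mg.
transitivity (\int[pushforward (@lebesgue_measure R) idR]_(x in A) g x)%E.
  exact: eq_measure_integral.
rewrite ge0_integral_pushforward//; exact: measurable_funTS.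
Qed.

Lemma gaussRE A : measurable A ->
  gaussR A = (\int[lebR]_(x in A) (normal_pdf 0 1 x)%:E)%E.
Proof.
move=> mA; rewrite ge0_integral_lebR//.
- by move=> x; rewrite lee_fin normal_pdf_ge0.
- by apply/measurable_EFinP; exact: measurable_normal_pdf.
Qed.

End realmeasures.

(** * The standard Gaussian on the line: translation, symmetry, stability *)

Section gauss1.
Context (R : realType).

Local Notation lam := (@lebR R).
Local Notation gam := (@gaussR R).
Local Open Scope ereal_scope.

Let measurable_affine (s t : R) : measurable_fun [set: R] (fun x => (s * x + t)%R).
Proof. by apply: measurable_funD => //; apply: measurable_funM. Qed.

(** The scaled push-forward gives every half-open interval its length, and these values determine
    Lebesgue measure. *)
Lemma lebR_affine (s t : R) (A : set R) : (0 < s)%R -> measurable A ->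
  lam A = s%:E * lam ((fun x => s * x + t)%R @^-1` A).
Proof.
move=> s0 mA.
have mf : measurable_fun [set: measurableTypeR R]
    (fun x : measurableTypeR R => (s * x + t)%R : measurableTypeR R).
  by move=> _ Y mY; exact: measurable_affine.
pose nu := mscale (NngNum (ltW s0)) (push_measure (@lebesgue_measure R) mf).
apply: (@lebesgue_measure_unique R nu) => // X [[a b] _ <-].
rewrite /nu/= /mscale/= /pushforward/=.
rewrite (_ : _ @^-1` _ = `](a - t) / s, (b - t) / s]%classic)%R; last first.
  by apply/seteqP; split => x /=; rewrite !in_itv/= ltr_pdivrMr// ler_pdivlMr// ltrBlDr lerBrDr (mulrC x).
rewrite !lebesgue_measure_itv/= !lte_fin.
rewrite ltr_pM2r ?invr_gt0// ltrD2r; case: ifPn => [ab|]; last by rewrite mule0.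
by rewrite -!EFinB -EFinM -mulrBl mulrC divfK ?gt_eqF// opprB addrA subrK.
Qed.

Lemma ge0_integral_affine (s t : R) (g : R -> \bar R) : (0 < s)%R ->
  (forall x, 0 <= g x) -> measurable_fun setT g ->
  \int[lam]_x g x = s%:E * \int[lam]_x g (s * x + t)%R.
Proof.
move=> s0 g0 mg.
transitivity (\int[mscale (NngNum (ltW s0)) (push_measure lam (measurable_affine s t))]_x g x).
  apply: eq_measure_integral => A mA _.
  exact: lebR_affine.
by rewrite ge0_integral_mscale//= ge0_integral_pushforward.
Qed.

Lemma gauss_pdfE (x : R) : normal_pdf 0 1 x = (normal_peak 1 * expR (- x ^+ 2 / 2))%R.
Proof.
rewrite normal_pdfE ?oner_eq0// /normal_fun subr0; congr (_ * expR (_ / _))%R.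
by rewrite expr1n.
Qed.

Lemma normal_pdf_scale (m s x : R) : (0 < s)%R ->
  (s * normal_pdf m s (s * x + m) = normal_pdf 0 1 x)%R.
Proof.
move=> s0; rewrite normal_pdfE ?gt_eqF// gauss_pdfE mulrA; congr (_ * _)%R.
  rewrite /normal_peak expr1n mul1r -mulrnAr sqrtrM ?sqr_ge0// sqrtr_sqr gtr0_norm//.
  by rewrite invfM mulrA divff ?mul1r// gt_eqF.
rewrite /normal_fun addrK; congr expR; rewrite exprMn -mulr_natr.
have s2 : (s != 0)%R by rewrite gt_eqF.
by field.
Qed.

Lemma ge0_integral_gauss (g : R -> \bar R) :
  (forall x, 0 <= g x) -> measurable_fun setT g ->
  \int[gam]_x g x = \int[lam]_x (g x * (normal_pdf 0 1 x)%:E).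
Proof.
move=> g0 mg; apply: (ge0_integral_density (mu := lam)) => //.
- by move=> x; rewrite lee_fin normal_pdf_ge0.
- by apply/measurable_EFinP; exact: measurable_normal_pdf.
- exact: gaussRE.
Qed.

Lemma ge0_integral_gauss_affine (s t : R) (g : R -> \bar R) : (0 < s)%R ->
  (forall x, 0 <= g x) -> measurable_fun setT g ->
  \int[gam]_x g (s * x + t)%R = \int[lam]_x (g x * (normal_pdf t s x)%:E).
Proof.
move=> s0 g0 mg.
have mf : measurable_fun [set: R] (fun x : R => (s * x + t)%R).
  by apply: measurable_funD => //; apply: measurable_funM.
rewrite ge0_integral_gauss; [|by []|exact: measurableT_comp mg mf].
rewrite [RHS](ge0_integral_affine t s0); last 2 first.
- by move=> x; rewrite mule_ge0// lee_fin normal_pdf_ge0.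
- apply: emeasurable_funM => //; apply/measurable_EFinP; exact: measurable_normal_pdf.
have mp : measurable_fun setT (fun x : R => normal_pdf t s (s * x + t)).
  by apply: (measurableT_comp (measurable_normal_pdf t s) mf).
rewrite -ge0_integralZl; [|by []|..]; last 3 first.
- apply: emeasurable_funM; first exact: measurableT_comp mg mf.
  exact/measurable_EFinP.
- by move=> x _; rewrite mule_ge0// lee_fin normal_pdf_ge0.
- by rewrite lee_fin ltW.
apply: eq_integral => x _; rewrite -(normal_pdf_scale t x s0) EFinM.
by rewrite muleCA.
Qed.

(** The density ratio of N(b, 1) and N(0, 1) at x is exp (b x - b^2 / 2). *)
Lemma gauss_cameron_martin (b : R) (g : R -> \bar R) :
  (forall x, 0 <= g x) -> measurable_fun setT g ->
  \int[gam]_x g (x + b)%R = \int[gam]_x (g x * (expR (b * x - b ^+ 2 / 2))%:E).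
Proof.
move=> g0 mg.
under eq_integral do rewrite -[X in g (X + b)%R]mul1r.
rewrite ge0_integral_gauss_affine; [|by []|by []|by []].
rewrite ge0_integral_gauss; last 2 first.
- by move=> x; rewrite mule_ge0// lee_fin expR_ge0.
- apply: emeasurable_funM => //; apply/measurable_EFinP.
  by apply: measurableT_comp => //; apply: measurable_funB => //; apply: measurable_funM.
apply: eq_integral => x _; rewrite -muleA; congr (_ * _).
rewrite -EFinM; congr EFin.
rewrite normal_pdfE ?oner_eq0// gauss_pdfE mulrCA -expRD; congr (_ * expR _)%R.
by rewrite expr1n; field.
Qed.

(** The joint density of x and v = s x + t y, for independent standard x and y, factored in both
    orders: v is N(0, r^2), and x given v is N(s v / r^2, (t / r)^2). *)
Lemma normal_pdf_prod (s t v x : R) : (0 < s)%R -> (0 < t)%R ->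
  let r := Num.sqrt (s ^+ 2 + t ^+ 2) in
  (normal_pdf 0 1 x * normal_pdf (s * x) t v =
   normal_pdf 0 r v * normal_pdf (s * v / r ^+ 2) (t / r) x)%R.
Proof.
move=> s0 t0 r.
have r2 : (r ^+ 2 = s ^+ 2 + t ^+ 2)%R by rewrite sqr_sqrtr// addr_ge0// sqr_ge0.
have r0 : (0 < r)%R by rewrite sqrtr_gt0 addr_gt0// exprn_gt0.
have pk (a : R) : (0 < a)%R -> normal_peak a = (a^-1 * (normal_peak 1))%R.
  move=> a0; rewrite /normal_peak expr1n mul1r -mulrnAr sqrtrM ?sqr_ge0// sqrtr_sqr gtr0_norm//.
  by rewrite invfM.
rewrite normal_pdfE ?oner_eq0// normal_pdfE ?gt_eqF// normal_pdfE ?gt_eqF// normal_pdfE; last first.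
  by rewrite gt_eqF// divr_gt0.
rewrite (pk t)// (pk r)// (pk (t / r))%R ?divr_gt0//.
rewrite mulrACA [RHS]mulrACA /normal_fun -!expRD; congr (_ * expR _)%R.
  by field; rewrite !gt_eqF.
have -> : ((t / r) ^+ 2 = t ^+ 2 / r ^+ 2)%R by rewrite exprMn exprVn.
rewrite r2 -![(_ ^+ 2 *+ 2)%R]mulr_natr -![(_ / _ *+ 2)%R]mulr_natr.
have q0 : (s ^+ 2 + t ^+ 2 != 0)%R by rewrite -r2 gt_eqF// exprn_gt0.
have t1 : (t != 0)%R by rewrite gt_eqF.
by field; rewrite ?q0 ?t1.
Qed.

(** The variable y is changed to v = s x + t y, the integrals are exchanged, and x is integrated
    out: its conditional density given v has mass 1. *)
Lemma gauss_stable_pos (s t : R) (g : R -> \bar R) : (0 < s)%R -> (0 < t)%R ->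
  (forall x, 0 <= g x) -> measurable_fun setT g ->
  \int[gam]_x \int[gam]_y g (s * x + t * y)%R =
  \int[gam]_x g (Num.sqrt (s ^+ 2 + t ^+ 2) * x)%R.
Proof.
move=> s0 t0 g0 mg; set r := Num.sqrt _.
have r0 : (0 < r)%R by rewrite sqrtr_gt0 addr_gt0// exprn_gt0.
have mpdf := @measurable_normal_pdf R.
have mker : measurable_fun setT (fun z : R * R => (normal_pdf (s * z.1) t z.2)).
  rewrite (_ : (fun z => _) = (fun z : R * R => normal_pdf 0 t (z.2 - s * z.1)))%R.
    apply: (measurableT_comp (mpdf 0%R t)); apply: measurable_funB => //.
    exact: measurable_funM.
  apply/funext => z; rewrite !normal_pdfE ?gt_eqF//=; congr (_ * _)%R.
  by rewrite /normal_fun subr0.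
transitivity (\int[lam]_x \int[lam]_v (g v * (normal_pdf 0 1 x * normal_pdf (s * x) t v)%:E)).
  under eq_integral => x _.
    under eq_integral do rewrite addrC.
    rewrite ge0_integral_gauss_affine; [|by []|by []|by []].
    over.
  rewrite ge0_integral_gauss.
  - apply: eq_integral => x _.
    rewrite -ge0_integralZr//.
    + by apply: eq_integral => v _; rewrite EFinM -muleA (muleC (normal_pdf _ _ v)%:E).
    + apply: emeasurable_funM => //; apply/measurable_EFinP; exact: mpdf.
    + by move=> v _; rewrite mule_ge0// lee_fin normal_pdf_ge0.
    + by rewrite lee_fin normal_pdf_ge0.
  - move=> x; apply: integral_ge0 => v _.
    by rewrite mule_ge0// lee_fin normal_pdf_ge0.
  - apply: (@measurable_fun_fubini_tonelli_F _ _ _ _ _ _ (fun z : R * R => g z.2 * (normal_pdf (s * z.1) t z.2)%:E)).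
    + apply: emeasurable_funM; last exact/measurable_EFinP.
      exact: measurableT_comp.
    + by move=> z; rewrite mule_ge0// lee_fin normal_pdf_ge0.
rewrite (@fubini_tonelli _ _ _ _ _ lam lam (fun z : R * R => g z.2 * (normal_pdf 0 1 z.1 * normal_pdf (s * z.1) t z.2)%:E)); last 2 first.
- apply: emeasurable_funM; first exact: measurableT_comp.
  apply/measurable_EFinP; apply: measurable_funM => //.
  exact: (measurableT_comp (mpdf 0%R 1%R)).
- by move=> z; rewrite mule_ge0// lee_fin mulr_ge0// normal_pdf_ge0.
transitivity (\int[lam]_v (g v * (normal_pdf 0 r v)%:E)); last first.
  under [RHS]eq_integral do rewrite -[X in g X]addr0.
  by rewrite ge0_integral_gauss_affine.
apply: eq_integral => v _ /=.
under eq_integral do rewrite normal_pdf_prod// EFinM muleA.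
rewrite ge0_integralZl.
- rewrite ge0_integral_lebR.
  + by rewrite integral_normal_pdf mule1.
  + by [].
  + by move=> x; rewrite lee_fin normal_pdf_ge0.
  + by apply/measurable_EFinP; exact: mpdf.
- by [].
- by apply/measurable_EFinP; exact: mpdf.
- by move=> x _; rewrite lee_fin normal_pdf_ge0.
- by rewrite mule_ge0// lee_fin normal_pdf_ge0.
Qed.

Lemma gaussN (g : R -> \bar R) : (forall x, 0 <= g x) -> measurable_fun setT g ->
  \int[gam]_x g (- x)%R = \int[gam]_x g x.
Proof.
move=> g0 mg.
have mo : measurable_fun [set: R] (fun x : R => - x)%R by exact: oppr_measurable.
rewrite !ge0_integral_gauss//; last exact: measurableT_comp mg mo.
transitivity (\int[push_measure lam mo]_x (g x * (normal_pdf 0 1 x)%:E)); last first.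
  by apply: eq_measure_integral => A mA _; exact: lebesgue_measureN.
rewrite ge0_integral_push_measure.
- by apply: eq_integral => x _; rewrite !gauss_pdfE sqrrN.
- by move=> x; rewrite mule_ge0// lee_fin normal_pdf_ge0.
- apply: emeasurable_funM => //; apply/measurable_EFinP; exact: measurable_normal_pdf.
Qed.

(** Symmetry makes both coefficients nonnegative. A zero coefficient is treated apart, since the
    density argument needs positive standard deviations. *)
Lemma gauss_stable (s t : R) (g : R -> \bar R) :
  (forall x, 0 <= g x) -> measurable_fun setT g ->
  \int[gam]_x \int[gam]_y g (s * x + t * y)%R =
  \int[gam]_x g (Num.sqrt (s ^+ 2 + t ^+ 2) * x)%R.
Proof.
move=> g0 mg.
have mM (c : R) (h : R -> \bar R) : measurable_fun setT h ->
    measurable_fun setT (fun x => h (c * x)%R).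
  by move=> mh; apply: (measurableT_comp mh); apply: measurable_funM.
have mD (c : R) : measurable_fun setT (fun x => g (c + x)%R).
  by apply: (measurableT_comp mg); apply: measurable_funD.
have scaleN (c : R) (h : R -> \bar R) : (forall x, 0 <= h x) -> measurable_fun setT h ->
    \int[gam]_x h (c * x)%R = \int[gam]_x h (`|c| * x)%R.
  move=> h0 mh; have [c0|c0] := ger0P c => //.
  rewrite -(gaussN (g := fun x => h (- c * x)%R)); [|by []|exact: mM].
  by apply: eq_integral => x _; rewrite mulrNN.
have mG (c : R) : measurable_fun setT (fun x : R => \int[gam]_y g (x + c * y)%R).
  apply: (@measurable_fun_fubini_tonelli_F _ _ _ _ _ _ (fun z : R * R => g (z.1 + c * z.2)%R)) => //.
  apply: (measurableT_comp mg); apply: measurable_funD => //; exact: measurable_funM.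
rewrite (scaleN s (fun x => \int[gam]_y g (x + t * y)%R)); last 2 first.
- by move=> x; exact: integral_ge0.
- exact: mG.
under eq_integral => x _ do rewrite (scaleN t (fun y => g (`|s| * x + y)%R))//.
rewrite -(real_normK (num_real s)) -(real_normK (num_real t)).
have [->|s0] := eqVneq s 0%R.
  rewrite normr0 expr0n add0r sqrtr_sqr normr_id.
  under eq_integral => x _ do under eq_integral => y _ do rewrite mul0r add0r.
  by rewrite integral_cst_prob.
have [->|t0] := eqVneq t 0%R.
  rewrite normr0 expr0n addr0 sqrtr_sqr normr_id.
  apply: eq_integral => x _.
  under eq_integral => y _ do rewrite mul0r addr0.
  by rewrite integral_cst_prob.
by rewrite gauss_stable_pos// normr_gt0.
Qed.

End gauss1.

(** * Row vectors as tuples: measurability, dot product, norm *)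

Section rowtuple.
Context (R : realType).

Definition rv l (t : l.-tuple R) : 'rV[R]_l := \row_i tnth t i.
Definition tp l (x : 'rV[R]_l) : l.-tuple R := [tuple x 0 i | i < l].

Lemma rvK l : cancel (@rv l) (@tp l).
Proof. by move=> t; apply/eq_from_tnth => i; rewrite tnth_mktuple mxE. Qed.

Lemma tpK l : cancel (@tp l) (@rv l).
Proof. by move=> x; apply/rowP => i; rewrite mxE tnth_mktuple. Qed.

(** The sigma-algebra is that of tuples, whereas matrix algebra takes place on row vectors; [mvec]
    and [mrv] express measurability of maps into and out of row vectors. *)
Definition mvec d (T : measurableType d) l (f : T -> 'rV[R]_l) :=
  forall i, measurable_fun setT (fun x => f x 0 i).

Definition mrv d (U : sigmaRingType d) l (F : 'rV[R]_l -> U) :=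
  measurable_fun setT (fun t : l.-tuple R => F (rv t)).

Lemma mvec_tp d (T : measurableType d) l (f : T -> 'rV[R]_l) :
  mvec f -> measurable_fun setT (fun x => tp (f x)).
Proof.
move=> mf; apply/measurable_fun_tnthP => i.
by rewrite (_ : _ \o _ = fun x => f x 0 i) //; apply/funext => x /=; rewrite tnth_mktuple.
Qed.

Lemma mrv_comp d (T : measurableType d) d' (U : measurableType d') l
    (F : 'rV[R]_l -> U) (f : T -> 'rV[R]_l) :
  mrv F -> mvec f -> measurable_fun setT (fun x => F (f x)).
Proof.
move=> mF mf; rewrite (_ : (fun x => _) = (fun t => F (rv t)) \o (fun x => tp (f x))).
  by apply: measurableT_comp => //; exact: mvec_tp.
by apply/funext => x /=; rewrite tpK.
Qed.

Lemma mvec_rv d (T : measurableType d) l (f : T -> l.-tuple R) :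
  measurable_fun setT f -> mvec (fun x => rv (f x)).
Proof.
move=> mf i; rewrite (_ : (fun x => _) = (fun t => tnth t i) \o f).
  by apply: measurableT_comp => //; exact: measurable_tnth.
by apply/funext => x /=; rewrite mxE.
Qed.

Lemma mvec_cst d (T : measurableType d) l (x : 'rV[R]_l) :
  mvec (fun _ : T => x).
Proof. by move=> i. Qed.

Lemma mvecD d (T : measurableType d) l (f g : T -> 'rV[R]_l) :
  mvec f -> mvec g -> mvec (fun x => f x + g x).
Proof.
move=> mf mg i; rewrite (_ : (fun x => _) = (fun x => f x 0 i + g x 0 i)).
  exact: measurable_funD.
by apply/funext => x /=; rewrite mxE.
Qed.

Lemma mvecZ d (T : measurableType d) l (f : T -> 'rV[R]_l) (s : R) :
  mvec f -> mvec (fun x => s *: f x).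
Proof.
move=> mf i; rewrite (_ : (fun x => _) = (fun x => s * f x 0 i)).
  exact: measurable_funM.
by apply/funext => x /=; rewrite mxE.
Qed.

Lemma mvecM d (T : measurableType d) l m (f : T -> 'rV[R]_l) (A : 'M[R]_(l, m)) :
  mvec f -> mvec (fun x => f x *m A).
Proof.
move=> mf i; rewrite (_ : (fun x => _) = (fun x => \sum_j f x 0 j * A j i)).
  by apply: measurable_sum => j; apply: measurable_funM.
by apply/funext => x /=; rewrite mxE.
Qed.

Lemma mvec_row_mx d (T : measurableType d) l (f : T -> R) (g : T -> 'rV[R]_l) :
  measurable_fun setT f -> mvec g ->
  mvec (fun x => row_mx (f x)%:M (g x) : 'rV[R]_(1 + l)).
Proof.
move=> mf mg i.
case: (split_ordP i) => j ->.
  rewrite (_ : (fun x => _) = f) //.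
  by apply/funext => x; rewrite row_mxEl !ord1 mxE eqxx.
rewrite (_ : (fun x => _) = (fun x => g x 0 j)) //.
by apply/funext => x; rewrite row_mxEr.
Qed.

Definition dotp l (b z : 'rV[R]_l) : R := \sum_i b 0 i * z 0 i.

Lemma mdotp d (T : measurableType d) l (b : 'rV[R]_l) (f : T -> 'rV[R]_l) :
  mvec f -> measurable_fun setT (fun x => dotp b (f x)).
Proof. by move=> mf; apply: measurable_sum => j; apply: measurable_funM. Qed.

Lemma mrv_dotp l (b : 'rV[R]_l) : mrv (dotp b).
Proof. by apply: mdotp; exact: mvec_rv. Qed.

Lemma mvec_id l : mvec (@rv l).
Proof. by apply: mvec_rv; exact: measurable_id. Qed.

Lemma mvec_fst d (T : measurableType d) l :
  mvec (fun z : l.-tuple R * T => rv z.1).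
Proof. exact: mvec_rv. Qed.

Lemma mvec_snd d (T : measurableType d) l :
  mvec (fun z : T * l.-tuple R => rv z.2).
Proof. exact: mvec_rv. Qed.

Lemma dotpDl l (b c z : 'rV[R]_l) : dotp (b + c) z = dotp b z + dotp c z.
Proof. by rewrite -big_split; apply: eq_bigr => i _; rewrite mxE mulrDl. Qed.

Lemma dotpZl l (b z : 'rV[R]_l) s : dotp (s *: b) z = s * dotp b z.
Proof. by rewrite /dotp mulr_sumr; apply: eq_bigr => i _; rewrite mxE mulrA. Qed.

Lemma dotpC l (b z : 'rV[R]_l) : dotp b z = dotp z b.
Proof. by apply: eq_bigr => i _; rewrite mulrC. Qed.

Lemma dotpDr l (z b c : 'rV[R]_l) : dotp z (b + c) = dotp z b + dotp z c.
Proof. by rewrite dotpC dotpDl !(dotpC z). Qed.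

Lemma dotpZr l (b z : 'rV[R]_l) s : dotp b (s *: z) = s * dotp b z.
Proof. by rewrite dotpC dotpZl dotpC. Qed.

Lemma row_mx_hd_tl l (b : 'rV[R]_(1 + l)) :
  b = row_mx (lsubmx b 0 0)%:M (rsubmx b).
Proof. by rewrite -mx11_scalar hsubmxK. Qed.

Lemma dotp_row_mx l (x y : R) (b z : 'rV[R]_l) :
  dotp (row_mx x%:M b : 'rV[R]_(1 + l)) (row_mx y%:M z) = x * y + dotp b z.
Proof.
rewrite /dotp big_split_ord /= big_ord1 !row_mxEl !mxE /=; congr (_ + _).
by apply: eq_bigr => i _; rewrite !row_mxEr.
Qed.

Lemma dotp_ge0 l (b : 'rV[R]_l) : 0 <= dotp b b.
Proof. by apply: sumr_ge0 => i _; rewrite -expr2 sqr_ge0. Qed.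

Definition nrm l (b : 'rV[R]_l) : R := Num.sqrt (dotp b b).

Lemma nrm_ge0 l (b : 'rV[R]_l) : 0 <= nrm b.
Proof. exact: sqrtr_ge0. Qed.

Lemma sqr_nrm l (b : 'rV[R]_l) : nrm b ^+ 2 = dotp b b.
Proof. by rewrite sqr_sqrtr// dotp_ge0. Qed.

Lemma nrmZ l s (b : 'rV[R]_l) : nrm (s *: b) = `|s| * nrm b.
Proof. by rewrite /nrm dotpZl dotpZr mulrA -expr2 sqrtrM ?sqr_ge0// sqrtr_sqr. Qed.

End rowtuple.

(** * The standard Gaussian on R^l, one coordinate at a time *)

Section gaussT.
Context (R : realType).
Local Notation gam := (@gaussR R).

Definition cons_pair l (z : R * l.-tuple R) : l.+1.-tuple R := [tuple of z.1 :: z.2].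

Lemma measurable_cons_pair l : measurable_fun setT (@cons_pair l).
Proof. by apply: measurable_cons. Qed.

HB.instance Definition _ l :=
  isMeasurableFun.Build _ _ _ _ (@cons_pair l) (@measurable_cons_pair l).

Fixpoint gaussT l : probability (l.-tuple R) R :=
  match l with
  | 0 => @dirac _ (0.-tuple R) [tuple] R
  | l'.+1 => distribution (gam \x gaussT l')%E (@cons_pair l')
  end.

Lemma rv_cons l x (t : l.-tuple R) : rv (cons_pair (x, t)) = row_mx x%:M (rv t) :> 'rV[R]_(1 + l).
Proof.
apply/rowP => i; rewrite mxE; case: (split_ordP i) => j ->.
  by rewrite row_mxEl !ord1 mxE eqxx /= (tnth_nth 0).
by rewrite row_mxEr mxE !(tnth_nth 0).
Qed.

Local Open Scope ereal_scope.

Lemma ge0_integral_gaussTS l (F : 'rV[R]_(1 + l) -> \bar R) :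
  (forall x, 0 <= F x) -> mrv F ->
  \int[gaussT l.+1]_t F (rv t) =
  \int[gam]_x \int[gaussT l]_t F (row_mx x%:M (rv t)).
Proof.
move=> F0 mF /=.
rewrite (ge0_integral_distribution (@cons_pair l) (f := fun t => F (rv t)))//.
rewrite fubini_tonelli1.
- by apply: eq_integral => x _; apply: eq_integral => t _; rewrite /= rv_cons.
- exact: (measurableT_comp mF (@measurable_cons_pair l)).
- by move=> x; exact: F0.
Qed.

(** Head and tail are independent: once the integrals over the tail of [z] and the head of [w] are
    exchanged, induction handles the tails and [gauss_stable] the heads. *)
Lemma gaussT_stable l (s t : R) (F : 'rV[R]_l -> \bar R) :
  (forall x, 0 <= F x) -> mrv F ->
  \int[gaussT l]_z \int[gaussT l]_w F (s *: rv z + t *: rv w)%R =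
  \int[gaussT l]_z F (Num.sqrt (s ^+ 2 + t ^+ 2) *: rv z)%R.
Proof.
set r := Num.sqrt _.
elim: l F => [|l IH] F F0 mF.
  have E (x : 'rV[R]_0) : x = 0%R by apply/rowP => -[].
  under eq_integral => z _ do under eq_integral => w _ do rewrite [X in F X]E.
  rewrite !integral_cst_prob.
  under eq_integral => z _ do rewrite [X in F X]E.
  by rewrite integral_cst_prob.
pose G y (w : 'rV[R]_l) := F (row_mx y%:M w).
have mG d (T : measurableType d) (f : T -> R) (g : T -> 'rV[R]_l) :
    measurable_fun setT f -> mvec g -> measurable_fun setT (fun x => G (f x) (g x)).
  by move=> mf mg; apply: (mrv_comp mF); apply: mvec_row_mx.
have GE (x x' : R) (z w : 'rV[R]_l) :
    F (s *: (row_mx x%:M z : 'rV[R]_(1 + l)) + t *: row_mx x'%:M w)%R = G (s * x + t * x')%R (s *: z + t *: w)%R.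
  by rewrite /G !scale_row_mx add_row_mx !scale_scalar_mx -raddfD.
rewrite (ge0_integral_gaussTS (F := fun z => \int[gaussT l.+1]_w F (s *: z + t *: rv w)%R)); last 2 first.
- by move=> x; apply: integral_ge0.
- apply: (@measurable_fun_fubini_tonelli_F _ _ _ _ _ _ (fun z : l.+1.-tuple R * l.+1.-tuple R => F (s *: rv z.1 + t *: rv z.2)%R)) => //.
  apply: (mrv_comp mF); apply: mvecD; apply: mvecZ; [exact: mvec_fst|exact: mvec_snd].
transitivity (\int[gam]_x \int[gaussT l]_z \int[gam]_x' \int[gaussT l]_w G (s * x + t * x')%R (s *: rv z + t *: rv w)%R).
  apply: eq_integral => x _; apply: eq_integral => z _.
  rewrite (ge0_integral_gaussTS (F := fun w => F (s *: row_mx x%:M (rv z) + t *: w)%R)); [|by []|]; last first.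
    by apply: (mrv_comp mF); apply: mvecD; [exact: mvec_cst|apply: mvecZ; exact: mvec_id].
  by apply: eq_integral => x' _; apply: eq_integral => w _; rewrite GE.
transitivity (\int[gam]_x \int[gam]_x' \int[gaussT l]_z G (s * x + t * x')%R (r *: rv z)%R).
  apply: eq_integral => x _.
  rewrite (@fubini_tonelli _ _ _ _ _ (gaussT l) gam (fun p => \int[gaussT l]_w G (s * x + t * p.2)%R (s *: rv p.1 + t *: rv w)%R)); last 2 first.
  - apply: (@measurable_fun_fubini_tonelli_F _ _ _ _ _ _ (fun q : (l.-tuple R * R) * l.-tuple R => G (s * x + t * q.1.2)%R (s *: rv q.1.1 + t *: rv q.2)%R)).
    + apply: mG.
      * apply: measurable_funD => //; apply: measurable_funM => //.
        exact: (measurableT_comp measurable_snd measurable_fst).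
      * apply: mvecD; apply: mvecZ; last exact: mvec_snd.
        by apply: mvec_rv; exact: (measurableT_comp measurable_fst measurable_fst).
    + by move=> q; exact: F0.
  - by move=> q; apply: integral_ge0 => *; exact: F0.
  apply: eq_integral => x' _ /=.
  rewrite (IH (G (s * x + t * x')%R)); [by []|by move=> w; exact: F0|].
  by apply: mG => //; exact: mvec_id.
rewrite (gauss_stable s t (g := fun y => \int[gaussT l]_z G y (r *: rv z)%R)); last 2 first.
- by move=> y; apply: integral_ge0 => *; exact: F0.
- apply: (@measurable_fun_fubini_tonelli_F _ _ _ _ _ _ (fun q : R * l.-tuple R => G q.1 (r *: rv q.2)%R)).
  + by apply: mG => //; apply: mvecZ; exact: mvec_snd.
  + by move=> q; exact: F0.
rewrite (ge0_integral_gaussTS (F := fun z => F (r *: z)%R)); [|by []|]; last first.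
  by apply: (mrv_comp mF); apply: mvecZ; exact: mvec_id.
apply: eq_integral => x _; apply: eq_integral => z _.
by rewrite /G -/r; congr F; rewrite scale_row_mx scale_scalar_mx.
Qed.

(** The exponential weight is the product of the weights of the head and of the tail of [b], so
    induction and the one-dimensional formula combine. *)
Lemma gaussT_cameron_martin l (b : 'rV[R]_l) (F : 'rV[R]_l -> \bar R) :
  (forall x, 0 <= F x) -> mrv F ->
  \int[gaussT l]_z F (rv z + b)%R =
  \int[gaussT l]_z (F (rv z) * (expR (dotp b (rv z) - dotp b b / 2))%:E).
Proof.
elim: l b F => [|l IH] b F F0 mF.
  have E (x : 'rV[R]_0) : x = 0%R by apply/rowP => -[].
  apply: eq_integral => z _; rewrite [X in F X]E [X in _ = F X * _]E.
  by rewrite /dotp !big_ord0 mul0r subr0 expR0 mule1.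
pose G y (w : 'rV[R]_l) := F (row_mx y%:M w).
have mG d (T : measurableType d) (f : T -> R) (g : T -> 'rV[R]_l) :
    measurable_fun setT f -> mvec g -> measurable_fun setT (fun x => G (f x) (g x)).
  by move=> mf mg; apply: (mrv_comp mF); apply: mvec_row_mx.
pose b0 := lsubmx (b : 'rV[R]_(1 + l)) 0%R 0%R.
pose b1 := rsubmx (b : 'rV[R]_(1 + l)).
have bE : b = row_mx b0%:M b1 :> 'rV[R]_(1 + l).
  exact: row_mx_hd_tl.
have mexp l' (c : 'rV[R]_l') d (T : measurableType d) (g : T -> 'rV[R]_l') : mvec g ->
    measurable_fun setT (fun x => (expR (dotp c (g x) - dotp c c / 2))%:E).
  move=> mg; apply/measurable_EFinP; apply: measurableT_comp => //.
  by apply: measurable_funB => //; exact: mdotp.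
rewrite (ge0_integral_gaussTS (F := fun z => F (z + b)%R)); [|by []|]; last first.
  by apply: (mrv_comp mF); apply: mvecD; [exact: mvec_id|exact: mvec_cst].
rewrite (ge0_integral_gaussTS (F := fun z => F z * (expR (dotp b z - dotp b b / 2))%:E)); last 2 first.
- by move=> z; rewrite mule_ge0// lee_fin expR_ge0.
- by apply: emeasurable_funM => //; apply: mexp; exact: mvec_id.
pose H y := \int[gaussT l]_z (G y (rv z) * (expR (dotp b1 (rv z) - dotp b1 b1 / 2))%:E).
transitivity (\int[gam]_x H (x + b0)%R).
  apply: eq_integral => x _; rewrite /H -IH.
  - apply: eq_integral => z _; rewrite /G; congr F.
    by rewrite {1}bE add_row_mx -raddfD.
  - by move=> w; exact: F0.
  - by apply: mG => //; exact: mvec_id.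
have H0 x : 0 <= H x.
  by apply: integral_ge0 => z _; rewrite mule_ge0 ?F0// lee_fin expR_ge0.
have mH : measurable_fun setT H.
  apply: (@measurable_fun_fubini_tonelli_F _ _ _ _ _ _ (fun q : R * l.-tuple R => (G q.1 (rv q.2) * (expR (dotp b1 (rv q.2) - dotp b1 b1 / 2))%:E))).
  - apply: emeasurable_funM; first by apply: mG => //; exact: mvec_snd.
    by apply: mexp; exact: mvec_snd.
  - by move=> q; rewrite mule_ge0 ?F0// lee_fin expR_ge0.
apply: (etrans (gauss_cameron_martin b0 H0 mH)).
apply: eq_integral => x _; rewrite /H muleC -ge0_integralZl; [|by []|..].
- apply: eq_integral => z _; rewrite muleCA -EFinM -expRD; congr (_ * (expR _)%:E).
  by rewrite [in RHS]bE !dotp_row_mx; field.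
- apply: emeasurable_funM; first by apply: mG => //; exact: mvec_id.
  by apply: mexp; exact: mvec_id.
- by move=> z _; rewrite mule_ge0 ?F0// lee_fin expR_ge0.
- by rewrite lee_fin expR_ge0.
Qed.

(** By induction the tail contributes |b1| y with y standard Gaussian; then b0 x + |b1| y is
    Gaussian with variance b0^2 + |b1|^2 = |b|^2. *)
Lemma gaussT_linear l (b : 'rV[R]_l) (g : R -> \bar R) :
  (forall x, 0 <= g x) -> measurable_fun setT g ->
  \int[gaussT l]_z g (dotp b (rv z)) = \int[gam]_x g (nrm b * x)%R.
Proof.
elim: l b g => [|l IH] b g g0 mg.
  under eq_integral => z _ do rewrite /dotp big_ord0.
  under [RHS]eq_integral => z _ do rewrite /nrm /dotp big_ord0 sqrtr0 mul0r.
  by rewrite !integral_cst_prob.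
pose b0 := lsubmx (b : 'rV[R]_(1 + l)) 0%R 0%R.
pose b1 := rsubmx (b : 'rV[R]_(1 + l)).
have bE : b = row_mx b0%:M b1 :> 'rV[R]_(1 + l).
  exact: row_mx_hd_tl.
rewrite (ge0_integral_gaussTS (F := fun z => g (dotp b z))); [|by []|]; last first.
  exact: (measurableT_comp mg (mrv_dotp b)).
transitivity (\int[gam]_x \int[gam]_y g (b0 * x + nrm b1 * y)%R).
  apply: eq_integral => x _.
  under eq_integral => z _ do rewrite {1}bE dotp_row_mx.
  rewrite (IH b1 (fun y => g (b0 * x + y)%R)); [by []|by []|].
  by apply: (measurableT_comp mg); apply: measurable_funD.
rewrite gauss_stable; [|by []|by []]; apply: eq_integral => x _; congr (g (_ * _)%R).
by rewrite sqr_nrm /nrm [in RHS]bE dotp_row_mx expr2.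
Qed.

End gaussT.

(** * Taylor estimates for exponential weights *)

Section exptaylor.
Context (R : realType).
Implicit Types y z t : R.

(** A tail term of index k + i is at most |y|^k |y|^i / i!, because (k + i)! >= i!. *)
Lemma expR_taylor k y :
  `|expR y - \sum_(i < k) y ^+ i / i`!%:R| <= `|y| ^+ k * expR `|y|.
Proof.
have cvS (x : R) : series (exp_coeff x) n @[n --> \oo] --> expR x.
  exact: is_cvg_series_exp_coeff.
set P := \sum_(i < k) _.
have cvA : `|series (exp_coeff y) n - P| @[n --> \oo] --> `|expR y - P|.
  by apply: cvg_norm; apply: cvgB => //; exact: cvg_cst.
apply: (cvgr_to_le cvA); near=> n.
have kn : (k <= n)%N by near: n; exists k.
rewrite /series/= (@big_cat_nat _ _ _ k)//= big_mkord.
rewrite -[X in _ - X]/(\sum_(i < k) exp_coeff y i) (addrC (\sum_(i < k) _)) addrK.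
apply: (le_trans (ler_norm_sum _ _ _)).
apply: (@le_trans _ _ (`|y| ^+ k * series (exp_coeff `|y|) (n - k)%N)).
  rewrite -[in leLHS](add0n k) -{1}(subnK kn) big_addn addnK /series/= mulr_sumr.
  apply: ler_sum_nat => i _; rewrite normrM normrX exprD.
  rewrite (mulrC (`|y| ^+ i)) -mulrA ler_wpM2l ?exprn_ge0// /exp_coeff/= ler_wpM2l ?exprn_ge0//.
  rewrite ger0_norm ?invr_ge0// lef_pV2 ?posrE ?ltr0n ?fact_gt0// ler_nat.
  by rewrite leq_fact// leq_addr.
rewrite ler_wpM2l ?exprn_ge0//.
apply: nondecreasing_cvgn_le; last exact: is_cvg_series_exp_coeff.
apply/nondecreasing_seqP => i; rewrite /series/= big_nat_recr//= lerDl.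
exact: exp_coeff_ge0.
Unshelve. all: by end_near. Qed.

Lemma expr_le_expR n (a : R) : 0 <= a -> a ^+ n <= n`!%:R * expR a.
Proof.
move=> a0; case: n => [|n].
  by rewrite expr0 mul1r -[leLHS]expR0 ler_expR.
have := expR_ge1Dxn n a0.
have f0 : 0 < (n.+1)`!%:R :> R by rewrite ltr0n fact_gt0.
move=> h; rewrite mulrC -ler_pdivrMr//; lra.
Qed.

Lemma expR_norm_le z : expR `|z| <= expR z + expR (- z).
Proof.
have [z0|z0] := leP 0 z.
  by rewrite ger0_norm// lerDl expR_ge0.
by rewrite ltr0_norm// lerDr expR_ge0.
Qed.

(** A majorant of 7 exp (2 a) with a = |z| + 1. The 7 is 3! + 1: a^3 <= 3! exp a in a third order
    remainder, plus one exponential for lower order leftovers. Two exponentials replace |z| so that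
    the Gaussian integral is a moment generating function. *)
Definition dom2 z : R := 7 * expR 2 * (expR (2 * z) + expR (- 2 * z)).

Lemma dom2_ge z : 7 * expR (2 * (`|z| + 1)) <= dom2 z.
Proof.
rewrite mulrDr mulr1 expRD /dom2 -!mulrA ler_pM2l// mulrC ler_pM2l ?expR_gt0//.
have -> : 2 * `|z| = `|2 * z| by rewrite normrM ger0_norm.
by rewrite mulNr expR_norm_le.
Qed.

(** For t <= 1 the exponent satisfies |y| <= t a, and the series is cut at order three. For t > 1
    every term is bounded separately, using t^3 >= 1; this is why the weight itself stands on the
    right, where its Gaussian integral is 1 for every t. *)
Lemma weight_taylor2 t z : 0 <= t ->
  `|expR (t * z - t ^+ 2 / 2) - (1 + t * z + t ^+ 2 * (z ^+ 2 - 1) / 2)| <=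
  t ^+ 3 * (expR (t * z - t ^+ 2 / 2) + dom2 z).
Proof.
move=> t0; set y : R := t * z - t ^+ 2 / 2.
set a : R := `|z| + 1.
have a1 : 1 <= a by rewrite lerDr.
have a0 : 0 <= a by rewrite (le_trans _ a1).
have dom := dom2_ge z; rewrite -/a in dom.
have ea : 1 <= expR a by rewrite -expR0 ler_expR.
have e2a : expR (2 * a) = expR a * expR a by rewrite mulrDl mul1r expRD.
have ey := expR_ge0 y.
have [t1|t1] := leP t 1.
  have t2 : t ^+ 2 <= t by rewrite expr2 ler_piMr.
  have ya : `|y| <= t * a.
    rewrite /y (le_trans (ler_normB _ _))// normrM (ger0_norm t0) (ger0_norm (_ : 0 <= t ^+ 2 / 2)); last by rewrite divr_ge0// sqr_ge0.
    by rewrite /a; nra.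
  have ya' : `|y| <= a by rewrite (le_trans ya)// ler_piMl.
  have := expR_taylor 3 y.
  rewrite !big_ord_recl big_ord0 /= /bump /= !add1n !factS fact0 => H.
  have {}H : `|expR y - (1 + y + y ^+ 2 / 2)| <= t ^+ 3 * (6 * expR a * expR a).
    have -> : 1 + y + y ^+ 2 / 2 = y ^+ 0 / 1%:R + (y ^+ 1 / (1 * 1)%:R + (y ^+ 2 / (2 * (1 * 1))%:R + 0)).
      by rewrite !muln1 expr0 expr1; field.
    apply: (le_trans H); rewrite -[6]/(3`!%:R : R).
    rewrite mulrA ler_pM ?exprn_ge0//; last by rewrite ler_expR.
    rewrite (le_trans (lerXn2r _ _ _ ya)) ?nnegrE ?mulr_ge0//.
    by rewrite exprMn ler_wpM2l ?exprn_ge0// expr_le_expR.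
  (* The exponent y has its own quadratic term in t, so y + y^2 / 2 differs from the polynomial in t
     by terms of orders three and four. *)
  have -> : expR y - (1 + t * z + t ^+ 2 * (z ^+ 2 - 1) / 2) =
     (expR y - (1 + y + y ^+ 2 / 2)) + (t ^+ 3 * (t / 8 - z / 2)).
    by rewrite /y; field.
  rewrite (le_trans (ler_normD _ _))//.
  have H2 : `|t ^+ 3 * (t / 8 - z / 2)| <= t ^+ 3 * a.
    rewrite normrM ger0_norm ?exprn_ge0// ler_wpM2l ?exprn_ge0//.
    rewrite (le_trans (ler_normB _ _))// [`|t / 8|]ger0_norm ?divr_ge0// normrM [`|2^-1|]ger0_norm// /a.
    by have := normr_ge0 z; lra.
  have ale := expr_le_expR 1 a0; rewrite expr1 mul1r in ale.
  have t3 : 0 <= t ^+ 3 by rewrite exprn_ge0.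
  rewrite (le_trans (lerD H H2))// -mulrDr ler_wpM2l//.
  by rewrite e2a in dom; nra.
have t3 : 1 <= t ^+ 3 by rewrite exprn_ege1// ltW.
apply: (le_trans (ler_normB _ _)); rewrite (ger0_norm ey) [leRHS]mulrDr; apply: lerD.
  by rewrite ler_peMl.
rewrite (@le_trans _ _ (t ^+ 3 * (2 * a ^+ 2)))//; last first.
  rewrite ler_wpM2l ?(le_trans _ t3)//.
  have := expr_le_expR 2 a0; rewrite -[2`!%:R]/(2%:R : R) => h.
  by rewrite e2a in dom; nra.
have tt3 : t <= t ^+ 3 by rewrite -[leLHS]expr1 ler_eXn2l.
have t23 : t ^+ 2 <= t ^+ 3 by rewrite ler_eXn2l.
rewrite (le_trans (ler_normD _ _))// (@le_trans _ _ (1 + t * `|z| + t ^+ 2 * (`|z| ^+ 2 + 1) / 2))//.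
  rewrite lerD//.
    by rewrite (le_trans (ler_normD _ _))// normr1 normrM (ger0_norm t0).
  rewrite normrM (normrM (t ^+ 2)) (ger0_norm (sqr_ge0 t)) [`|2^-1|]ger0_norm//.
  rewrite ler_wpM2r// ler_wpM2l ?sqr_ge0// (le_trans (ler_normB _ _))// normr1 normrX//.
have z0 := normr_ge0 z.
rewrite /a; move: (`|z|) (t ^+ 3) (t ^+ 2) z0 t3 tt3 t23 => w u v w0 u1 tu vu.
have h1 : t * w <= u * w by rewrite ler_wpM2r.
have h2 : v * (w ^+ 2 + 1) <= u * (w ^+ 2 + 1) by rewrite ler_wpM2r// addr_ge0 ?sqr_ge0.
have h3 : 0 <= u * w by rewrite mulr_ge0//; lra.
have h4 : 0 <= u * w ^+ 2 by rewrite mulr_ge0 ?sqr_ge0//; lra.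
by nra.
Qed.

Lemma weight_taylor0 t z : 0 <= t ->
  `|expR (t * z - t ^+ 2 / 2) - 1| <=
  t * (expR (t * z - t ^+ 2 / 2) + dom2 z).
Proof.
move=> t0; set y : R := t * z - t ^+ 2 / 2.
set a : R := `|z| + 1.
have a1 : 1 <= a by rewrite lerDr.
have a0 : 0 <= a by rewrite (le_trans _ a1).
have dom := dom2_ge z; rewrite -/a in dom.
have ea : 1 <= expR a by rewrite -expR0 ler_expR.
have e2a : expR (2 * a) = expR a * expR a by rewrite mulrDl mul1r expRD.
have ey := expR_ge0 y.
have [t1|t1] := leP t 1.
  have t2 : t ^+ 2 <= t by rewrite expr2 ler_piMr.
  have ya : `|y| <= t * a.
    rewrite /y (le_trans (ler_normB _ _))// normrM (ger0_norm t0) (ger0_norm (_ : 0 <= t ^+ 2 / 2)); last by rewrite divr_ge0// sqr_ge0.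
    by rewrite /a; nra.
  have ya' : `|y| <= a by rewrite (le_trans ya)// ler_piMl.
  have := expR_taylor 1 y.
  rewrite big_ord_recl big_ord0 /= fact0 expr0 divr1 addr0 expr1 => H.
  apply: (le_trans H).
  rewrite (@le_trans _ _ (t * a * expR a))//.
    by rewrite ler_pM// ler_expR.
  rewrite -mulrA ler_wpM2l//.
  have ale := expr_le_expR 1 a0; rewrite expr1 mul1r in ale.
  by rewrite e2a in dom; nra.
rewrite (le_trans (ler_normB _ _))// (ger0_norm ey) normr1.
have : 1 <= dom2 z by rewrite e2a in dom; nra.
by nra.
Qed.

End exptaylor.

(** * Gaussian expectations and their one-dimensional bounds *)

Section gaussexp.
Context (R : realType).
Local Notation gam := (@gaussR R).

Definition Gi l (F : 'rV[R]_l -> R) :=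
  (gaussT R l).-integrable setT (fun t => (F (rv t))%:E).
Definition EG l (F : 'rV[R]_l -> R) : R := \int[gaussT R l]_t F (rv t).

Variable l : nat.
Implicit Types F G : 'rV[R]_l -> R.

Lemma Gi_mrv F : Gi F -> mrv F.
Proof. by move=> /integrableP[/measurable_EFinP]. Qed.

Lemma Gi_cst c : Gi (fun _ : 'rV[R]_l => c).
Proof. exact: (finite_measure_integrable_cst (gaussT R l)). Qed.

Lemma GiD F G : Gi F -> Gi G -> Gi (fun z => F z + G z).
Proof.
move=> iF iG; rewrite /Gi; under eq_fun do rewrite EFinD; exact: integrableD.
Qed.

Lemma GiB F G : Gi F -> Gi G -> Gi (fun z => F z - G z).
Proof.
move=> iF iG; rewrite /Gi; under eq_fun do rewrite EFinB; exact: integrableB.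
Qed.

Lemma GiZ F c : Gi F -> Gi (fun z => c * F z).
Proof.
move=> iF; rewrite /Gi; under eq_fun do rewrite EFinM; exact: integrableZl.
Qed.

Lemma Gi_le F G : mrv F -> Gi G -> (forall z, `|F z| <= G z) -> Gi F.
Proof.
move=> mF iG FG; apply: (le_integrable measurableT _ _ iG).
  exact/measurable_EFinP.
by move=> z _; rewrite /= lee_fin (le_trans (FG _))// ler_norm.
Qed.

Lemma EGD F G : Gi F -> Gi G -> EG (fun z => F z + G z) = EG F + EG G.
Proof. by move=> iF iG; rewrite /EG RintegralD. Qed.

Lemma EGB F G : Gi F -> Gi G -> EG (fun z => F z - G z) = EG F - EG G.
Proof. by move=> iF iG; rewrite /EG RintegralB. Qed.

Lemma EGZ F c : Gi F -> EG (fun z => c * F z) = c * EG F.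
Proof. by move=> iF; rewrite /EG RintegralZl. Qed.

Lemma EG_cst c : EG (fun _ : 'rV[R]_l => c) = c.
Proof. by rewrite /EG /Rintegral integral_cst_prob. Qed.

Lemma Gi_sum (I : Type) (r : seq I) (F : I -> 'rV[R]_l -> R) :
  (forall i, Gi (F i)) -> Gi (fun z => \sum_(i <- r) F i z).
Proof.
move=> iF; elim: r => [|i r IH].
  by under eq_fun do rewrite big_nil; exact: Gi_cst.
by under eq_fun do rewrite big_cons; apply: GiD.
Qed.

Lemma EG_sum (I : Type) (r : seq I) (F : I -> 'rV[R]_l -> R) :
  (forall i, Gi (F i)) -> EG (fun z => \sum_(i <- r) F i z) = \sum_(i <- r) EG (F i).
Proof.
move=> iF; elim: r => [|i r IH].
  by under eq_fun do rewrite big_nil; rewrite EG_cst big_nil.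
under eq_fun do rewrite big_cons; rewrite EGD ?IH ?big_cons//.
exact: Gi_sum.
Qed.

Lemma EG_le F G : Gi F -> Gi G -> (forall z, F z <= G z) -> EG F <= EG G.
Proof. by move=> iF iG FG; apply: le_Rintegral. Qed.

Lemma EG_norm_le F G : Gi F -> Gi G -> (forall z, `|F z| <= G z) -> `|EG F| <= EG G.
Proof.
move=> iF iG FG; rewrite ler_norml; apply/andP; split; last first.
  by apply: EG_le => // z; rewrite (le_trans (ler_norm _)).
rewrite -mulN1r -EGZ//; apply: EG_le => //; first exact: GiZ.
by move=> z; rewrite mulN1r lerNl (le_trans _ (FG z))// -normrN ler_norm.
Qed.

Lemma Gi_bounded F c : mrv F -> (forall z, `|F z| <= c) -> Gi F.
Proof. by move=> mF Fc; apply: (Gi_le mF (Gi_cst c)). Qed.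

Lemma EG_bound_ge0 F c : mrv F -> (forall z, 0 <= F z) ->
  (\int[gaussT R l]_t (F (rv t))%:E <= c%:E)%E -> Gi F /\ EG F <= c.
Proof.
move=> mF F0 Fc.
have iF : Gi F.
  apply/integrableP; split; first exact/measurable_EFinP.
  under eq_integral do rewrite gee0_abs ?lee_fin//.
  by rewrite (le_lt_trans Fc)// ltry.
split => //; rewrite -lee_fin /EG /Rintegral fineK//.
by apply: integrable_fin_num => //.
Qed.

Lemma integral_linear (G : R -> R) (b : 'rV[R]_l) :
  measurable_fun setT G -> (forall z, 0 <= G z) ->
  (\int[gaussT R l]_z (G (dotp b (rv z)))%:E = \int[gam]_x (G (nrm b * x)%R)%:E)%E.
Proof.
move=> mG G0.
apply: (gaussT_linear b (g := fun x => (G x)%:E)); [by move=> x; rewrite lee_fin|exact/measurable_EFinP].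
Qed.

Local Open Scope ereal_scope.

Lemma gauss_weight (t : R) : \int[gam]_x (expR (t * x - t ^+ 2 / 2))%:E = 1.
Proof.
transitivity (\int[gam]_x (cst 1 (x + t)%R)); last by rewrite integral_cst_prob.
rewrite (gauss_cameron_martin t (g := cst 1)) //.
by apply: eq_integral => x _; rewrite mul1e.
Qed.

Lemma gauss_mgf (a : R) : \int[gam]_x (expR (a * x))%:E = (expR (a ^+ 2 / 2))%:E.
Proof.
have m1 : measurable_fun [set: R] (fun x : R => (expR (a * x))%:E).
  by apply/measurable_EFinP; apply: measurableT_comp => //; apply: measurable_funM.
have := gauss_weight a => /(congr1 (fun z => (expR (a ^+ 2 / 2))%:E * z)).
rewrite mule1 => <-; rewrite -ge0_integralZl; [|by []|..].
- by apply: eq_integral => x _; rewrite -EFinM -expRD addrC subrK.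
- apply/measurable_EFinP; apply: measurableT_comp => //.
  by apply: measurable_funB => //; apply: measurable_funM.
- by move=> x _; rewrite lee_fin expR_ge0.
- by rewrite lee_fin expR_ge0.
Qed.

(* The Gaussian integral of the bound of [weight_taylor2], up to [t ^+ 3]. *)
Definition wcst : R := (1 + 14 * expR 4)%R.

Lemma mexpR_affine (a c : R) : measurable_fun [set: R] (fun x : R => expR (a * x - c))%R.
Proof. by apply: measurableT_comp => //; apply: measurable_funB => //; apply: measurable_funM. Qed.

Lemma mdom2 : measurable_fun [set: R] (@dom2 R).
Proof.
apply: measurable_funM => //; apply: measurable_funD => //.
- by apply: measurableT_comp => //; apply: measurable_funM.
- by apply: measurableT_comp => //; apply: measurable_funM.
Qed.

Lemma dom2_ge0 (x : R) : (0 <= dom2 x)%R.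
Proof. by rewrite /dom2 !mulr_ge0 ?addr_ge0 ?expR_ge0. Qed.

Lemma integral_dom2 : \int[gam]_x (dom2 x)%:E = (14 * expR 4)%:E.
Proof.
have m1 (a : R) : measurable_fun [set: R] (fun x : R => (expR (a * x))%:E).
  by apply/measurable_EFinP; apply: measurableT_comp => //; apply: measurable_funM.
under eq_integral do rewrite /dom2 EFinM EFinD.
rewrite ge0_integralZl; [|by []|..].
- rewrite ge0_integralD//=; [|by move=> x _; rewrite lee_fin expR_ge0..].
  rewrite !gauss_mgf -EFinD -EFinM sqrrN; congr EFin.
  have -> : (2 ^+ 2 / 2 = 2 :> R)%R by field.
  have -> : (expR 4 = expR 2 * expR 2 :> R)%R by rewrite -expRD; congr expR; ring.
  by ring.
- exact: emeasurable_funD.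
- by move=> x _; rewrite adde_ge0// lee_fin expR_ge0.
- by rewrite lee_fin mulr_ge0 ?expR_ge0.
Qed.

Lemma integral_weight (t : R) :
  \int[gam]_x (expR (t * x - t ^+ 2 / 2) + dom2 x)%:E = wcst%:E.
Proof.
have m1 : measurable_fun [set: R] (fun x : R => (expR (t * x - t ^+ 2 / 2))%:E).
  by apply/measurable_EFinP; exact: mexpR_affine.
under eq_integral do rewrite EFinD.
rewrite ge0_integralD; [|by []|..].
- by rewrite integral_dom2 gauss_weight.
- by move=> x _; rewrite lee_fin expR_ge0.
- by [].
- by move=> x _; rewrite lee_fin dom2_ge0.
- by apply/measurable_EFinP; exact: mdom2.
Qed.

(** A power of |x| is dominated by k! exp |x|, hence by k! [dom2 x]. *)
Lemma integral_pow k :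
  \int[gam]_x ((`|x| ^+ k)%R)%:E <= (k`!%:R * (14 * expR 4))%:E.
Proof.
rewrite [leRHS]EFinM -integral_dom2 -ge0_integralZl; [|by []|..].
- apply: ge0_le_integral => //.
  + by apply/measurable_EFinP; apply: measurable_funX; exact: normr_measurable.
  + by apply: emeasurable_funM => //; apply/measurable_EFinP; exact: mdom2.
  + move=> x _; rewrite -EFinM lee_fin (le_trans (expr_le_expR k (normr_ge0 x)))//.
    rewrite ler_wpM2l// (le_trans _ (dom2_ge x))//.
    have x0 := normr_ge0 x.
    have h1 : (expR `|x| <= expR (2 * (`|x| + 1)))%R by rewrite ler_expR; lra.
    by have := expR_ge0 (2 * (`|x| + 1))%R; lra.
- by apply/measurable_EFinP; exact: mdom2.
- by move=> x _; rewrite lee_fin dom2_ge0.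
- by rewrite lee_fin.
Qed.

End gaussexp.

(** * Gaussian moments and expansions under translation *)

Section moments.
Context (R : realType).
Local Notation gam := (@gaussR R).
Local Notation W := (wcst R).

Lemma Gi_dotp_pow l (b : 'rV[R]_l) k : Gi (fun z => `|dotp b z| ^+ k).
Proof.
have mk : measurable_fun [set: R] (fun x : R => `|x| ^+ k).
  by apply: measurable_funX; exact: normr_measurable.
apply: (proj1 (EG_bound_ge0 (c := nrm b ^+ k * (k`!%:R * (14 * expR 4))) _ _ _)).
- exact: (measurableT_comp mk (mrv_dotp b)).
- by move=> z; rewrite exprn_ge0.
- rewrite (integral_linear (G := fun x => `|x| ^+ k)); [|by []|by move=> z; rewrite exprn_ge0].
  under eq_integral do rewrite normrM exprMn (ger0_norm (nrm_ge0 b)) EFinM.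
  rewrite ge0_integralZl; [|by []|exact/measurable_EFinP|..].
  + rewrite EFinM; apply: lee_wpmul2l; first by rewrite lee_fin exprn_ge0 ?nrm_ge0.
    exact: integral_pow.
  + by move=> x _; rewrite lee_fin exprn_ge0.
  + by rewrite lee_fin exprn_ge0 ?nrm_ge0.
Qed.

Lemma Gi_dotp l (b : 'rV[R]_l) : Gi (dotp b).
Proof. by apply: (Gi_le (mrv_dotp b) (Gi_dotp_pow b 1)) => z; rewrite expr1. Qed.

Lemma mrvM l (F G : 'rV[R]_l -> R) : mrv F -> mrv G -> mrv (fun z => F z * G z).
Proof. by move=> mF mG; apply: measurable_funM. Qed.

Lemma Gi_dotpM l (b c : 'rV[R]_l) : Gi (fun z => dotp b z * dotp c z).
Proof.
apply: (Gi_le (mrvM (mrv_dotp b) (mrv_dotp c)) (GiD (Gi_dotp_pow b 2) (Gi_dotp_pow c 2))) => z.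
rewrite normrM; have h1 := normr_ge0 (dotp b z); have h2 := normr_ge0 (dotp c z).
by nra.
Qed.

Lemma Gi_dotp2 l (b : 'rV[R]_l) : Gi (fun z => dotp b z ^+ 2).
Proof. exact: Gi_dotpM. Qed.

Lemma dotpNl l (b z : 'rV[R]_l) : dotp (- b) z = - dotp b z.
Proof. by rewrite -scaleN1r dotpZl mulN1r. Qed.

(** The negative part of b . z is the positive part of (- b) . z, and the integral of the positive
    part depends on [b] only through |b|. *)
Lemma EG_dotp l (b : 'rV[R]_l) : EG (dotp b) = 0.
Proof.
rewrite /EG /Rintegral integralE.
have mp : measurable_fun [set: R] (fun x : R => Num.max x 0).
  by apply: measurable_maxr.
have -> : (fun t : l.-tuple R => (dotp b (rv t))%:E)^\+%E = (fun t => (Num.max (dotp b (rv t)) 0)%:E).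
  by apply/funext => t; rewrite funeposE EFin_max.
have -> : (fun t : l.-tuple R => (dotp b (rv t))%:E)^\-%E = (fun t => (Num.max (dotp (- b) (rv t)) 0)%:E).
  by apply/funext => t; rewrite funenegE EFin_max dotpNl.
rewrite !(integral_linear (G := fun x => Num.max x 0)); [|by []|by move=> z; rewrite le_max lexx orbT|by []|by move=> z; rewrite le_max lexx orbT].
rewrite -scaleN1r nrmZ normrN1 mul1r.
set I := integral _ _ _.
by case: I => [r| |] //=; rewrite ?subrr.
Qed.

(** The Cameron-Martin density of the translation by [b], followed by the part of order at most two
    in [b] of its expansion. *)
Definition weight l (b z : 'rV[R]_l) : R := expR (dotp b z - dotp b b / 2).
Definition weight2 l (b z : 'rV[R]_l) : R :=
  1 + dotp b z + (dotp b z ^+ 2 - dotp b b) / 2.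

Lemma weight_ge0 l (b z : 'rV[R]_l) : 0 <= weight b z.
Proof. exact: expR_ge0. Qed.

Lemma mrv_weight l (b : 'rV[R]_l) : mrv (weight b).
Proof.
apply: measurableT_comp => //; apply: measurable_funB => //; exact: mrv_dotp.
Qed.

Lemma Gi_weight l (b : 'rV[R]_l) : Gi (weight b).
Proof.
apply: (proj1 (EG_bound_ge0 (c := 1) (mrv_weight b) (weight_ge0 b) _)).
have -> : (1%:E = \int[gaussT R l]_t (cst 1%E (rv t + b)%R))%E by rewrite integral_cst_prob.
rewrite (gaussT_cameron_martin b (F := cst 1%E)) //; last exact: measurable_cst.
by under [leRHS]eq_integral do rewrite mul1e.
Qed.

Lemma EG_shift l (b : 'rV[R]_l) (F : 'rV[R]_l -> R) : mrv F -> (forall z, 0 <= F z) ->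
  EG (fun z => F (z + b)) = EG (fun z => F z * weight b z).
Proof.
move=> mF F0; rewrite /EG /Rintegral; congr fine.
rewrite (gaussT_cameron_martin b (F := fun z => (F z)%:E)).
- by apply: eq_integral => z _; rewrite EFinM.
- by move=> z; rewrite lee_fin.
- exact/measurable_EFinP.
Qed.

Lemma EG_weight l (b : 'rV[R]_l) : EG (weight b) = 1.
Proof.
have := EG_shift b (F := fun=> 1) (measurable_cst _) (fun=> ler01).
rewrite EG_cst => ->.
by rewrite /EG; apply: eq_Rintegral => z _; rewrite mul1r.
Qed.

(** The remainder depends on [z] only through b . z, so its integral reduces to dimension one and
    the constant is independent of [l]. *)
Lemma weight_rem2 l (b : 'rV[R]_l) :
  Gi (fun z => `|weight b z - weight2 b z|) /\
  EG (fun z => `|weight b z - weight2 b z|) <= W * nrm b ^+ 3.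
Proof.
set t := nrm b; have t0 : 0 <= t := nrm_ge0 b.
pose G x : R := `|expR (x - t ^+ 2 / 2) - (1 + x + (x ^+ 2 - t ^+ 2) / 2)|.
have mG : measurable_fun setT G.
  apply: measurableT_comp; first exact: normr_measurable.
  apply: measurable_funB; first by apply: measurableT_comp => //; exact: measurable_funB.
  apply: measurable_funD; first exact: measurable_funD.
  apply: measurable_funM => //; apply: measurable_funB => //; exact: measurable_funX.
have E z : `|weight b z - weight2 b z| = G (dotp b z).
  by rewrite /G /weight /weight2 /t sqr_nrm.
apply: EG_bound_ge0.
- by rewrite /mrv; under eq_fun do rewrite E; exact: (measurableT_comp mG (mrv_dotp b)).
- by [].
under eq_integral do rewrite E.
rewrite (integral_linear (G := G)); [|by []|by move=> z; exact: normr_ge0].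
rewrite mulrC EFinM -(integral_weight t) -ge0_integralZl; [|by []|..].
- apply: ge0_le_integral => //.
  + by move=> x _; rewrite lee_fin; exact: normr_ge0.
  + by apply/measurable_EFinP; apply: (measurableT_comp mG); exact: measurable_funM.
  + apply: emeasurable_funM => //; apply/measurable_EFinP.
    by apply: measurable_funD; [exact: mexpR_affine|exact: mdom2].
  + move=> x _; rewrite -EFinM lee_fin; apply: le_trans (weight_taylor2 x t0).
    rewrite /G -/t (_ : ((t * x) ^+ 2 - t ^+ 2) / 2 = t ^+ 2 * (x ^+ 2 - 1) / 2)//.
    by field.
- by apply/measurable_EFinP; apply: measurable_funD; [exact: mexpR_affine|exact: mdom2].
- by move=> x _; rewrite lee_fin addr_ge0 ?expR_ge0 ?dom2_ge0.
- by rewrite lee_fin exprn_ge0.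
Qed.

Lemma weight_rem0 l (b : 'rV[R]_l) :
  Gi (fun z => `|weight b z - 1|) /\
  EG (fun z => `|weight b z - 1|) <= W * nrm b.
Proof.
set t := nrm b; have t0 : 0 <= t := nrm_ge0 b.
pose G x : R := `|expR (x - t ^+ 2 / 2) - 1|.
have mG : measurable_fun setT G.
  apply: measurableT_comp; first exact: normr_measurable.
  apply: measurable_funB => //; by apply: measurableT_comp => //; exact: measurable_funB.
have E z : `|weight b z - 1| = G (dotp b z) by rewrite /G /weight /t sqr_nrm.
apply: EG_bound_ge0.
- by rewrite /mrv; under eq_fun do rewrite E; exact: (measurableT_comp mG (mrv_dotp b)).
- by [].
under eq_integral do rewrite E.
rewrite (integral_linear (G := G)); [|by []|by move=> z; exact: normr_ge0].
rewrite mulrC EFinM -(integral_weight t) -ge0_integralZl; [|by []|..].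
- apply: ge0_le_integral => //.
  + by move=> x _; rewrite lee_fin; exact: normr_ge0.
  + by apply/measurable_EFinP; apply: (measurableT_comp mG); exact: measurable_funM.
  + apply: emeasurable_funM => //; apply/measurable_EFinP.
    by apply: measurable_funD; [exact: mexpR_affine|exact: mdom2].
  + by move=> x _; rewrite -EFinM lee_fin; exact: (weight_taylor0 x t0).
- by apply/measurable_EFinP; apply: measurable_funD; [exact: mexpR_affine|exact: mdom2].
- by move=> x _; rewrite lee_fin addr_ge0 ?expR_ge0 ?dom2_ge0.
- by rewrite lee_fin.
Qed.

Lemma Gi_weight2 l (b : 'rV[R]_l) : Gi (weight2 b).
Proof.
rewrite /weight2; apply: GiD; first by apply: GiD; [exact: Gi_cst|exact: Gi_dotp].
under eq_fun do rewrite mulrC; apply: GiZ; apply: GiB; [exact: Gi_dotp2|exact: Gi_cst].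
Qed.

Lemma EG_weight2 l (b : 'rV[R]_l) :
  EG (weight2 b) = 1 + (EG (fun z => dotp b z ^+ 2) - nrm b ^+ 2) / 2.
Proof.
rewrite /weight2 EGD.
- rewrite EGD ?EG_cst ?EG_dotp ?addr0; [|exact: Gi_cst|exact: Gi_dotp].
  under eq_fun do rewrite mulrC.
  rewrite EGZ ?EGB ?EG_cst ?sqr_nrm; [by rewrite mulrC|exact: Gi_dotp2|exact: Gi_cst|].
  by apply: GiB; [exact: Gi_dotp2|exact: Gi_cst].
- by apply: GiD; [exact: Gi_cst|exact: Gi_dotp].
- under eq_fun do rewrite mulrC; apply: GiZ; apply: GiB; [exact: Gi_dotp2|exact: Gi_cst].
Qed.

Lemma wcst_gt0 : 0 < W.
Proof. by rewrite /wcst ltr_wpDr// mulr_ge0 ?expR_ge0. Qed.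

(** The variance [M2] is read off the expansion of the weight. With t = |b|, the means of [weight b]
    and [weight2 b] are 1 and 1 + t^2 (M2 - 1) / 2, and they differ by O(t^3); letting t tend to 0
    forces M2 = 1. *)
Lemma EG_dotp2 l (b : 'rV[R]_l) : EG (fun z => dotp b z ^+ 2) = nrm b ^+ 2.
Proof.
pose M2 : R := fine (\int[gam]_x (x ^+ 2)%:E)%E.
have msq : measurable_fun [set: R] (fun x : R => x ^+ 2) by exact: measurable_funX.
have scale l' (c : 'rV[R]_l') : EG (fun z => dotp c z ^+ 2) = nrm c ^+ 2 * M2.
  rewrite /EG /Rintegral (integral_linear (G := fun x => x ^+ 2)); [|by []|by move=> z; exact: sqr_ge0].
  under eq_integral do rewrite exprMn EFinM.
  rewrite ge0_integralZl; [|by []|exact/measurable_EFinP|..].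
  - rewrite fineM//.
    rewrite ge0_fin_numE; last by apply: integral_ge0 => x _; rewrite lee_fin sqr_ge0.
    apply: (@le_lt_trans _ _ (2`!%:R * (14 * expR 4))%:E); last by rewrite ltry.
    apply: le_trans (integral_pow R 2).
    by under [leRHS]eq_integral do rewrite real_normK ?num_real//.
  - by move=> x _; rewrite lee_fin sqr_ge0.
  - by rewrite lee_fin sqr_ge0.
suff M21 : M2 = 1 by rewrite scale M21 mulr1.
have key t : 0 <= t -> `|t ^+ 2 * (M2 - 1) / 2| <= W * t ^+ 3.
  move=> t0; pose c : 'rV[R]_1 := const_mx t.
  have nc : nrm c = t by rewrite /nrm /dotp big_ord1 !mxE -expr2 sqrtr_sqr ger0_norm.
  have [iw wle] := weight_rem2 c; rewrite nc in wle.
  apply: le_trans wle.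
  have -> : t ^+ 2 * (M2 - 1) / 2 = - EG (fun z => weight c z - weight2 c z).
    rewrite EGB; [|exact: Gi_weight|exact: Gi_weight2].
    by rewrite EG_weight EG_weight2 scale nc; ring.
  rewrite normrN; apply: EG_norm_le => //.
  by apply: GiB; [exact: Gi_weight|exact: Gi_weight2].
apply/eqP; rewrite -subr_eq0 -normr_le0.
apply/ler_addgt0Pl => e e0; rewrite addr0.
(* This value turns W t^3 into t^2 e / 2. *)
pose t := e / (2 * W).
have w0 := wcst_gt0.
have t0 : 0 < t by rewrite divr_gt0// mulr_gt0.
have := key t (ltW t0).
rewrite normrM (normrM (t ^+ 2)) (gtr0_norm (exprn_gt0 2 t0)) [`|2^-1|]ger0_norm//.
have -> : W * t ^+ 3 = t ^+ 2 * (e / 2) by rewrite /t; field; rewrite gt_eqF.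
by rewrite -mulrA ler_pM2l ?exprn_gt0// ler_pM2r.
Qed.

Lemma Gi_norm l (F : 'rV[R]_l -> R) : Gi F -> Gi (fun z => `|F z|).
Proof. by move=> iF; exact: integrable_norm. Qed.

Lemma GiM1 l (F G : 'rV[R]_l -> R) : mrv F -> (forall z, 0 <= F z <= 1) ->
  Gi G -> Gi (fun z => F z * G z).
Proof.
move=> mF F01 iG; apply: (Gi_le _ (Gi_norm iG)).
  by apply: mrvM => //; exact: Gi_mrv.
move=> z; have /andP[F0 F1] := F01 z.
by rewrite normrM (ger0_norm F0) ler_piMl.
Qed.

Lemma EG_mul_le l (F G : 'rV[R]_l -> R) : mrv F -> (forall z, 0 <= F z <= 1) ->
  Gi G -> `|EG (fun z => F z * G z)| <= EG (fun z => `|G z|).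
Proof.
move=> mF F01 iG; apply: EG_norm_le; [exact: GiM1|exact: Gi_norm|].
move=> z; have /andP[F0 F1] := F01 z.
by rewrite normrM (ger0_norm F0) ler_piMl.
Qed.

Lemma coord_dotp l (i : 'I_l) (z : 'rV[R]_l) : z 0 i = dotp (delta_mx 0 i) z.
Proof.
rewrite /dotp (bigD1 i)//= mxE !eqxx mul1r big1 ?addr0// => j ji.
by rewrite mxE (negbTE ji) andbF mul0r.
Qed.

Lemma eq_EG l (F G : 'rV[R]_l -> R) : F =1 G -> EG F = EG G.
Proof. by move=> FG; apply: eq_Rintegral => z _; rewrite FG. Qed.

Lemma eq_Gi l (F G : 'rV[R]_l -> R) : F =1 G -> Gi F -> Gi G.
Proof. by move=> /funext ->. Qed.

(** Since [F] is only measurable, the expansion is that of the weight by which the translation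
    multiplies it. The coefficients are the Gaussian means of F(z) z_i and of F(z) (z_i z_j -
    delta_ij) / 2. *)
Lemma EG_taylor2 l (F : 'rV[R]_l -> R) : mrv F -> (forall z, 0 <= F z <= 1) ->
  exists (c1 : 'rV[R]_l) (c2 : 'M[R]_l), forall b,
  `|EG (fun z => F (z + b)) - (EG F + dotp b c1 + (b *m c2 *m b^T) 0 0)|
  <= W * nrm b ^+ 3.
Proof.
move=> mF F01.
have F0 z : 0 <= F z by have /andP[] := F01 z.
have iF : Gi F.
  by apply: (Gi_bounded mF (c := 1)) => z; have /andP[h0 h1] := F01 z; rewrite ger0_norm.
pose m1 i := EG (fun z => F z * z 0 i).
pose m2 i j := EG (fun z => F z * (z 0 i * z 0 j)).
have i1 i : Gi (fun z : 'rV[R]_l => F z * z 0 i).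
  apply: GiM1 => //; apply: (eq_Gi (F := dotp (delta_mx 0 i))); last exact: Gi_dotp.
  by move=> z; rewrite coord_dotp.
have i2 i j : Gi (fun z : 'rV[R]_l => F z * (z 0 i * z 0 j)).
  apply: GiM1 => //; apply: (eq_Gi (F := fun z => dotp (delta_mx 0 i) z * dotp (delta_mx 0 j) z)); last exact: Gi_dotpM.
  by move=> z; rewrite -!coord_dotp.
exists (\row_i m1 i), (\matrix_(i, j) ((m2 i j - (i == j)%:R * EG F) / 2)) => b.
rewrite EG_shift//.
have e1 : EG (fun z => F z * dotp b z) = dotp b (\row_i m1 i).
  under eq_EG do rewrite /dotp mulr_sumr.
  rewrite EG_sum; last first.
    move=> i; apply: (eq_Gi (F := fun z => b 0 i * (F z * z 0 i))); first by move=> z; rewrite mulrCA.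
    exact: GiZ.
  apply: eq_bigr => i _; rewrite mxE /m1 -EGZ//.
  by apply: eq_EG => z; rewrite mulrCA.
have e2 : EG (fun z => F z * dotp b z ^+ 2) = \sum_i \sum_j b 0 i * b 0 j * m2 i j.
  have E z : F z * dotp b z ^+ 2 = \sum_i \sum_j b 0 i * b 0 j * (F z * (z 0 i * z 0 j)).
    rewrite expr2 {1}/dotp mulr_suml mulr_sumr; apply: eq_bigr => i _.
    by rewrite /dotp !mulr_sumr; apply: eq_bigr => j _; ring.
  rewrite (eq_EG E) EG_sum; last first.
    by move=> i; apply: Gi_sum => j; apply: GiZ.
  apply: eq_bigr => i _; rewrite EG_sum; last by move=> j; apply: GiZ.
  by apply: eq_bigr => j _; rewrite EGZ.
have -> : EG F + dotp b (\row_i m1 i) + (b *m (\matrix_(i, j) ((m2 i j - (i == j)%:R * EG F) / 2)) *m b^T) 0 0 = EG (fun z => F z * weight2 b z).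
  have E z : F z * weight2 b z = F z + F z * dotp b z + 2^-1 * (F z * dotp b z ^+ 2 - dotp b b * F z).
    by rewrite /weight2; field.
  have j1 : Gi (fun z => F z * dotp b z) by apply: GiM1 => //; exact: Gi_dotp.
  have j2 : Gi (fun z => F z * dotp b z ^+ 2) by apply: GiM1 => //; exact: Gi_dotp2.
  have j3 : Gi (fun z => dotp b b * F z) by exact: GiZ.
  rewrite (eq_EG E) EGD; [|exact: GiD|by apply: GiZ; exact: GiB].
  rewrite EGD// e1 EGZ; last exact: GiB.
  rewrite EGB// EGZ// e2; congr (_ + _).
  rewrite mxE; under eq_bigr do rewrite !mxE mulr_suml.
  rewrite exchange_big/= mulrBr [dotp b b in RHS]/dotp mulr_suml !mulr_sumr -sumrB.
  apply: eq_bigr => i _; rewrite mulr_sumr.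
  under eq_bigr do rewrite !mxE mulrBl mulrBr mulrBl.
  rewrite sumrB; congr (_ - _); first by apply: eq_bigr => j _; ring.
  rewrite (bigD1 i)//= eqxx big1 ?addr0; last first.
    by move=> j ji; rewrite eq_sym (negbTE ji) !mul0r mulr0 mul0r.
  by rewrite -[true%:R]/(1 : R); ring.
have iw : Gi (fun z => weight b z - weight2 b z).
  by apply: GiB; [exact: Gi_weight|exact: Gi_weight2].
rewrite -EGB; [|by apply: GiM1 => //; exact: Gi_weight|by apply: GiM1 => //; exact: Gi_weight2].
under eq_EG do rewrite -mulrBr.
apply: (le_trans (EG_mul_le mF F01 iw)).
by have [] := weight_rem2 b.
Qed.

Lemma EG_lipschitz l (F : 'rV[R]_l -> R) (b : 'rV[R]_l) :
  mrv F -> (forall z, 0 <= F z <= 1) ->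
  `|EG (fun z => F (z + b)) - EG F| <= W * nrm b.
Proof.
move=> mF F01.
have F0 z : 0 <= F z by have /andP[] := F01 z.
have iF : Gi F.
  by apply: (Gi_bounded mF (c := 1)) => z; have /andP[h0 h1] := F01 z; rewrite ger0_norm.
rewrite EG_shift// -EGB//; last by apply: GiM1 => //; exact: Gi_weight.
have E z : F z * weight b z - F z = F z * (weight b z - 1) by rewrite mulrBr mulr1.
rewrite (eq_EG E).
have iw : Gi (fun z => weight b z - 1) by apply: GiB; [exact: Gi_weight|exact: Gi_cst].
apply: (le_trans (EG_mul_le mF F01 iw)).
by have [] := weight_rem0 b.
Qed.

(** Polarization of [EG_dotp2]. *)
Lemma EG_dotpM l (b c : 'rV[R]_l) : EG (fun z => dotp b z * dotp c z) = dotp b c.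
Proof.
have E z : dotp b z * dotp c z = 2^-1 * (dotp (b + c) z ^+ 2 - (dotp b z ^+ 2 + dotp c z ^+ 2)).
  by rewrite dotpDl; field.
rewrite (eq_EG E) EGZ; last by apply: GiB; [exact: Gi_dotp2|apply: GiD; exact: Gi_dotp2].
rewrite EGB; [|exact: Gi_dotp2|apply: GiD; exact: Gi_dotp2].
rewrite EGD; [|exact: Gi_dotp2..].
by rewrite !EG_dotp2 !sqr_nrm dotpDl !dotpDr (dotpC c b); field.
Qed.

End moments.

Lemma quad_disc (R : realType) (a b c : R) : 0 <= c ->
  (forall t, 0 <= a - 2 * t * b + t ^+ 2 * c) -> b ^+ 2 <= a * c.
Proof.
move=> c0 H; have [cc0|cc0] := eqVneq c 0.
  rewrite cc0 mulr0 in H *.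
  have [->|b0] := eqVneq b 0; first by rewrite expr0n.
  have := H ((a + 1) / (2 * b)).
  rewrite [leRHS](_ : _ = -1); last by field.
  by rewrite ler0N1.
have cp : 0 < c by rewrite lt_def cc0 c0.
have := H (b / c).
rewrite (_ : _ + _ = a - b ^+ 2 / c); last by field.
by rewrite subr_ge0 ler_pdivrMr.
Qed.

(** * Gaussian smoothing operators *)

Section smoothing.
Context (R : realType) (l m : nat) (A : 'M[R]_(l, m)).
Implicit Types f g h : 'rV[R]_m -> R.
Local Notation W := (wcst R).

Definition meas01 f := mrv f /\ forall x, 0 <= f x <= 1.

Definition smooth (s : R) f (x : 'rV[R]_m) : R := EG (fun z => f (x + s *: (z *m A))).

Lemma mvec_smooth_arg s (x : 'rV[R]_m) d (T : measurableType d) (g : T -> 'rV[R]_l) :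
  mvec g -> mvec (fun t => x + s *: (g t *m A)).
Proof. by move=> mg; apply: mvecD; [exact: mvec_cst|apply: mvecZ; exact: mvecM]. Qed.

Lemma mrv_smooth_arg s f (x : 'rV[R]_m) : mrv f ->
  mrv (fun z : 'rV[R]_l => f (x + s *: (z *m A))).
Proof. by move=> mf; apply: (mrv_comp mf); apply: mvec_smooth_arg; exact: mvec_id. Qed.

Lemma Gi01 (F : 'rV[R]_l -> R) : mrv F -> (forall z, 0 <= F z <= 1) -> Gi F.
Proof.
move=> mF F01; apply: (Gi_bounded mF (c := 1)) => z.
by have /andP[h0 h1] := F01 z; rewrite ger0_norm.
Qed.

Lemma Gi_smooth_arg s f x : meas01 f -> Gi (fun z : 'rV[R]_l => f (x + s *: (z *m A))).
Proof. by move=> [mf f01]; apply: Gi01 => //; exact: mrv_smooth_arg. Qed.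

Lemma EFin_smooth s f x : meas01 f ->
  (smooth s f x)%:E = (\int[gaussT R l]_z (f (x + s *: (rv z *m A)))%:E)%E.
Proof.
move=> mf; rewrite /smooth /EG /Rintegral fineK//.
by apply: integrable_fin_num => //; exact: (Gi_smooth_arg s x mf).
Qed.

Lemma smooth01 s f : meas01 f -> meas01 (smooth s f).
Proof.
move=> mf; split; last first.
  move=> x; apply/andP; split.
    by apply: Rintegral_ge0 => z _; have /andP[] := mf.2 (x + s *: (rv z *m A)).
  rewrite -(@EG_cst R l 1); apply: EG_le; [exact: Gi_smooth_arg|exact: Gi_cst|].
  by move=> z; have /andP[] := mf.2 (x + s *: (z *m A)).
apply/measurable_EFinP.
rewrite (_ : EFin \o _ = fun t : m.-tuple R => (\int[gaussT R l]_z (f (rv t + s *: (rv z *m A)))%:E)%E).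
  apply: (@measurable_fun_fubini_tonelli_F _ _ _ _ _ _ (fun q : m.-tuple R * l.-tuple R => (f (rv q.1 + s *: (rv q.2 *m A)))%:E)).
  - apply/measurable_EFinP; apply: (mrv_comp mf.1); apply: mvecD; first exact: mvec_fst.
    by apply: mvecZ; apply: mvecM; exact: mvec_snd.
  - by move=> q; rewrite lee_fin; have /andP[] := mf.2 (rv q.1 + s *: (rv q.2 *m A)).
by apply/funext => t; rewrite /= EFin_smooth.
Qed.

(** The right-hand side is symmetric in [s] and [t], which yields the commutation of smoothings in
    step (3). *)
Lemma smooth_stable s t f x : meas01 f ->
  smooth s (smooth t f) x = smooth (Num.sqrt (s ^+ 2 + t ^+ 2)) f x.
Proof.
move=> mf; apply: EFin_inj; rewrite !EFin_smooth//; last exact: smooth01.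
under eq_integral do rewrite EFin_smooth//.
have f0 y : 0 <= f y by have /andP[] := mf.2 y.
under [RHS]eq_integral do rewrite scalemxAl.
apply: etrans (gaussT_stable s t (F := fun z => (f (x + z *m A))%:E) _ _).
- apply: eq_integral => z _; apply: eq_integral => w _.
  by rewrite mulmxDl -!scalemxAl addrA.
- by move=> z; rewrite lee_fin.
- apply/measurable_EFinP; apply: (mrv_comp mf.1); apply: mvecD; first exact: mvec_cst.
  by apply: mvecM; exact: mvec_id.
Qed.

Lemma smooth_contract s f g x c : meas01 f -> meas01 g ->
  (forall y, `|f y - g y| <= c) -> `|smooth s f x - smooth s g x| <= c.
Proof.
move=> mf mg fg; rewrite /smooth -EGB; [|exact: Gi_smooth_arg..].
rewrite -[leRHS](@EG_cst R l); apply: EG_norm_le => //; last exact: Gi_cst.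
by apply: GiB; exact: Gi_smooth_arg.
Qed.

Variable B : 'M[R]_(m, l).
Hypothesis BA : B *m A = 1%:M.

(* For B = Sigma^-1 A^T with Sigma = A^T A, its square is u Sigma^-1 u^T. *)
Definition bnorm (u : 'rV[R]_m) := nrm (u *m B).

(** Since u B A = u, translating the point by [u] amounts to translating the Gaussian vector by u B
    / e, of norm |u| / e. *)
Lemma smooth_shiftE (e : R) f x u : meas01 f -> 0 < e ->
  EG (fun z => f (x + e *: ((z + e^-1 *: (u *m B)) *m A))) = smooth e f (x + u).
Proof.
move=> mf e0; apply: eq_EG => z; congr f.
by rewrite mulmxDl scalerDr -scalemxAl scalerA divff ?gt_eqF// scale1r -mulmxA BA mulmx1 -addrA (addrC u).
Qed.

Lemma smooth_taylor2 (e : R) f x : 0 < e -> meas01 f ->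
  exists (d1 : 'rV[R]_m) (d2 : 'M[R]_m), forall u,
  `|smooth e f (x + u) - (smooth e f x + dotp u d1 + (u *m d2 *m u^T) 0 0)|
  <= W * (bnorm u / e) ^+ 3.
Proof.
move=> e0 mf.
have [c1 [c2 H]] := EG_taylor2 (mrv_smooth_arg e x mf.1) (fun z => mf.2 (x + e *: (z *m A))).
exists (e^-1 *: (c1 *m B^T)), ((e^-1 *: B) *m c2 *m (e^-1 *: B)^T) => u.
have := H (e^-1 *: (u *m B)).
have ei : `|e^-1| = e^-1 by rewrite ger0_norm// invr_ge0 ltW.
rewrite nrmZ ei (mulrC e^-1) -/(bnorm u).
rewrite (smooth_shiftE x u mf e0).
have -> : dotp (e^-1 *: (u *m B)) c1 = dotp u (e^-1 *: (c1 *m B^T)).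
  rewrite dotpZl dotpZr; congr (_ * _).
  have dotpE l' (b c : 'rV[R]_l') : dotp b c = (b *m c^T) 0 0.
    by rewrite mxE; apply: eq_bigr => i _; rewrite mxE.
  by rewrite !dotpE trmx_mul trmxK mulmxA.
have -> : e^-1 *: (u *m B) *m c2 *m (e^-1 *: (u *m B))^T =
    u *m (e^-1 *: B *m c2 *m (e^-1 *: B)^T) *m u^T.
  by rewrite !linearZ/= trmx_mul -!scalemxAl -!scalemxAr -!scalemxAl !mulmxA.
by [].
Qed.

Lemma smooth_lipschitz (e : R) f x u : 0 < e -> meas01 f ->
  `|smooth e f (x + u) - smooth e f x| <= W * (bnorm u / e).
Proof.
move=> e0 mf.
have := EG_lipschitz (e^-1 *: (u *m B)) (mrv_smooth_arg e x mf.1) (fun z => mf.2 (x + e *: (z *m A))).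
have ei : `|e^-1| = e^-1 by rewrite ger0_norm// invr_ge0 ltW.
rewrite nrmZ ei (mulrC e^-1) -/(bnorm u).
by rewrite (smooth_shiftE x u mf e0).
Qed.

End smoothing.

(** * Finitely supported laws and their convolutions *)

Section laws.
Context (R : realType) (m : nat).
Local Notation V := 'rV[R]_m.
Implicit Types (s t : seq (R * V)) (g h : V -> R).

(* A finitely supported law is a list of (weight, point) pairs; the same point may
   occur several times. *)
Definition lawE s g : R := \sum_(a <- s) a.1 * g a.2.
Definition is_law s := all (fun a => 0 <= a.1) s /\ \sum_(a <- s) a.1 = 1.
Definition conv s t := [seq (a.1 * b.1, a.2 + b.2) | a <- s, b <- t].
Definition scale_law (c : R) s : seq (R * V) := [seq (a.1, c *: a.2) | a <- s].
Definition law0 : seq (R * V) := [:: (1, 0)].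
Definition convn N s := iter N (conv s) law0.
Definition bigconv (L : seq (seq (R * V))) := foldr conv law0 L.
(** The list of a convolution depends on order and bracketing, so identities between laws are stated
    through expectations. *)
Definition eqlaw s t := forall g, lawE s g = lawE t g.

Lemma lawE_conv s t g : lawE (conv s t) g = lawE s (fun x => lawE t (fun y => g (x + y))).
Proof.
rewrite /lawE /conv big_allpairs_dep; apply: eq_bigr => a _ /=.
by rewrite mulr_sumr; apply: eq_bigr => b _; rewrite mulrA.
Qed.

Lemma lawE_scale c s g : lawE (scale_law c s) g = lawE s (fun x => g (c *: x)).
Proof. by rewrite /lawE /scale_law big_map. Qed.

Lemma lawE_law0 g : lawE law0 g = g 0.
Proof. by rewrite /lawE big_seq1 mul1r. Qed.

Lemma lawED s g h : lawE s (fun x => g x + h x) = lawE s g + lawE s h.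
Proof. by rewrite -big_split; apply: eq_bigr => a _; rewrite mulrDr. Qed.

Lemma lawEB s g h : lawE s (fun x => g x - h x) = lawE s g - lawE s h.
Proof. by rewrite -sumrB; apply: eq_bigr => a _; rewrite mulrBr. Qed.

Lemma lawEZ s c g : lawE s (fun x => c * g x) = c * lawE s g.
Proof. by rewrite /lawE mulr_sumr; apply: eq_bigr => a _; rewrite mulrCA. Qed.

Lemma lawE_sum s (I : Type) (r : seq I) (g : I -> V -> R) :
  lawE s (fun x => \sum_(i <- r) g i x) = \sum_(i <- r) lawE s (g i).
Proof. by rewrite /lawE exchange_big; apply: eq_bigr => a _; rewrite mulr_sumr. Qed.

Lemma eq_lawE s g h : g =1 h -> lawE s g = lawE s h.
Proof. by move=> gh; apply: eq_bigr => a _; rewrite gh. Qed.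

Lemma lawE_cst s c : is_law s -> lawE s (fun=> c) = c.
Proof. by move=> [_ s1]; rewrite /lawE -mulr_suml s1 mul1r. Qed.

Lemma lawE_le_in s g h : is_law s -> (forall a, a \in s -> g a.2 <= h a.2) ->
  lawE s g <= lawE s h.
Proof.
move=> [/allP s0 _] gh; rewrite /lawE big_seq [leRHS]big_seq.
by apply: ler_sum => a sa; rewrite ler_wpM2l ?gh ?s0.
Qed.

Lemma lawE_le s g h : is_law s -> (forall x, g x <= h x) -> lawE s g <= lawE s h.
Proof. by move=> ls gh; apply: lawE_le_in. Qed.

Lemma lawE_norm_le s g h : is_law s -> (forall x, `|g x| <= h x) ->
  `|lawE s g| <= lawE s h.
Proof.
move=> [/allP s0 _] gh; apply: (le_trans (ler_norm_sum _ _ _)).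
rewrite /lawE big_seq [leRHS]big_seq.
by apply: ler_sum => a sa; rewrite normrM ger0_norm ?s0// ler_wpM2l ?s0.
Qed.

Lemma is_law_conv s t : is_law s -> is_law t -> is_law (conv s t).
Proof.
move=> ls lt; have [/allP s0 s1] := ls; have [/allP t0 t1] := lt; split.
  apply/allP => x /allpairsP[[a b] [/= sa tb ->]] /=.
  by apply: mulr_ge0; [exact: s0|exact: t0].
transitivity (lawE (conv s t) (fun=> 1)).
  by rewrite /lawE; apply: eq_bigr => a _; rewrite mulr1.
by rewrite lawE_conv !lawE_cst.
Qed.

Lemma is_law_scale c s : is_law s -> is_law (scale_law c s).
Proof.
move=> [/allP s0 s1]; split; last by rewrite big_map.
by apply/allP => _ /mapP[a sa ->] /=; rewrite s0.
Qed.

Lemma is_law_law0 : is_law law0.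
Proof. by split; rewrite /= ?ler01// big_seq1. Qed.

Lemma is_law_convn N s : is_law s -> is_law (convn N s).
Proof.
by move=> ls; elim: N => [|N IH] /=; [exact: is_law_law0|exact: is_law_conv].
Qed.

Lemma is_law_bigconv L : (forall s, s \in L -> is_law s) -> is_law (bigconv L).
Proof.
elim: L => [|s L IH] lL /=; first exact: is_law_law0.
apply: is_law_conv; first by apply: lL; rewrite mem_head.
by apply: IH => t tL; apply: lL; rewrite in_cons tL orbT.
Qed.

Lemma convC s t : eqlaw (conv s t) (conv t s).
Proof.
move=> g; rewrite !lawE_conv /lawE; under eq_bigr do rewrite mulr_sumr.
rewrite exchange_big/=; apply: eq_bigr => b _; rewrite mulr_sumr.
by apply: eq_bigr => a _; rewrite mulrCA addrC.
Qed.

Lemma convA s t u : eqlaw (conv s (conv t u)) (conv (conv s t) u).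
Proof.
move=> g; rewrite !lawE_conv; apply: eq_lawE => x; rewrite lawE_conv.
by apply: eq_lawE => y; apply: eq_lawE => z; rewrite addrA.
Qed.

Lemma eqlaw_conv s s' t t' : eqlaw s s' -> eqlaw t t' -> eqlaw (conv s t) (conv s' t').
Proof. by move=> ss tt g; rewrite !lawE_conv ss; apply: eq_lawE => x; rewrite tt. Qed.

Lemma eqlaw_trans s t u : eqlaw s t -> eqlaw t u -> eqlaw s u.
Proof. by move=> st tu g; rewrite st. Qed.

Lemma eqlaw_sym s t : eqlaw s t -> eqlaw t s.
Proof. by move=> st g. Qed.

Lemma convACA s t u v : eqlaw (conv (conv s t) (conv u v)) (conv (conv s u) (conv t v)).
Proof.
apply: eqlaw_trans (eqlaw_sym (convA _ _ _)) _.
apply: eqlaw_trans _ (convA _ _ _).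
apply: eqlaw_conv => //.
apply: eqlaw_trans (convA _ _ _) _.
apply: eqlaw_trans _ (eqlaw_sym (convA _ _ _)).
by apply: eqlaw_conv => //; exact: convC.
Qed.

Lemma convn_conv N s t : eqlaw (convn N (conv s t)) (conv (convn N s) (convn N t)).
Proof.
elim: N => [|N IH] /=.
  by move=> g; rewrite lawE_conv !lawE_law0 addr0.
apply: eqlaw_trans (convACA _ _ _ _).
by apply: eqlaw_conv.
Qed.

Lemma scale_conv c s t : eqlaw (scale_law c (conv s t)) (conv (scale_law c s) (scale_law c t)).
Proof.
move=> g; rewrite lawE_scale !lawE_conv lawE_scale; apply: eq_lawE => x.
by rewrite lawE_scale; apply: eq_lawE => y; rewrite scalerDr.
Qed.

Lemma eqlaw_convn N s t : eqlaw s t -> eqlaw (convn N s) (convn N t).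
Proof. by move=> st; elim: N => //= N IH; apply: eqlaw_conv. Qed.

Lemma convn_law0 N : eqlaw (convn N law0) law0.
Proof.
elim: N => [|N IH] g //; rewrite [convn _ _]/= lawE_conv lawE_law0 IH !lawE_law0.
by rewrite addr0.
Qed.

(** N scaled copies of every summand regroup into N scaled copies of the total; this is how
    [lindeberg] passes from the summands to the whole sum. *)
Lemma bigconv_convn_scale N c L :
  eqlaw (bigconv [seq convn N (scale_law c s) | s <- L]) (convn N (scale_law c (bigconv L))).
Proof.
elim: L => [|s L IH].
  apply/eqlaw_sym; apply: (eqlaw_trans _ (convn_law0 N)); apply: eqlaw_convn.
  by move=> g; rewrite lawE_scale !lawE_law0 scaler0.
rewrite [map _ _]/= [bigconv (_ :: _)]/= [bigconv (s :: L)]/=.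
apply: eqlaw_trans (eqlaw_conv (fun=> erefl) IH) _.
apply: eqlaw_trans (eqlaw_sym (convn_conv _ _ _)) _.
by apply: eqlaw_convn; apply/eqlaw_sym/scale_conv.
Qed.

End laws.

(** * Lindeberg replacement *)

Section lindeberg.
Context (R : realType) (l m : nat) (A : 'M[R]_(l, m)) (B : 'M[R]_(m, l)).
Hypothesis BA : B *m A = 1%:M.
Local Notation V := 'rV[R]_m.
Implicit Types (s t : seq (R * V)) (f g h : V -> R).
Local Notation W := (wcst R).
Local Notation nb := (bnorm B).

Lemma bnormZ c (u : V) : nb (c *: u) = `|c| * nb u.
Proof. by rewrite /bnorm -scalemxAl nrmZ. Qed.

Definition law_shift s f (x : V) : R := lawE s (fun u => f (x + u)).

Lemma law_shift01 s f : is_law s -> meas01 f -> meas01 (law_shift s f).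
Proof.
move=> ls [mf f01]; split; last first.
  move=> x; apply/andP; split.
    rewrite -(lawE_cst 0 ls); apply: lawE_le => // u.
    by have /andP[] := f01 (x + u).
  rewrite -[leRHS](lawE_cst 1 ls); apply: lawE_le => // u.
  by have /andP[] := f01 (x + u).
rewrite /mrv /law_shift /lawE; apply: measurable_sum => a; apply: measurable_funM => //.
apply: (mrv_comp mf); apply: mvecD; [exact: mvec_id|exact: mvec_cst].
Qed.

(** Both operators average translates of [f]. Commuting them brings the smoothing outside all
    shifts, so that every exchange acts on a smoothed function. *)
Lemma smooth_law_shift c s f x : is_law s -> meas01 f ->
  smooth A c (law_shift s f) x = law_shift s (smooth A c f) x.
Proof.
move=> ls mf; rewrite /smooth /law_shift /lawE.
rewrite EG_sum; last first.
  move=> a; apply: GiZ; apply: (eq_Gi (F := fun z => f (x + a.2 + c *: (z *m A)))).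
    by move=> z; rewrite addrAC.
  exact: Gi_smooth_arg.
apply: eq_bigr => a _; rewrite EGZ; last first.
  apply: (eq_Gi (F := fun z => f (x + a.2 + c *: (z *m A)))).
    by move=> z; rewrite addrAC.
  exact: Gi_smooth_arg.
by congr (_ * _); apply: eq_EG => z; rewrite addrAC.
Qed.

Lemma law_shift_conv s t f x : law_shift (conv s t) f x = law_shift s (law_shift t f) x.
Proof.
rewrite /law_shift lawE_conv; apply: eq_lawE => u; apply: eq_lawE => v.
by rewrite addrA.
Qed.

Lemma law_shift_contract s f g x c : is_law s ->
  (forall y, `|f y - g y| <= c) -> `|law_shift s f x - law_shift s g x| <= c.
Proof.
move=> ls fg; rewrite /law_shift -lawEB -[leRHS](lawE_cst c ls).
by apply: lawE_norm_le.
Qed.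

Definition centered s := forall i, lawE s (fun u => u 0 i) = 0.
Definition law_cov s : 'M[R]_m := \matrix_(i, j) lawE s (fun u => u 0 i * u 0 j).

Lemma lawE_dotp s (d1 : V) : centered s -> lawE s (fun u => dotp u d1) = 0.
Proof.
move=> cs; rewrite (eq_lawE s (h := fun u => \sum_i d1 0 i * u 0 i)); last by move=> u; rewrite dotpC.
by rewrite lawE_sum big1// => i _; rewrite lawEZ cs mulr0.
Qed.

(** A quadratic polynomial sees only the covariance of a centered law; hence laws of equal
    covariance are exchangeable up to a third order remainder. *)
Lemma lawE_quad s c0 (d1 : V) (d2 : 'M[R]_m) : is_law s -> centered s ->
  lawE s (fun u => c0 + dotp u d1 + (u *m d2 *m u^T) 0 0) =
  c0 + \sum_i \sum_j d2 i j * law_cov s i j.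
Proof.
move=> ls cs; rewrite !lawED lawE_cst// lawE_dotp// addr0; congr (_ + _).
rewrite (eq_lawE s (h := fun u => \sum_i \sum_j d2 i j * (u 0 i * u 0 j))); last first.
  move=> u; rewrite mxE exchange_big/=; apply: eq_bigr => j _; rewrite !mxE mulr_suml.
  by apply: eq_bigr => i _; ring.
rewrite lawE_sum; apply: eq_bigr => i _; rewrite lawE_sum; apply: eq_bigr => j _.
by rewrite lawEZ mxE.
Qed.

Lemma law_taylor (e : R) s f x c0 (d1 : V) (d2 : 'M[R]_m) : is_law s -> centered s ->
  (forall u, `|f (x + u) - (c0 + dotp u d1 + (u *m d2 *m u^T) 0 0)| <= W * (nb u / e) ^+ 3) ->
  `|law_shift s f x - (c0 + \sum_i \sum_j d2 i j * law_cov s i j)| <=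
  W / e ^+ 3 * lawE s (fun u => nb u ^+ 3).
Proof.
move=> ls cs H; rewrite -(lawE_quad _ d1)// /law_shift -lawEB -lawEZ.
apply: lawE_norm_le => // u; apply: le_trans (H u) _.
by rewrite expr_div_n mulrA mulrAC.
Qed.

Lemma swap_law (e : R) s t f x : 0 < e -> meas01 f -> is_law s -> is_law t ->
  centered s -> centered t -> law_cov s = law_cov t ->
  `|law_shift s (smooth A e f) x - law_shift t (smooth A e f) x| <=
  W / e ^+ 3 * (lawE s (fun u => nb u ^+ 3) + lawE t (fun u => nb u ^+ 3)).
Proof.
move=> e0 mf ls lt cs ct st.
have [d1 [d2 H]] := smooth_taylor2 BA x e0 mf.
have Hs := law_taylor ls cs H; have Ht := law_taylor lt ct H.
rewrite st in Hs; rewrite mulrDr; apply: le_trans (ler_distD _ _ _) _.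
by apply: lerD; [exact: Hs|rewrite distrC; exact: Ht].
Qed.

Lemma EG_coordM i j : EG (fun z : 'rV[R]_l => (z *m A) 0 i * (z *m A) 0 j) = (A^T *m A) i j.
Proof.
have E k (z : 'rV[R]_l) : (z *m A) 0 k = dotp (row k A^T) z.
  by rewrite mxE /dotp; apply: eq_bigr => a _; rewrite !mxE mulrC.
rewrite (eq_EG (G := fun z => dotp (row i A^T) z * dotp (row j A^T) z)); last by move=> z; rewrite !E.
by rewrite EG_dotpM /dotp mxE; apply: eq_bigr => a _; rewrite !mxE.
Qed.

Lemma EG_coord i : EG (fun z : 'rV[R]_l => (z *m A) 0 i) = 0.
Proof.
rewrite -[RHS](EG_dotp (row i A^T)); apply: eq_EG => z.
by rewrite mxE /dotp; apply: eq_bigr => a _; rewrite !mxE mulrC.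
Qed.

Lemma Gi_coord i : Gi (fun z : 'rV[R]_l => (z *m A) 0 i).
Proof.
apply: (eq_Gi (F := dotp (row i A^T))); last exact: Gi_dotp.
by move=> z; rewrite mxE /dotp; apply: eq_bigr => a _; rewrite !mxE mulrC.
Qed.

Lemma Gi_coordM i j : Gi (fun z : 'rV[R]_l => (z *m A) 0 i * (z *m A) 0 j).
Proof.
apply: (eq_Gi (F := fun z => dotp (row i A^T) z * dotp (row j A^T) z)); last exact: Gi_dotpM.
by move=> z; rewrite !mxE; congr (_ * _); rewrite /dotp; apply: eq_bigr => a _; rewrite !mxE mulrC.
Qed.

Lemma mrv_nrmM (p q : nat) (M : 'M[R]_(p, q)) : mrv (fun z => nrm (z *m M)).
Proof.
rewrite /mrv /nrm; apply: (measurableT_comp (f := @Num.sqrt R)); first by apply: continuous_measurable_fun; exact: sqrt_continuous.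
apply: measurable_sum => i; apply: measurable_funM; by apply: mvecM; exact: mvec_id.
Qed.

Lemma nrmM_sqr (p q : nat) (M : 'M[R]_(p, q)) z :
  nrm (z *m M) ^+ 2 = \sum_j dotp (row j M^T) z ^+ 2.
Proof.
rewrite sqr_nrm; apply: eq_bigr => j _; rewrite -expr2; congr (_ ^+ 2).
by rewrite mxE; apply: eq_bigr => i _; rewrite !mxE mulrC.
Qed.

Lemma Gi_nrmM2 (p q : nat) (M : 'M[R]_(p, q)) : Gi (fun z => nrm (z *m M) ^+ 2).
Proof.
apply: (eq_Gi (F := fun z => \sum_j dotp (row j M^T) z ^+ 2)).
  by move=> z; rewrite nrmM_sqr.
by apply: Gi_sum => j; exact: Gi_dotp2.
Qed.

Lemma EG_nrmM2 (p q : nat) (M : 'M[R]_(p, q)) :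
  EG (fun z => nrm (z *m M) ^+ 2) = \tr (M^T *m M).
Proof.
rewrite (eq_EG (nrmM_sqr M)) EG_sum; last by move=> j; exact: Gi_dotp2.
apply: eq_bigr => j _; rewrite EG_dotp2 sqr_nrm mxE.
by apply: eq_bigr => i _; rewrite !mxE.
Qed.

(** |z M|^3 <= 1 + |z M|^4, and the fourth power is a polynomial in linear forms, whose moments are
    finite. *)
Lemma Gi_nrmM3 (p q : nat) (M : 'M[R]_(p, q)) : Gi (fun z => nrm (z *m M) ^+ 3).
Proof.
have i4 : Gi (fun z => 1 + \sum_j \sum_k (dotp (row j M^T) z ^+ 2 * dotp (row k M^T) z ^+ 2)).
  apply: GiD; first exact: Gi_cst.
  apply: Gi_sum => j; apply: Gi_sum => k.
  apply: (Gi_le _ (GiD (Gi_dotp_pow (row j M^T) 4) (Gi_dotp_pow (row k M^T) 4))).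
    by apply: mrvM; apply: measurable_funX; exact: mrv_dotp.
  move=> z; rewrite ger0_norm; last by apply: mulr_ge0; exact: sqr_ge0.
  have e4 (x : R) : `|x| ^+ 4 = (x ^+ 2) ^+ 2.
    by rewrite -[4%N]/(2 * 2)%N exprM real_normK ?num_real.
  rewrite !e4.
  set a := _ ^+ 2; set b := _ ^+ 2.
  have a0 : 0 <= a by exact: sqr_ge0.
  have b0 : 0 <= b by exact: sqr_ge0.
  by nra.
apply: (Gi_le _ i4).
  by apply: measurable_funX; exact: mrv_nrmM.
move=> z; have n0 := nrm_ge0 (z *m M).
rewrite ger0_norm ?exprn_ge0//.
have -> : \sum_j \sum_k (dotp (row j M^T) z ^+ 2 * dotp (row k M^T) z ^+ 2) = nrm (z *m M) ^+ 4.
  rewrite -[4%N]/(2 * 2)%N exprM nrmM_sqr expr2 mulr_suml; apply: eq_bigr => j _.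
  by rewrite mulr_sumr.
move: (nrm _) n0 => a a0; have [a1|a1] := leP a 1.
  by rewrite (@le_trans _ _ 1)// ?exprn_ile1// lerDl exprn_ge0.
by rewrite (@le_trans _ _ (a ^+ 4))// ?ler_eXn2l// lerDr.
Qed.

(** As in [swap_law], with one side Gaussian: [Q] is the Taylor polynomial at the increment c z A,
    and equal covariances give both sides the same mean polynomial. *)
Lemma swap_gauss (c e : R) s f x : 0 < e -> meas01 f -> is_law s ->
  centered s -> law_cov s = c ^+ 2 *: (A^T *m A) ->
  `|law_shift s (smooth A e f) x - smooth A c (smooth A e f) x| <=
  W / e ^+ 3 * (lawE s (fun u => nb u ^+ 3) + `|c| ^+ 3 * EG (fun z => nb (z *m A) ^+ 3)).
Proof.
move=> e0 mf ls cs sc.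
have [d1 [d2 H]] := smooth_taylor2 BA x e0 mf.
have Hs := law_taylor ls cs H.
rewrite mulrDr; apply: le_trans (ler_distD (smooth A e f x + \sum_i \sum_j d2 i j * law_cov s i j) _ _) _.
apply: lerD => //; rewrite distrC.
pose Q (z : 'rV[R]_l) := smooth A e f x + \sum_i d1 0 i * (c * (z *m A) 0 i) +
   \sum_i \sum_j d2 i j * (c ^+ 2 * ((z *m A) 0 i * (z *m A) 0 j)).
have gQ1 : Gi (fun z : 'rV[R]_l => \sum_i d1 0 i * (c * (z *m A) 0 i)).
  by apply: Gi_sum => i; do 2 apply: GiZ; exact: Gi_coord.
have gQ2 : Gi (fun z : 'rV[R]_l => \sum_i \sum_j d2 i j * (c ^+ 2 * ((z *m A) 0 i * (z *m A) 0 j))).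
  by apply: Gi_sum => i; apply: Gi_sum => j; do 2 apply: GiZ; exact: Gi_coordM.
have gQ : Gi Q by do 2 (apply: GiD => //); exact: Gi_cst.
have EQ : EG Q = smooth A e f x + \sum_i \sum_j d2 i j * law_cov s i j.
  rewrite EGD//; last by apply: GiD => //; exact: Gi_cst.
  rewrite EGD//; last exact: Gi_cst.
  rewrite EG_cst EG_sum; last by move=> i; do 2 apply: GiZ; exact: Gi_coord.
  rewrite big1 ?addr0; last first.
    move=> i _; rewrite EGZ; last by apply: GiZ; exact: Gi_coord.
    by rewrite EGZ ?EG_coord ?mulr0//; exact: Gi_coord.
  congr (_ + _); rewrite EG_sum; last first.
    by move=> i; apply: Gi_sum => j; do 2 apply: GiZ; exact: Gi_coordM.
  apply: eq_bigr => i _; rewrite EG_sum; last first.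
    by move=> j; do 2 apply: GiZ; exact: Gi_coordM.
  apply: eq_bigr => j _; rewrite EGZ; last by apply: GiZ; exact: Gi_coordM.
  rewrite EGZ; last exact: Gi_coordM.
  by rewrite EG_coordM sc; congr (_ * _); rewrite [RHS]mxE.
have gS := Gi_smooth_arg A c x (smooth01 A e mf).
have g3 : Gi (fun z : 'rV[R]_l => nb (z *m A) ^+ 3).
  apply: (eq_Gi (F := fun z => nrm (z *m (A *m B)) ^+ 3)); last exact: Gi_nrmM3.
  by move=> z; rewrite /bnorm mulmxA.
rewrite -EQ /smooth -/(smooth A e f) -EGB//.
rewrite -EGZ// -EGZ; last exact: GiZ.
apply: EG_norm_le; [exact: GiB|by do 2 apply: GiZ|].
move=> z; have := H (c *: (z *m A)).
rewrite bnormZ => Hz.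
rewrite [leRHS](_ : _ = W * (`|c| * nb (z *m A) / e) ^+ 3); last first.
  by rewrite expr_div_n exprMn; ring.
apply: le_trans Hz; rewrite le_eqVlt; apply/orP; left; apply/eqP; congr `|_ - _|.
rewrite /Q; congr (_ + _ + _).
  by rewrite [RHS]dotpC /dotp; apply: eq_bigr => i _; congr (_ * _); rewrite [RHS]mxE.
rewrite mxE exchange_big/=; apply: eq_bigr => j _; rewrite !mxE mulr_suml.
by apply: eq_bigr => i _; rewrite !mxE; ring.
Qed.

Lemma smooth0 f x : smooth A 0 f x = f x.
Proof.
rewrite -[RHS](@EG_cst R l); apply: eq_EG => z.
by rewrite scale0r addr0.
Qed.

(** One copy is exchanged at a time. By commutation the exchanged copy again faces a smoothed
    function, and smoothing does not increase the error of the other copies. The variances c^2 and N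
    c^2 add by [smooth_stable]. *)
Lemma convn_gauss (c e d : R) s : 0 <= c -> 0 < e -> is_law s ->
  (forall f x, meas01 f -> `|law_shift s (smooth A e f) x - smooth A c (smooth A e f) x| <= d) ->
  forall N f x, meas01 f ->
  `|law_shift (convn N s) (smooth A e f) x - smooth A (Num.sqrt N%:R * c) (smooth A e f) x| <= N%:R * d.
Proof.
move=> c0 e0 ls H; elim=> [|N IH] f x mf.
  rewrite sqrtr0 !mul0r smooth0 /law_shift lawE_law0 addr0 subrr normr0//.
have lN := is_law_convn N ls.
have m1 := smooth01 A e mf.
rewrite [convn _ _]/= law_shift_conv.
have -> : law_shift (convn N s) (smooth A e f) = smooth A e (law_shift (convn N s) f).
  by apply/funext => y; rewrite smooth_law_shift.
have m2 := law_shift01 lN mf.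
apply: le_trans (ler_distD (smooth A c (smooth A e (law_shift (convn N s) f)) x) _ _) _.
rewrite -addn1 natrD mulrDl mul1r addrC; apply: lerD; last exact: H.
have -> : smooth A (Num.sqrt (N%:R + 1) * c) (smooth A e f) x =
    smooth A c (smooth A (Num.sqrt N%:R * c) (smooth A e f)) x.
  have -> : Num.sqrt (N%:R + 1) * c = Num.sqrt (c ^+ 2 + (Num.sqrt N%:R * c) ^+ 2).
    have -> : c ^+ 2 + (Num.sqrt N%:R * c) ^+ 2 = (N%:R + 1) * c ^+ 2.
      by rewrite exprMn sqr_sqrtr//; ring.
    rewrite sqrtrM ?addr_ge0//.
    by rewrite sqrtr_sqr ger0_norm.
  by apply/esym; exact: smooth_stable.
apply: smooth_contract; [exact: smooth01|exact: smooth01|].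
by move=> y; rewrite smooth_law_shift//; exact: IH.
Qed.

(** Telescoping: the factors not yet exchanged are absorbed into the smoothed function, and those
    already exchanged only average the error. *)
Lemma bigconv_swap (I : eqType) (L : seq I) (s t : I -> seq (R * V)) (d : I -> R) (e : R) :
  0 < e -> (forall i, is_law (s i)) -> (forall i, is_law (t i)) ->
  (forall i f x, meas01 f -> `|law_shift (s i) (smooth A e f) x - law_shift (t i) (smooth A e f) x| <= d i) ->
  forall f x, meas01 f ->
  `|law_shift (bigconv [seq s i | i <- L]) (smooth A e f) x -
    law_shift (bigconv [seq t i | i <- L]) (smooth A e f) x| <= \sum_(i <- L) d i.
Proof.
move=> e0 ls lt H; elim: L => [|i L IH] f x mf.
  by rewrite big_nil subrr normr0.
have lS : is_law (bigconv [seq s i | i <- L]) by apply: is_law_bigconv => _ /mapP[? _ ->].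
rewrite [map _ _]/= [bigconv (_ :: _)]/= [map t (i :: L)]/= [bigconv (t i :: _)]/= big_cons.
rewrite !law_shift_conv.
apply: le_trans (ler_distD (law_shift (t i) (law_shift (bigconv [seq s i | i <- L]) (smooth A e f)) x) _ _) _.
apply: lerD.
  have -> : law_shift (bigconv [seq s i | i <- L]) (smooth A e f) = smooth A e (law_shift (bigconv [seq s i | i <- L]) f).
    by apply/funext => y; rewrite smooth_law_shift.
  by apply: H; exact: law_shift01.
by apply: law_shift_contract => // y; exact: IH.
Qed.

Lemma centered_conv s t : is_law s -> is_law t -> centered s -> centered t -> centered (conv s t).
Proof.
move=> ls lt cs ct i; rewrite lawE_conv.
under eq_lawE do under eq_lawE do rewrite mxE.
under eq_lawE do rewrite lawED lawE_cst// ct addr0.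
exact: cs.
Qed.

Lemma centered_law0 : centered (@law0 R m).
Proof. by move=> i; rewrite lawE_law0 mxE. Qed.

Lemma centered_scale c s : centered s -> centered (scale_law c s).
Proof.
move=> cs i; rewrite lawE_scale.
by under eq_lawE do rewrite mxE; rewrite lawEZ cs mulr0.
Qed.

Lemma law_cov_conv s t : is_law s -> is_law t -> centered s -> centered t ->
  law_cov (conv s t) = law_cov s + law_cov t.
Proof.
move=> ls lt cs ct; apply/matrixP => i j; rewrite !mxE lawE_conv.
transitivity (lawE s (fun x => x 0 i * x 0 j + lawE t (fun u => u 0 i * u 0 j))); last first.
  by rewrite lawED lawE_cst.
apply: eq_lawE => x.
transitivity (lawE t (fun y => (x 0 i * x 0 j + y 0 i * y 0 j) + (x 0 i * y 0 j + x 0 j * y 0 i))).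
  by apply: eq_lawE => y; rewrite !mxE; ring.
by rewrite lawED (lawED _ (fun y => x 0 i * y 0 j)) !lawEZ !ct !mulr0 !addr0 lawED lawE_cst.
Qed.

Lemma law_cov_law0 : law_cov (@law0 R m) = 0.
Proof. by apply/matrixP => i j; rewrite !mxE lawE_law0 !mxE mul0r. Qed.

Lemma law_cov_scale c s : law_cov (scale_law c s) = c ^+ 2 *: law_cov s.
Proof.
apply/matrixP => i j; rewrite !mxE lawE_scale -lawEZ; apply: eq_lawE => x.
by rewrite !mxE; ring.
Qed.

Lemma centered_convn N s : is_law s -> centered s -> centered (convn N s).
Proof.
move=> ls cs; elim: N => [|N IH]; first exact: centered_law0.
by apply: centered_conv => //; exact: is_law_convn.
Qed.

Lemma law_cov_convn N s : is_law s -> centered s -> law_cov (convn N s) = N%:R *: law_cov s.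
Proof.
move=> ls cs; elim: N => [|N IH]; first by rewrite scale0r law_cov_law0.
rewrite [convn _ _]/= law_cov_conv//; last 2 first.
- exact: is_law_convn.
- exact: centered_convn.
by rewrite -/(convn N s) IH -addn1 natrD scalerDl scale1r addrC.
Qed.

Lemma centered_bigconv L : (forall s, s \in L -> is_law s) ->
  (forall s, s \in L -> centered s) -> centered (bigconv L).
Proof.
elim: L => [|s L IH] lL cL; first exact: centered_law0.
have lL' t : t \in L -> is_law t by move=> tL; apply: lL; rewrite in_cons tL orbT.
have cL' t : t \in L -> centered t by move=> tL; apply: cL; rewrite in_cons tL orbT.
apply: centered_conv; [by apply: lL; rewrite mem_head|exact: is_law_bigconv|..].
- by apply: cL; rewrite mem_head.
- exact: IH.
Qed.

Lemma law_cov_bigconv L : (forall s, s \in L -> is_law s) ->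
  (forall s, s \in L -> centered s) -> law_cov (bigconv L) = \sum_(s <- L) law_cov s.
Proof.
elim: L => [|s L IH] lL cL; first by rewrite big_nil law_cov_law0.
have lL' t : t \in L -> is_law t by move=> tL; apply: lL; rewrite in_cons tL orbT.
have cL' t : t \in L -> centered t by move=> tL; apply: cL; rewrite in_cons tL orbT.
rewrite [bigconv _]/= law_cov_conv ?big_cons ?IH//.
- by apply: lL; rewrite mem_head.
- exact: is_law_bigconv.
- by apply: cL; rewrite mem_head.
- exact: centered_bigconv.
Qed.

Lemma dotp_CS (p : nat) (b c : 'rV[R]_p) : dotp b c ^+ 2 <= dotp b b * dotp c c.
Proof.
apply: quad_disc (dotp_ge0 c) _ => t; have := dotp_ge0 (b + (- t) *: c).
rewrite dotpDl !dotpDr !dotpZl !dotpZr (dotpC c b) => h.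
by rewrite (_ : _ + _ = dotp b b + - t * dotp b c + (- t * dotp b c + - t * (- t * dotp c c)))//; ring.
Qed.

Lemma nb_sqrD u v : nb (u + v) ^+ 2 = nb u ^+ 2 + 2 * dotp (u *m B) (v *m B) + nb v ^+ 2.
Proof.
rewrite /bnorm !sqr_nrm mulmxDl dotpDl !dotpDr (dotpC (v *m B) (u *m B)); ring.
Qed.

Lemma centered_dotpM s (w : 'rV[R]_l) : centered s -> lawE s (fun u => dotp (u *m B) w) = 0.
Proof.
move=> cs; rewrite (eq_lawE s (h := fun u => dotp u (w *m B^T))); first exact: lawE_dotp.
move=> u.
have dotpE l' (b c : 'rV[R]_l') : dotp b c = (b *m c^T) 0 0.
  by rewrite mxE; apply: eq_bigr => i _; rewrite mxE.
by rewrite !dotpE trmx_mul trmxK mulmxA.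
Qed.

Lemma convn_moment2 N s : is_law s -> centered s ->
  lawE (convn N s) (fun u => nb u ^+ 2) = N%:R * lawE s (fun u => nb u ^+ 2).
Proof.
move=> ls cs; elim: N => [|N IH].
  by rewrite lawE_law0 /bnorm mul0mx /nrm /dotp big1 ?sqrtr0 ?expr0n ?mul0r// => i _; rewrite mxE mul0r.
have lN := is_law_convn N ls.
rewrite [convn _ _]/= (convC s) lawE_conv -/(convn N s).
transitivity (lawE (convn N s) (fun x => nb x ^+ 2 + lawE s (fun u => nb u ^+ 2))); last first.
  by rewrite lawED lawE_cst// IH mulrS mulrDl mul1r addrC.
apply: eq_lawE => x.
rewrite (eq_lawE s (h := fun u => nb x ^+ 2 + 2 * dotp (u *m B) (x *m B) + nb u ^+ 2)); last first.
  by move=> u; rewrite nb_sqrD (dotpC (u *m B)).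
by rewrite !lawED lawE_cst// lawEZ centered_dotpM// mulr0 addr0.
Qed.

Lemma nb_ge0 u : 0 <= nb u.
Proof. exact: nrm_ge0. Qed.

Lemma lawE_ge0 s g : is_law s -> (forall u, 0 <= g u) -> 0 <= lawE s g.
Proof. by move=> ls g0; rewrite -(lawE_cst 0 ls); apply: lawE_le. Qed.

(** With a = |x|^2, q = |u|^2 and d their scalar product, d^2 <= a q gives (a + 2 d + q)^2 <= a^2 +
    8 a q + 3 q^2 + 4 a d. The last term has mean 0 and a has mean N t2; the increments 8 N t2^2 sum
    to at most 4 N^2 t2^2. *)
Lemma convn_moment4 N s : is_law s -> centered s ->
  lawE (convn N s) (fun u => nb u ^+ 4) <=
  4 * N%:R ^+ 2 * lawE s (fun u => nb u ^+ 2) ^+ 2 + 3 * N%:R * lawE s (fun u => nb u ^+ 4).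
Proof.
move=> ls cs.
set t2 := lawE s (fun u => nb u ^+ 2); set t4 := lawE s (fun u => nb u ^+ 4).
elim: N => [|N IH].
  rewrite lawE_law0 /bnorm mul0mx /nrm /dotp big1 ?sqrtr0 ?expr0n/= ?mulr0 ?mul0r ?addr0//.
  by move=> i _; rewrite mxE mul0r.
have lN := is_law_convn N ls.
rewrite [convn _ _]/= (convC s) lawE_conv -/(convn N s).
have t20 : 0 <= t2 by apply: lawE_ge0 => // u; exact: sqr_ge0.
apply: (@le_trans _ _ (lawE (convn N s) (fun x => nb x ^+ 4 + 8 * t2 * nb x ^+ 2 + 3 * t4))); last first.
  rewrite !lawED lawEZ convn_moment2// lawE_cst// -/t2.
  have e1 : (N.+1)%:R = N%:R + 1 :> R by rewrite mulrS addrC.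
  rewrite e1; set n : R := N%:R in IH *.
  have n0 : 0 <= n by exact: ler0n.
  have t22 : 0 <= t2 ^+ 2 by exact: sqr_ge0.
  move: IH; set y := lawE (convn N s) _ => IH.
  have -> : 8 * t2 * (n * t2) = 8 * n * t2 ^+ 2 by ring.
  by nra.
apply: lawE_le => // x.
set a := nb x ^+ 2.
have -> : nb x ^+ 4 = a ^+ 2 by rewrite /a -exprM.
apply: (@le_trans _ _ (lawE s (fun u => a ^+ 2 + 8 * a * nb u ^+ 2 + 3 * nb u ^+ 4 + 4 * a * dotp (u *m B) (x *m B)))); last first.
  rewrite !lawED lawE_cst// !lawEZ centered_dotpM// mulr0 addr0 -/t2 -/t4.
  by rewrite le_eqVlt; apply/orP; left; apply/eqP; ring.
apply: lawE_le => // u.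
have -> : nb (x + u) ^+ 4 = (nb (x + u) ^+ 2) ^+ 2 by rewrite -exprM.
rewrite nb_sqrD -/a (dotpC (x *m B)).
have := dotp_CS (u *m B) (x *m B); rewrite -!sqr_nrm -/(nb u) -/(nb x) -/a.
have -> : nb u ^+ 4 = (nb u ^+ 2) ^+ 2 by rewrite -exprM.
move: (nb u ^+ 2) (sqr_ge0 (nb u)) (dotp _ _) => q q0 d hd.
have a0 : 0 <= a by exact: sqr_ge0.
have h1 : 4 * d * q <= 2 * d ^+ 2 + 2 * q ^+ 2 by have := sqr_ge0 (d - q); nra.
by nra.
Qed.

(* Each [s i] is first exchanged with [t i], the law of N^-1/2 times the sum of N
   independent copies; the total is then a sum of N independent copies of a scaled
   law, each of which is exchanged with a Gaussian at cost O(N^-3/2). *)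
Lemma lindeberg (I : eqType) (L : seq I) (s : I -> seq (R * V)) (k e : R) f x :
  0 < k -> 0 < e -> meas01 f -> (forall i, is_law (s i)) ->
  (forall i, centered (s i)) -> (forall i a, a \in s i -> nb a.2 <= k) ->
  \sum_(i <- L) law_cov (s i) = A^T *m A ->
  `|law_shift (bigconv [seq s i | i <- L]) (smooth A e f) x - smooth A 1 (smooth A e f) x| <=
  5 * k * W / e ^+ 3 * \sum_(i <- L) lawE (s i) (fun u => nb u ^+ 2).
Proof.
move=> k0 e0 mf ls cs sk sc.
pose S := bigconv [seq s i | i <- L].
have lS : is_law S by apply: is_law_bigconv => _ /mapP[? _ ->].
have cS : centered S by apply: centered_bigconv => _ /mapP[? _ ->].
have covS : law_cov S = A^T *m A.
  by rewrite law_cov_bigconv ?big_map// => _ /mapP[? _ ->].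
pose K := W / e ^+ 3 * (lawE S (fun u => nb u ^+ 3) + EG (fun z => nb (z *m A) ^+ 3)).
set D := 5 * k * W / e ^+ 3 * _.
(* [D] and [K] do not depend on N, so the cost K / sqrt N of the Gaussian exchange disappears in the
   limit, whatever the size of [K]. *)
have main (N : nat) : (0 < N)%N ->
    `|law_shift S (smooth A e f) x - smooth A 1 (smooth A e f) x| <= D + K / Num.sqrt N%:R.
  move=> N0; have n0 : 0 < N%:R :> R by rewrite ltr0n.
  have r0 : 0 < Num.sqrt N%:R :> R by rewrite sqrtr_gt0.
  pose c : R := (Num.sqrt N%:R)^-1.
  have c0 : 0 < c by rewrite invr_gt0.
  have c2 : N%:R * c ^+ 2 = 1 by rewrite exprVn sqr_sqrtr ?ltW// divff ?gt_eqF.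
  pose t i := convn N (scale_law c (s i)).
  have ls' i : is_law (scale_law c (s i)) by exact: is_law_scale.
  have cs' i : centered (scale_law c (s i)) by exact: centered_scale.
  have lt i : is_law (t i) by exact: is_law_convn.
  have ct i : centered (t i) by exact: centered_convn.
  have st i : law_cov (s i) = law_cov (t i).
    by rewrite law_cov_convn// law_cov_scale scalerA c2 scale1r.
  pose d i := 5 * k * W / e ^+ 3 * lawE (s i) (fun u => nb u ^+ 2).
  have Hd i g y : meas01 g ->
      `|law_shift (s i) (smooth A e g) y - law_shift (t i) (smooth A e g) y| <= d i.
    move=> mg; apply: le_trans (swap_law y e0 mg (ls i) (lt i) (cs i) (ct i) (st i)) _.
    rewrite /d [leRHS](_ : _ = W / e ^+ 3 * (5 * k * lawE (s i) (fun u => nb u ^+ 2))); last by ring.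
    apply: ler_wpM2l; first by rewrite divr_ge0 ?exprn_ge0 ?ltW// wcst_gt0.
    set t2 := lawE (s i) (fun u => nb u ^+ 2).
    have t20 : 0 <= t2 by apply: lawE_ge0 => // u; exact: sqr_ge0.
    have t2k : t2 <= k ^+ 2.
      rewrite -(lawE_cst (k ^+ 2) (ls i)); apply: lawE_le_in => // a /sk ak.
      by rewrite ler_pXn2r// ?nnegrE ?nb_ge0 ?ltW.
    have s3 : lawE (s i) (fun u => nb u ^+ 3) <= k * t2.
      rewrite -lawEZ; apply: lawE_le_in => // a /sk ak.
      by rewrite exprS; apply: ler_wpM2r => //; exact: sqr_ge0.
    have s4 : lawE (s i) (fun u => nb u ^+ 4) <= k ^+ 2 * t2.
      rewrite -lawEZ; apply: lawE_le_in => // a /sk ak.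
      rewrite (exprD _ 2 2); apply: ler_wpM2r; first exact: sqr_ge0.
      by rewrite ler_pXn2r// ?nnegrE ?nb_ge0 ?ltW.
    have m2 : lawE (t i) (fun u => nb u ^+ 2) = t2.
      rewrite convn_moment2// lawE_scale.
      under eq_lawE do rewrite bnormZ exprMn.
      by rewrite lawEZ real_normK ?num_real// mulrA c2 mul1r.
    (* 7 = 4 + 3: both terms of [convn_moment4] are bounded through |u| <= k, using N c^2 = 1 and c
       <= 1. *)
    have m4 : lawE (t i) (fun u => nb u ^+ 4) <= 7 * k ^+ 2 * t2.
      apply: le_trans (convn_moment4 N (ls' i) (cs' i)) _.
      rewrite !lawE_scale.
      have -> : lawE (s i) (fun u => nb (c *: u) ^+ 2) = c ^+ 2 * t2.
        under eq_lawE do rewrite bnormZ exprMn.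
        by rewrite lawEZ real_normK ?num_real.
      have -> : lawE (s i) (fun u => nb (c *: u) ^+ 4) = c ^+ 4 * lawE (s i) (fun u => nb u ^+ 4).
        under eq_lawE do rewrite bnormZ exprMn.
        by rewrite lawEZ gtr0_norm.
      set t4 := lawE _ _ in s4 *.
      have -> : 4 * N%:R ^+ 2 * (c ^+ 2 * t2) ^+ 2 = 4 * t2 ^+ 2.
        transitivity ((N%:R * c ^+ 2) ^+ 2 * (4 * t2 ^+ 2)); [ring|by rewrite c2 expr1n mul1r].
      have c2N : c ^+ 2 = N%:R^-1 by rewrite exprVn sqr_sqrtr ?ltW.
      have -> : 3 * N%:R * (c ^+ 4 * t4) = 3 * c ^+ 2 * t4.
        transitivity ((N%:R * c ^+ 2) * (3 * c ^+ 2 * t4)); [ring|by rewrite c2 mul1r].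
      have c21 : c ^+ 2 <= 1 by rewrite c2N invf_le1// ler1n.
      have c20 : 0 <= c ^+ 2 by exact: sqr_ge0.
      have h1 : t2 ^+ 2 <= k ^+ 2 * t2 by rewrite expr2; apply: ler_wpM2r.
      have h2 : c ^+ 2 * t4 <= k ^+ 2 * t2.
        apply: (@le_trans _ _ (c ^+ 2 * (k ^+ 2 * t2))); first exact: ler_wpM2l.
        by apply: ler_piMl => //; rewrite mulr_ge0 ?sqr_ge0.
      by nra.
    (* |u|^3 <= (k |u|^2 + |u|^4 / k) / 2 involves even moments only. It gives k / 2 + 7 k / 2 = 4
       k, and with the k of [s3] the factor 5 k. *)
    have m3 : lawE (t i) (fun u => nb u ^+ 3) <= 4 * k * t2.
      apply: (@le_trans _ _ (lawE (t i) (fun u => k / 2 * nb u ^+ 2 + (2 * k)^-1 * nb u ^+ 4))).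
        apply: lawE_le => // u; have u0 := nb_ge0 u.
        rewrite -subr_ge0 [leRHS](_ : _ = (2 * k)^-1 * nb u ^+ 2 * (nb u - k) ^+ 2); last by field; rewrite gt_eqF.
        by apply: mulr_ge0 (sqr_ge0 _); apply: mulr_ge0 (sqr_ge0 _); rewrite invr_ge0 mulr_ge0// ltW.
      rewrite lawED !lawEZ m2.
      apply: (@le_trans _ _ (k / 2 * t2 + (2 * k)^-1 * (7 * k ^+ 2 * t2))).
        by apply: lerD => //; apply: ler_wpM2l => //; rewrite invr_ge0 mulr_ge0// ltW.
      by rewrite le_eqVlt; apply/orP; left; apply/eqP; field; rewrite gt_eqF.
    by apply: le_trans (lerD s3 m3) _; rewrite le_eqVlt; apply/orP; left; apply/eqP; ring.
  apply: le_trans (ler_distD (law_shift (bigconv [seq t i | i <- L]) (smooth A e f) x) _ _) _.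
  apply: lerD.
    by rewrite /D mulr_sumr; exact: (bigconv_swap L e0 ls lt Hd).
  rewrite /law_shift (_ : [seq t i | i <- L] = [seq convn N (scale_law c s) | s <- [seq s i | i <- L]]); last by rewrite -map_comp.
  rewrite bigconv_convn_scale -/(law_shift _ _ _) -/S.
  have lcS : is_law (scale_law c S) by exact: is_law_scale.
  have H g y : meas01 g ->
    `|law_shift (scale_law c S) (smooth A e g) y - smooth A c (smooth A e g) y| <= c ^+ 3 * K.
    move=> mg; have := swap_gauss y e0 mg lcS (centered_scale c cS).
    rewrite law_cov_scale covS => /(_ c erefl) h; apply: le_trans h _.
    rewrite lawE_scale; under eq_lawE do rewrite bnormZ exprMn.
    rewrite lawEZ gtr0_norm// /K.
    by rewrite le_eqVlt; apply/orP; left; apply/eqP; ring.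
  have := convn_gauss (ltW c0) e0 lcS H N x mf.
  rewrite divff ?gt_eqF// => h; apply: le_trans h _.
  rewrite -/c le_eqVlt; apply/orP; left; apply/eqP.
  by transitivity ((N%:R * c ^+ 2) * (K * c)); [ring|rewrite c2 mul1r].
apply/ler_addgt0Pr => a a0.
have [N N0 Na] : exists2 N : nat, (0 < N)%N & `|K| <= a * Num.sqrt N%:R.
  pose N := Num.truncn ((`|K| / a) ^+ 2); exists N.+1 => //.
  rewrite mulrC -ler_pdivrMr//.
  have h : 0 <= `|K| / a by rewrite divr_ge0// ltW.
  rewrite -[leLHS](ger0_norm h) -sqrtr_sqr ler_sqrt//.
  by apply: ltW; exact: truncnS_gt.
apply: le_trans (main N N0) _; rewrite lerD2l ler_pdivrMr ?sqrtr_gt0 ?ltr0n//.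
exact: le_trans (ler_norm _) Na.
Qed.

(** |u|^2 = u B B^T u^T, so its mean is a trace against the covariance. When B B^T inverts A^T A the
    total is the dimension, which bounds the sum of all exchange costs. *)
Lemma trace_law_cov (I : eqType) (L : seq I) (s : I -> seq (R * V)) :
  \sum_(i <- L) law_cov (s i) = A^T *m A ->
  \sum_(i <- L) lawE (s i) (fun u => nb u ^+ 2) = \tr (B *m B^T *m (A^T *m A)).
Proof.
move=> sc; rewrite -sc mulmx_sumr raddf_sum; apply: eq_bigr => i _.
rewrite (eq_lawE (s i) (h := fun u => \sum_a \sum_b (B *m B^T) a b * (u 0 b * u 0 a))).
  rewrite lawE_sum /mxtrace; apply: eq_bigr => a _.
  rewrite lawE_sum mxE; apply: eq_bigr => b _.
  by rewrite lawEZ; congr (_ * _); rewrite [RHS]mxE.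
move=> u; rewrite /bnorm sqr_nrm.
transitivity ((u *m (B *m B^T) *m u^T) 0 0).
  rewrite -!mulmxA -trmx_mul mulmxA mxE; apply: eq_bigr => j _.
  by rewrite [(_ ^T) _ _]mxE.
rewrite mxE exchange_big/=; apply: eq_bigr => b _; rewrite !mxE mulr_suml.
by apply: eq_bigr => a _; ring.
Qed.

End lindeberg.

(** * Independent categorical variables as a finite product law *)

Section product_law.
Context {R : realType} {I J : finType}.
Variable p : I -> J -> R.
Implicit Types (f : {ffun I -> J}) (F : {ffun I -> J} -> R).

Definition upd f i a : {ffun I -> J} := [ffun j => if j == i then a else f j].

Lemma updE f i a : upd f i a i = a.
Proof. by rewrite ffunE eqxx. Qed.

Lemma upd_neq f i a j : j != i -> upd f i a j = f j.
Proof. by rewrite ffunE => /negbTE ->. Qed.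

Lemma updK f i a : upd (upd f i a) i (f i) = f.
Proof. by apply/ffunP => j; rewrite !ffunE; case: eqP => [->|]. Qed.

Definition pw f : R := \prod_i p i (f i).
Definition pE F : R := \sum_f pw f * F f.

Lemma pw_upd f i a : pw (upd f i a) * p i (f i) = pw f * p i a.
Proof.
rewrite /pw (bigD1 i)//= [in RHS](bigD1 i)//= updE.
rewrite (eq_bigr (fun j => p j (f j))); last by move=> j ji; rewrite upd_neq.
by ring.
Qed.

(* (f, a) |-> (upd f i a, f i) is an involution preserving the weights. *)
Lemma pE_resample i (F : {ffun I -> J} -> J -> R) :
  pE (fun f => \sum_a p i a * F f a) =
  pE (fun f => \sum_a p i a * F (upd f i a) (f i)).
Proof.
have E (G : {ffun I -> J} -> J -> R) : pE (fun f => \sum_a p i a * G f a) =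
    \sum_(x : {ffun I -> J} * J) pw x.1 * p i x.2 * G x.1 x.2.
  rewrite -(pair_bigA _ (fun f a => pw f * p i a * G f a))/=.
  by apply: eq_bigr => f _; rewrite mulr_sumr; apply: eq_bigr => a _; rewrite mulrA.
rewrite !E (reindex (fun x : {ffun I -> J} * J => (upd x.1 i x.2, x.1 i))) /=; last first.
  exists (fun x : {ffun I -> J} * J => (upd x.1 i x.2, x.1 i)) => -[f a] _ /=;
  by rewrite updK updE.
by apply: eq_bigr => -[f a] _ /=; rewrite pw_upd.
Qed.

Lemma eq_pE F G : F =1 G -> pE F = pE G.
Proof. by move=> FG; apply: eq_bigr => f _; rewrite FG. Qed.

Lemma pED F G : pE (fun f => F f + G f) = pE F + pE G.
Proof. by rewrite -big_split; apply: eq_bigr => f _; rewrite mulrDr. Qed.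

Lemma pEZ c F : pE (fun f => c * F f) = c * pE F.
Proof. by rewrite /pE mulr_sumr; apply: eq_bigr => f _; rewrite mulrCA. Qed.

Lemma pE_sum (K : Type) (r : seq K) (P : pred K) (F : K -> {ffun I -> J} -> R) :
  pE (fun f => \sum_(x <- r | P x) F x f) = \sum_(x <- r | P x) pE (F x).
Proof. by rewrite /pE exchange_big; apply: eq_bigr => f _; rewrite mulr_sumr. Qed.

Hypothesis p_ge0 : forall i a, 0 <= p i a.
Hypothesis p_sum1 : forall i, \sum_a p i a = 1.

Lemma pw_ge0 f : 0 <= pw f.
Proof. by apply: prodr_ge0. Qed.

Lemma pw_sum1 : \sum_f pw f = 1.
Proof. by rewrite -(bigA_distr_bigA p) big1. Qed.

Lemma pE_cst c : pE (fun=> c) = c.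
Proof. by rewrite /pE -mulr_suml pw_sum1 mul1r. Qed.

Lemma pE_norm_le F G : (forall f, `|F f| <= G f) -> `|pE F| <= pE G.
Proof.
move=> FG; apply: le_trans (ler_norm_sum _ _ _) _; apply: ler_sum => f _.
by rewrite normrM ger0_norm ?pw_ge0// ler_wpM2l// pw_ge0.
Qed.

Lemma pE_upd i F : pE F = \sum_a p i a * pE (fun f => F (upd f i a)).
Proof.
transitivity (pE (fun f => \sum_a p i a * F f)).
  by apply: eq_pE => f; rewrite -mulr_suml p_sum1 mul1r.
by rewrite (pE_resample i (fun f _ => F f)) pE_sum; apply: eq_bigr => a _; rewrite pEZ.
Qed.

Lemma pE_marg i (h : J -> R) : pE (fun f => h (f i)) = \sum_a p i a * h a.
Proof.
rewrite (pE_upd i); apply: eq_bigr => a _; rewrite -[in RHS](pE_cst (h a)).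
by congr (_ * _); apply: eq_pE => f; rewrite updE.
Qed.

Lemma pE_indep i F (h : J -> R) : (forall f a, F (upd f i a) = F f) ->
  \sum_a p i a * h a = 0 -> pE (fun f => h (f i) * F f) = 0.
Proof.
move=> HF h0; rewrite (pE_upd i).
rewrite (eq_bigr (fun a => p i a * h a * pE F)); last first.
  move=> a _; rewrite -mulrA -[h a * pE F]pEZ; congr (_ * _).
  by apply: eq_pE => f; rewrite updE HF.
by rewrite -mulr_suml h0 mul0r.
Qed.

(** Off-diagonal products vanish: for i <> j the factor h i is centered and independent of
    coordinate j. *)
Lemma pE_prod_sum (h g : I -> J -> R) : (forall i, \sum_a p i a * h i a = 0) ->
  pE (fun f => (\sum_i h i (f i)) * (\sum_i g i (f i))) =
  \sum_i \sum_a p i a * (h i a * g i a).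
Proof.
move=> h0.
transitivity (pE (fun f => \sum_i \sum_j h i (f i) * g j (f j))).
  by apply: eq_pE => f; rewrite mulr_suml; apply: eq_bigr => i _; rewrite mulr_sumr.
rewrite pE_sum; apply: eq_bigr => i _.
rewrite pE_sum (bigD1 i)//= big1 ?addr0; last first.
  move=> j ji; apply: (pE_indep (F := fun f => g j (f j))) => // f a.
  by rewrite upd_neq.
exact: (pE_marg i (fun a => h i a * g i a)).
Qed.

Definition pmean (i : I) (phi : J -> R) : R := \sum_b p i b * phi b.
Definition pvar (phi : J -> R) : R := \sum_i \sum_a p i a * (phi a - pmean i phi) ^+ 2.

Lemma pcentered i phi : \sum_a p i a * (phi a - pmean i phi) = 0.
Proof.
under eq_bigr do rewrite mulrBr.
by rewrite sumrB -mulr_suml p_sum1 mul1r subrr.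
Qed.

(* [Z a f] below is the score: exchanging [f i] and [a] turns the weight
   [phi a - mean] of the left-hand side into [phi (f i) - mean], and the latter is
   centered and independent in [i]. *)
Lemma score_le (phi : J -> R) (G : {ffun I -> J} -> J -> R) (lam : R) : 0 < lam ->
  (forall i f a, G (upd f i a) (f i) = G f a) -> (forall f a, `|G f a| <= 1) ->
  `|\sum_a (\sum_i p i a * (phi a - pmean i phi)) * pE (G^~ a)| <=
  (#|J|%:R * lam + pvar phi / lam) / 2.
Proof.
move=> lam0 Gs G1.
pose Z a f := \sum_i p i a * (phi (f i) - pmean i phi).
have -> : \sum_a (\sum_i p i a * (phi a - pmean i phi)) * pE (G^~ a) =
    \sum_a pE (fun f => Z a f * G f a).
  transitivity (\sum_i pE (fun f => \sum_a p i a * ((phi a - pmean i phi) * G f a))).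
    rewrite (eq_bigr (fun a => \sum_i p i a * (phi a - pmean i phi) * pE (G^~ a))); last first.
      by move=> a _; rewrite mulr_suml.
    rewrite exchange_big/=; apply: eq_bigr => i _; rewrite pE_sum; apply: eq_bigr => a _.
    by rewrite !pEZ mulrA.
  transitivity (\sum_i pE (fun f => \sum_a p i a * (phi (f i) - pmean i phi) * G f a)).
    apply: eq_bigr => i _.
    rewrite (pE_resample i (fun f a => (phi a - pmean i phi) * G f a)).
    by apply: eq_pE => f; apply: eq_bigr => a _; rewrite Gs mulrA.
  rewrite -!pE_sum; apply: eq_pE => f; rewrite exchange_big; apply: eq_bigr => a _.
  by rewrite mulr_suml.
apply: le_trans (ler_norm_sum _ _ _) _.
have Zsq a : pE (fun f => Z a f ^+ 2) = \sum_i \sum_b p i b * (p i a * (phi b - pmean i phi)) ^+ 2.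
  have c0 i : \sum_b p i b * (p i a * (phi b - pmean i phi)) = 0.
    by under eq_bigr do rewrite mulrCA; rewrite -mulr_sumr pcentered mulr0.
  pose h i b := p i a * (phi b - pmean i phi).
  transitivity (pE (fun f => (\sum_i h i (f i)) * (\sum_i h i (f i)))).
    by apply: eq_pE => f; rewrite expr2.
  exact: pE_prod_sum.
(* |z| <= lam / 2 + z^2 / (2 lam) plays the role of Cauchy-Schwarz; [amgm_opt] chooses [lam]
   afterwards. *)
apply: (@le_trans _ _ (\sum_a (lam / 2 + (2 * lam)^-1 * pE (fun f => Z a f ^+ 2)))).
  apply: ler_sum => a _; rewrite -pEZ -(pE_cst (lam / 2)) -pED.
  apply: pE_norm_le => f; rewrite normrM.
  apply: (@le_trans _ _ `|Z a f|); first by rewrite ler_piMr.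
  rewrite -real_normK ?num_real//; move: `|Z a f| => z.
  rewrite -subr_ge0 [leRHS](_ : _ = (2 * lam)^-1 * (z - lam) ^+ 2); last by field; rewrite gt_eqF.
  by apply: mulr_ge0 (sqr_ge0 _); rewrite invr_ge0 mulr_ge0// ltW.
rewrite big_split/= sumr_const -mulr_sumr.
(* For each i the squares p_ia^2 <= p_ia sum to at most 1 over a, so summing over a costs no factor
   k here. *)
have ZV : \sum_a pE (fun f => Z a f ^+ 2) <= pvar phi.
  under eq_bigr do rewrite Zsq.
  rewrite exchange_big/=; apply: ler_sum => i _.
  rewrite exchange_big/=; apply: ler_sum => b _.
  rewrite -mulr_sumr; apply: ler_wpM2l => //.
  rewrite (eq_bigr (fun a => p i a ^+ 2 * (phi b - pmean i phi) ^+ 2)); last by move=> a _; rewrite exprMn.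
  rewrite -mulr_suml; apply: ler_piMl; first exact: sqr_ge0.
  rewrite -(p_sum1 i); apply: ler_sum => a _; rewrite expr2; apply: ler_piMl => //.
  by rewrite -(p_sum1 i) (bigD1 a)//= lerDl sumr_ge0.
rewrite -[(lam / 2) *+ _]mulr_natl.
apply: (@le_trans _ _ (#|J|%:R * (lam / 2) + (2 * lam)^-1 * pvar phi)).
  by rewrite lerD2l; apply: ler_wpM2l => //; rewrite invr_ge0 mulr_ge0// ltW.
by rewrite le_eqVlt; apply/orP; left; apply/eqP; field; rewrite gt_eqF.
Qed.

End product_law.

(** The minimizer is lam = v / sqrt k; for v = 0 it degenerates and lam is taken arbitrarily
    small. *)
Lemma amgm_opt (R : realType) (x k v : R) : 0 < k -> 0 <= v ->
  (forall lam, 0 < lam -> x <= (k * lam + v ^+ 2 / lam) / 2) -> x <= Num.sqrt k * v.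
Proof.
move=> k0; rewrite le_eqVlt => /predU1P[<-|v0] H.
  rewrite mulr0; apply/ler_addgt0Pr => e e0; rewrite add0r.
  have := H (2 * e / k); rewrite !mulr_gt0 ?invr_gt0// => /(_ isT) h; apply: le_trans h _.
  by rewrite le_eqVlt; apply/orP; left; apply/eqP; field; rewrite !gt_eqF.
have s0 : 0 < Num.sqrt k by rewrite sqrtr_gt0.
have := H (v / Num.sqrt k); rewrite divr_gt0// => /(_ isT) h; apply: le_trans h _.
rewrite -{1}(sqr_sqrtr (ltW k0)).
by rewrite le_eqVlt; apply/orP; left; apply/eqP; field; rewrite !gt_eqF.
Qed.

(** * Scores, flows and the cost of shifting the sum *)

Section gmd_law.
Context {R : realType} {k : nat} {I : finType}.
Variables (i0 : 'I_k) (p : I -> 'I_k -> R).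
Local Notation m := k.-1.
Local Notation V := 'rV[R]_m.
Implicit Types (u v x : V) (a b c : 'I_k) (g G : V -> R).

Lemma dotp_sumr (K : Type) (r : seq K) (P : pred K) (y : V) (h : K -> V) :
  dotp y (\sum_(a <- r | P a) h a) = \sum_(a <- r | P a) dotp y (h a).
Proof.
apply: (big_morph (dotp y)); first by move=> u v; rewrite dotpDr.
by rewrite /dotp big1// => j _; rewrite mxE mulr0.
Qed.

(** The basis vector e_a with coordinate [i0] dropped; in particular it is 0 for a = i0. *)
Definition evec (a : 'I_k) : V := \row_j (lift i0 j == a)%:R.

Definition psum (f : {ffun I -> 'I_k}) : V := \sum_i evec (f i).

Definition pmu i : V := \sum_a p i a *: evec a.

Definition pcov : 'M[R]_m :=
  \sum_i \sum_a p i a *: ((evec a - pmu i)^T *m (evec a - pmu i)).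

Definition wgt a b : R := \sum_i p i a * p i b.

Lemma sum_evec (c : 'I_k -> R) j : (\sum_a c a *: evec a) 0 j = c (lift i0 j).
Proof.
rewrite summxE (bigD1 (lift i0 j))//= big1 => [|a aj].
  by rewrite addr0 !mxE eqxx mulr1.
by rewrite !mxE eq_sym (negbTE aj) mulr0.
Qed.

(** The projected basis vectors are affinely independent: coordinates determine the coefficients
    away from [i0], and the total determines the last one. *)
Lemma evec_inj (c d : 'I_k -> R) : \sum_a c a = \sum_a d a ->
  \sum_a c a *: evec a = \sum_a d a *: evec a -> c =1 d.
Proof.
move=> cd1 cd.
have H a : a != i0 -> c a = d a.
  rewrite eq_sym => /unlift_some[j -> _]; have := sum_evec c j.
  by rewrite cd sum_evec.
move=> a; have [->|] := eqVneq a i0; last exact: H.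
move: cd1; rewrite (bigD1 i0)//= [RHS](bigD1 i0)//= (eq_bigr d) => [|b bi]; last exact: H.
exact: addIr.
Qed.

Hypothesis p_ge0 : forall i a, 0 <= p i a.
Hypothesis p_sum1 : forall i, \sum_a p i a = 1.

Lemma wgt_ge0 a b : 0 <= wgt a b.
Proof. by apply: sumr_ge0 => i _; rewrite mulr_ge0. Qed.

Lemma wgtC a b : wgt a b = wgt b a.
Proof. by apply: eq_bigr => i _; rewrite mulrC. Qed.

(** Reading w_ab as conductances, this is the net flow out of [a] under the potential [h]; the
    right-hand side is the coefficient that occurs in [score_le]. *)
Lemma sum_wgt (h : 'I_k -> R) a :
  \sum_b wgt a b * (h a - h b) = \sum_i p i a * (h a - pmean p i h).
Proof.
rewrite (eq_bigr (fun b => \sum_i p i a * (p i b * (h a - h b)))); last first.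
  by move=> b _; rewrite mulr_suml; apply: eq_bigr => i _; rewrite mulrA.
rewrite exchange_big/=; apply: eq_bigr => i _.
rewrite -mulr_sumr; congr (_ * _).
under eq_bigr do rewrite mulrBr.
by rewrite sumrB -mulr_suml p_sum1 mul1r.
Qed.

Lemma sum_antisym (U : lmodType R) (F : 'I_k -> 'I_k -> R) (h : 'I_k -> U) :
  (forall a b, F a b = - F b a) ->
  \sum_a \sum_b F a b *: (h a - h b) = 2 *: \sum_a \sum_b F a b *: h a.
Proof.
move=> FN.
have -> : \sum_a \sum_b F a b *: (h a - h b) = \sum_a \sum_b F a b *: h a - \sum_a \sum_b F a b *: h b.
  rewrite -sumrB; apply: eq_bigr => a _; rewrite -sumrB; apply: eq_bigr => b _.
  by rewrite scalerBr.
rewrite [X in _ - X]exchange_big/= scaler_nat mulr2n -sumrN; congr (_ + _).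
apply: eq_bigr => a _; rewrite -sumrN; apply: eq_bigr => b _.
by rewrite (FN b a) scaleNr opprK.
Qed.

Lemma pmean_dotp i (y : V) : pmean p i (fun a => dotp y (evec a)) = dotp y (pmu i).
Proof.
by rewrite /pmu dotp_sumr; apply: eq_bigr => a _; rewrite dotpZr.
Qed.

(** The terms in [pmu i] cancel because the coefficients have total 0 for each i. Hence y Sigma
    combines the e_a with the coefficients of [score_le]. *)
Lemma mul_pcov (y : V) : y *m pcov =
  \sum_a (\sum_i p i a * (dotp y (evec a) - dotp y (pmu i))) *: evec a.
Proof.
have dE (q r : V) : q *m (r^T *m r) = dotp q r *: r.
  rewrite mulmxA (_ : q *m r^T = (dotp q r)%:M) ?mul_scalar_mx//.
  by apply/matrixP => a b; rewrite !ord1 !mxE mulr1n; apply: eq_bigr => j _; rewrite mxE.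
rewrite /pcov mulmx_sumr (eq_bigr (fun i => \sum_a (p i a * (dotp y (evec a) - dotp y (pmu i))) *: evec a)).
  rewrite exchange_big/=; apply: eq_bigr => a _; rewrite scaler_suml.
  by apply: eq_bigr => i _.
move=> i _; rewrite mulmx_sumr.
transitivity (\sum_a ((p i a * (dotp y (evec a) - dotp y (pmu i))) *: evec a) -
   (\sum_a (p i a * (dotp y (evec a) - dotp y (pmu i)))) *: pmu i).
  rewrite scaler_suml -sumrB; apply: eq_bigr => a _.
  rewrite -scalemxAr dE scalerA -scalerBr; congr (_ * _ *: _).
  by rewrite dotpDr -scaleN1r dotpZr mulN1r.
have := pcentered p_sum1 i (fun a => dotp y (evec a)).
by rewrite pmean_dotp => ->; rewrite scale0r subr0.
Qed.

Lemma quad_pcov (y : V) : dotp (y *m pcov) y = pvar p (fun a => dotp y (evec a)).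
Proof.
rewrite mul_pcov dotpC.
rewrite dotp_sumr (eq_bigr (fun a => \sum_i p i a * (dotp y (evec a) - dotp y (pmu i)) * dotp y (evec a))); last first.
  by move=> a _; rewrite dotpZr mulr_suml.
rewrite exchange_big/=; apply: eq_bigr => i _.
rewrite pmean_dotp; set h := fun a => dotp y (evec a).
have := pcentered p_sum1 i h; rewrite pmean_dotp => c0.
transitivity (\sum_a p i a * (h a - dotp y (pmu i)) * h a - (\sum_a p i a * (h a - dotp y (pmu i))) * dotp y (pmu i)).
  by rewrite c0 mul0r subr0.
by rewrite mulr_suml -sumrB; apply: eq_bigr => a _; rewrite -/(h a); ring.
Qed.

(** The Dirichlet energy of the potential [h], computed by antisymmetry and [sum_wgt]. *)
Lemma pvar_wgt (h : 'I_k -> R) :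
  \sum_a \sum_b wgt a b * (h a - h b) ^+ 2 = 2 * pvar p h.
Proof.
have vE i : \sum_a p i a * (h a - pmean p i h) ^+ 2 = \sum_a p i a * (h a - pmean p i h) * h a.
  apply/eqP; rewrite -subr_eq0 -sumrB (eq_bigr (fun a => - pmean p i h * (p i a * (h a - pmean p i h)))).
    by rewrite -mulr_sumr pcentered// mulr0.
  by move=> a _; ring.
have := @sum_antisym R^o (fun a b => wgt a b * (h a - h b)) h.
rewrite /GRing.scale/= => E.
transitivity (\sum_a \sum_b wgt a b * (h a - h b) * (h a - h b)).
  by apply: eq_bigr => a _; apply: eq_bigr => b _; rewrite expr2 mulrA.
rewrite E; last by move=> a b; rewrite wgtC; ring.
congr (_ * _); rewrite /pvar; under [RHS]eq_bigr do rewrite vE.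
rewrite [RHS]exchange_big/=; apply: eq_bigr => a _.
by rewrite -!mulr_suml sum_wgt.
Qed.


Variables (l : nat) (B : 'M[R]_(m, l)).
Hypothesis BBcov : B *m B^T *m pcov = 1%:M.
Local Notation nb := (bnorm B).

Lemma nb_dotp v : nb v ^+ 2 = dotp (v *m (B *m B^T)) v.
Proof.
rewrite /bnorm sqr_nrm dotpC mulmxA /dotp.
transitivity (\sum_i \sum_j v 0 i * B i j * (v *m B) 0 j).
  rewrite exchange_big/=; apply: eq_bigr => j _; rewrite -mulr_suml; congr (_ * _).
  by rewrite mxE.
apply: eq_bigr => i _; rewrite [(_ *m B^T) 0 i]mxE mulr_sumr; apply: eq_bigr => j _.
by rewrite [B^T j i]mxE; ring.
Qed.

Lemma nb_pvar v : pvar p (fun a => dotp (v *m (B *m B^T)) (evec a)) = nb v ^+ 2.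
Proof. by rewrite -quad_pcov -mulmxA BBcov mulmx1 nb_dotp dotpC. Qed.

(** This is [mul_pcov] at y = v Sigma^-1, where B B^T = Sigma^-1 by [BBcov]: every [v] has a
    potential whose net flow is [v]. *)
Lemma score_decomp v : \sum_a (\sum_i p i a * (dotp (v *m (B *m B^T)) (evec a) -
    pmean p i (fun b => dotp (v *m (B *m B^T)) (evec b)))) *: evec a = v.
Proof.
rewrite -[RHS]mulmx1 -BBcov [RHS]mulmxA mul_pcov.
by apply: eq_bigr => a _; congr (_ *: _); apply: eq_bigr => i _; rewrite pmean_dotp.
Qed.

(** The energies of the rows of B^T add up to 2 tr (B^T Sigma B), which is 2 tr 1. *)
Lemma sum_wgt_nb : \sum_a \sum_b wgt a b * nb (evec a - evec b) ^+ 2 = 2 * m%:R.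
Proof.
have nbE u : nb u ^+ 2 = \sum_j dotp (row j B^T) u ^+ 2 by exact: nrmM_sqr.
transitivity (\sum_j 2 * pvar p (fun a => dotp (row j B^T) (evec a))).
  under [RHS]eq_bigr do rewrite -pvar_wgt.
  rewrite [RHS]exchange_big/=; apply: eq_bigr => a _.
  rewrite [RHS]exchange_big/=; apply: eq_bigr => b _.
  rewrite nbE mulr_sumr; apply: eq_bigr => j _; congr (_ * _ ^+ 2).
  by rewrite dotpDr -scaleN1r dotpZr mulN1r.
rewrite -mulr_sumr; congr (_ * _).
under eq_bigr do rewrite -quad_pcov.
transitivity (\tr (B^T *m pcov *m B)).
  apply: eq_bigr => j _; rewrite -row_mul [RHS]mxE; apply: eq_bigr => i _.
  by rewrite ![row _ _ _ _]mxE [B^T j i]mxE.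
by rewrite -mulmxA mxtrace_mulC -mulmxA mxtrace_mulC BBcov mxtrace1.
Qed.

(** The score coefficients for the potential of e_a - e_b are the indicator of [a] minus that of
    [b]: both families have total 0 and combine the e_c to e_a - e_b, so [evec_inj] identifies them.
    [score_le] then compares exactly the two shifts. *)
Lemma evec_shift a b G : (forall x, `|G x| <= 1) ->
  `|pE p (fun f => G (psum f + evec a)) - pE p (fun f => G (psum f + evec b))| <=
  Num.sqrt k%:R * nb (evec a - evec b).
Proof.
move=> G1; set d := evec a - evec b.
have k0 : 0 < k%:R :> R by rewrite ltr0n (leq_ltn_trans (leq0n a) (ltn_ord a)).
apply: amgm_opt => //; first exact: nrm_ge0.
move=> lam lam0.
pose phi c := dotp (d *m (B *m B^T)) (evec c).
(* Adding one extra value c to the sum makes it symmetric under the exchange of c and f i, the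
   invariance required by [score_le]. *)
have Gs i f c : G (psum (upd f i c) + evec (f i)) = G (psum f + evec c).
  rewrite /psum (bigD1 i)//= updE [in RHS](bigD1 i)//=.
  rewrite (eq_bigr (fun j => evec (f j))); last by move=> j ji; rewrite upd_neq.
  by congr G; rewrite addrAC [RHS]addrAC [evec c + _]addrC.
have := score_le p_ge0 p_sum1 phi lam0 Gs (fun f c => G1 _).
rewrite nb_pvar card_ord => h; apply: le_trans h.
rewrite le_eqVlt; apply/orP; left; apply/eqP; congr `|_|.
pose c0 c : R := (c == a)%:R - (c == b)%:R.
have dlt c : \sum_x (x == c)%:R = 1 :> R.
  by rewrite (bigD1 c)//= eqxx big1 ?addr0// => x /negbTE ->.
have dlte (F : 'I_k -> R) c : \sum_x (x == c)%:R * F x = F c.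
  by rewrite (bigD1 c)//= eqxx big1 ?addr0 ?mul1r// => x /negbTE ->; rewrite mul0r.
rewrite (eq_bigr (fun c => c0 c * pE p (fun f => G (psum f + evec c)))); last first.
  move=> c _; congr (_ * _); apply: (evec_inj (c := fun c => \sum_i _)).
    rewrite exchange_big/= big1; last by move=> i _; exact: pcentered.
    by rewrite sumrB !dlt subrr.
  rewrite score_decomp.
  apply/rowP => j; rewrite sum_evec !mxE; rewrite eq_sym [in X in _ - X]eq_sym.
  by rewrite /c0 eq_sym [in X in _ - X]eq_sym.
under eq_bigr do rewrite mulrBl.
by rewrite sumrB !dlte.
Qed.

(** Quantifying over all bounded [G] makes the cost subadditive and even in [u], because translates
    of [G] are again admissible; moves can then be composed. *)
Definition shift_cost u (d : R) := forall G, (forall x, `|G x| <= 1) ->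
  `|pE p (fun f => G (psum f + u)) - pE p (fun f => G (psum f))| <= d.

Lemma shift_cost_le u (d d' : R) : d <= d' -> shift_cost u d -> shift_cost u d'.
Proof. by move=> dd' H G G1; exact: le_trans (H G G1) dd'. Qed.

Lemma shift_cost0 : shift_cost 0 0.
Proof.
by move=> G G1; under eq_pE do rewrite addr0; rewrite subrr normr0.
Qed.

Lemma shift_costD u v (d d' : R) : shift_cost u d -> shift_cost v d' -> shift_cost (u + v) (d + d').
Proof.
move=> Hu Hv G G1; apply: le_trans (ler_distD (pE p (fun f => G (psum f + u))) _ _) _.
rewrite addrC; apply: lerD; first exact: Hu.
have := Hv (fun x => G (x + u)) (fun x => G1 (x + u)).
by under eq_pE do rewrite -addrA (addrC v).
Qed.

Lemma shift_costN u (d : R) : shift_cost u d -> shift_cost (- u) d.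
Proof.
move=> Hu G G1; have := Hu (fun x => G (x - u)) (fun x => G1 (x - u)).
by rewrite distrC; under [X in _ - X]eq_pE do rewrite addrK.
Qed.

Lemma shift_cost_sum (K : Type) (r : seq K) (u : K -> V) (d : K -> R) :
  (forall x : K, shift_cost (u x) (d x)) -> shift_cost (\sum_(x <- r) u x) (\sum_(x <- r) d x).
Proof.
move=> H; elim: r => [|x r IH]; first by rewrite !big_nil; exact: shift_cost0.
by rewrite !big_cons; exact: shift_costD.
Qed.

Lemma shift_cost_int u (d : R) (z : int) : shift_cost u d -> shift_cost (z%:~R *: u) (`|z%:~R| * d).
Proof.
move=> H.
have nat_case n : shift_cost (n%:R *: u) (n%:R * d).
  elim: n => [|n IH]; first by rewrite scale0r mul0r; exact: shift_cost0.
  by rewrite mulrS scalerDl scale1r mulrDl mul1r; exact: shift_costD.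
case: z => n; first by rewrite ger0_norm ?ler0n//; exact: nat_case.
rewrite NegzE mulrNz normrN scaleNr.
by apply: shift_costN; rewrite ger0_norm ?ler0n//; exact: nat_case.
Qed.

Lemma shift_cost_evec a b : shift_cost (evec a - evec b) (Num.sqrt k%:R * nb (evec a - evec b)).
Proof.
move=> G G1; have := evec_shift a b (fun x => G1 (x - evec b)).
by under eq_pE do rewrite -addrA; under [X in _ - X]eq_pE do rewrite addrK.
Qed.

(** The flow of the potential of [v]. By antisymmetry every pair counts twice, hence the division by
    2, and the net flows recombine to [v]. *)
Lemma flow_decomp v : v = \sum_a \sum_b (wgt a b * (dotp (v *m (B *m B^T)) (evec a) -
    dotp (v *m (B *m B^T)) (evec b)) / 2) *: (evec a - evec b).
Proof.
set h := fun a => dotp (v *m (B *m B^T)) (evec a).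
have := @sum_antisym V (fun a b => wgt a b * (h a - h b)) evec.
move=> /(_ _)H; transitivity (2^-1 *: \sum_a \sum_b (wgt a b * (h a - h b)) *: (evec a - evec b)).
  rewrite H; last by move=> a b; rewrite wgtC; ring.
  rewrite scalerA mulVf ?pnatr_eq0// scale1r -[LHS]score_decomp.
  by apply: eq_bigr => a _; rewrite -scaler_suml sum_wgt.
rewrite scaler_sumr; apply: eq_bigr => a _; rewrite scaler_sumr; apply: eq_bigr => b _.
by rewrite scalerA mulrC.
Qed.

(* The shift is split along the rounded flow [T a b] of [flow_decomp], and the
   bounded remainder [rz] is moved one coordinate at a time. *)
Lemma shift_cost_row (kap eta : R) v (z : 'I_m -> int) : 0 < eta ->
  (forall a b, nb (evec a - evec b) <= kap) ->
  (forall j, `|(z j)%:~R - v 0 j| <= 2^-1) ->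
  shift_cost (\row_j (z j)%:~R) (Num.sqrt k%:R *
    ((eta * m%:R + nb v ^+ 2 / eta) / 2 + kap * (k%:R ^+ 2 + m%:R * (2^-1 + k%:R ^+ 2)))).
Proof.
move=> eta0 Hk Hz.
pose h a := dotp (v *m (B *m B^T)) (evec a).
pose F a b := wgt a b * (h a - h b).
pose T a b : int := Num.floor (F a b / 2).
pose rz j : int := z j - \sum_a \sum_b T a b * ((lift i0 j == a)%:R - (lift i0 j == b)%:R).
have T1 a b : 0 <= F a b / 2 - (T a b)%:~R <= 1.
  rewrite /T; have := floor_itv (F a b / 2) => /andP[h1 h2].
  by rewrite intrD1 in h2; lra.
have dE a b j : (evec a - evec b) 0 j = (lift i0 j == a)%:R - (lift i0 j == b)%:R.
  by rewrite !mxE.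
have zE (r : R) u j : (r *: u) 0 j = r * u 0 j by rewrite mxE.
have rzE j : (rz j)%:~R = (z j)%:~R - \sum_a \sum_b (T a b)%:~R * (evec a - evec b) 0 j :> R.
  rewrite /rz rmorphB rmorph_sum; congr (_ - _); apply: eq_bigr => a _.
  rewrite rmorph_sum; apply: eq_bigr => b _.
  by rewrite rmorphM rmorphB !rmorph_nat dE.
(* [z] is within 1/2 of [v], and each of the k^2 floors loses at most 1 in a given coordinate. *)
have rz1 j : `|(rz j)%:~R| <= 2^-1 + k%:R ^+ 2 :> R.
  have -> : (rz j)%:~R = ((z j)%:~R - v 0 j) +
      \sum_a \sum_b (F a b / 2 - (T a b)%:~R) * (evec a - evec b) 0 j.
    rewrite rzE [in RHS](flow_decomp v) summxE -addrA; congr (_ + _).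
    rewrite addrC -sumrB -sumrN; apply: eq_bigr => a _.
    rewrite summxE -sumrB -sumrN; apply: eq_bigr => b _.
    by rewrite zE -/(h a) -/(h b) -/(F a b); ring.
  apply: le_trans (ler_normD _ _) _; apply: lerD => //.
  apply: le_trans (ler_norm_sum _ _ _) _.
  have -> : k%:R ^+ 2 = \sum_(a < k) \sum_(b < k) 1 :> R.
    by rewrite !sumr_const card_ord -mulrnA natrM expr2.
  apply: ler_sum => a _; apply: le_trans (ler_norm_sum _ _ _) _; apply: ler_sum => b _.
  rewrite normrM dE; have /andP[t0 t1] := T1 a b; rewrite ger0_norm//.
  apply: mulr_ile1 => //.
  by case: (_ == a); case: (_ == b); rewrite ?subrr ?subr0 ?sub0r ?normrN ?normr0 ?normr1 ?ler01.
(* As [evec i0] is 0, the difference evec (lift i0 j) - evec i0 is the j-th unit vector, which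
   corrects one coordinate alone. *)
have -> : \row_j (z j)%:~R = \sum_a \sum_b (T a b)%:~R *: (evec a - evec b) +
    \sum_j (rz j)%:~R *: (evec (lift i0 j) - evec i0) :> V.
  apply/rowP => j; rewrite mxE [RHS]mxE.
  have -> : (\sum_j (rz j)%:~R *: (evec (lift i0 j) - evec i0) : V) 0 j = (rz j)%:~R.
    rewrite summxE (bigD1 j)//= big1 ?addr0 => [|j' jj'].
      by rewrite zE dE eqxx [_ == i0]eq_sym (negbTE (neq_lift _ _)) subr0 mulr1.
    rewrite zE dE (inj_eq lift_inj) eq_sym (negbTE jj') eq_sym (negbTE (neq_lift _ _)).
    by rewrite subrr mulr0.
  rewrite rzE addrC summxE -[LHS](subrK (\sum_a \sum_b (T a b)%:~R * (evec a - evec b) 0 j)).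
  congr (_ + _).
  by apply: eq_bigr => a _; rewrite summxE; apply: eq_bigr => b _; rewrite zE.
have kap0 a b : 0 <= nb (evec a - evec b) by exact: nrm_ge0.
have s0 : 0 <= Num.sqrt k%:R :> R by exact: sqrtr_ge0.
apply: shift_cost_le (shift_costD (shift_cost_sum _ (fun a => shift_cost_sum _ (fun b =>
    shift_cost_int (T a b) (shift_cost_evec a b))))
   (shift_cost_sum _ (fun j => shift_cost_int (rz j) (shift_cost_evec (lift i0 j) i0)))).
rewrite [X in _ * (_ + X)]mulrDr addrA mulrDr; apply: lerD; last first.
  rewrite mulrCA -[leRHS](_ : \sum_(j < m) (2^-1 + k%:R ^+ 2) * (Num.sqrt k%:R * kap) = _); last first.
    by rewrite sumr_const card_ord -[LHS]mulr_natl; ring.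
  apply: ler_sum => j _; apply: ler_pM => //; first exact: mulr_ge0.
  by apply: ler_wpM2l.
rewrite mulrDr.
have -> : Num.sqrt k%:R * (kap * k%:R ^+ 2) = \sum_(a < k) \sum_(b < k) Num.sqrt k%:R * kap.
  rewrite (eq_bigr (fun=> k%:R * (Num.sqrt k%:R * kap))); last first.
    by move=> a _; rewrite sumr_const card_ord -[LHS]mulr_natl.
  by rewrite sumr_const card_ord -[RHS]mulr_natl; ring.
(* The energy identities distribute the bound over the pairs (a, b). For each pair there remains an
   AM-GM inequality: |F a b| y / 2 <= w (eta y^2 + (h a - h b)^2 / eta) / 4, with w the weight and y
   the norm of e_a - e_b. *)
have -> : (eta * m%:R + nb v ^+ 2 / eta) / 2 =
    \sum_a \sum_b (eta * (wgt a b * nb (evec a - evec b) ^+ 2) + (wgt a b * (h a - h b) ^+ 2) / eta) / 4.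
  transitivity ((eta * (2 * m%:R) + (2 * nb v ^+ 2) / eta) / 4); first by field; rewrite gt_eqF.
  rewrite -sum_wgt_nb -nb_pvar -pvar_wgt.
  rewrite mulr_sumr mulr_suml -big_split/= mulr_suml; apply: eq_bigr => a _.
  by rewrite mulr_sumr mulr_suml -big_split/= mulr_suml.
rewrite mulr_sumr -big_split/=; apply: ler_sum => a _.
rewrite mulr_sumr -big_split/=; apply: ler_sum => b _.
rewrite mulrCA -mulrDr; apply: ler_wpM2l => //.
have Tle : `|(T a b)%:~R| <= `|F a b| / 2 + 1.
  have /andP[t0 t1] := T1 a b.
  have := ler_norm (F a b); have := ler_norm (- F a b); rewrite normrN => n1 n2.
  by rewrite ler_norml; apply/andP; split; lra.
apply: (@le_trans _ _ ((`|F a b| / 2 + 1) * nb (evec a - evec b))); first exact: ler_wpM2r.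
rewrite mulrDl mul1r; apply: lerD => //.
rewrite /F normrM (ger0_norm (wgt_ge0 a b)) -(real_normK (num_real (h a - h b))).
move: (wgt a b) (wgt_ge0 a b) `|_| (nb _) => w w0 x y.
rewrite -subr_ge0 [leRHS](_ : _ = w * (4 * eta)^-1 * (x - eta * y) ^+ 2); last by field; rewrite gt_eqF.
by apply: mulr_ge0 (sqr_ge0 _); apply: mulr_ge0 => //; rewrite invr_ge0 mulr_ge0// ltW.
Qed.

End gmd_law.

(** * Quadratic forms and the smallest eigenvalue *)

Section quadratic_form.
Context {R : realType} {m : nat}.
Implicit Types (u v : 'rV[R]_m) (M S : 'M[R]_m).

Lemma dotpE (p : nat) (b c : 'rV[R]_p) : dotp b c = (b *m c^T) 0 0.
Proof. by rewrite mxE; apply: eq_bigr => i _; rewrite mxE. Qed.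

Lemma dotp_mulmx (p q : nat) (b : 'rV[R]_p) (c : 'rV[R]_q) (M : 'M[R]_(p, q)) :
  dotp (b *m M) c = dotp b (c *m M^T).
Proof. by rewrite !dotpE trmx_mul trmxK mulmxA. Qed.

Lemma dotp_eq0 u : dotp u u = 0 -> u = 0.
Proof.
move=> u0; apply/rowP => j; rewrite mxE; apply/eqP.
have /eqP := u0; rewrite /dotp psumr_eq0; last by move=> i _; rewrite -expr2 sqr_ge0.
by move=> /allP/(_ j); rewrite mem_index_enum => /(_ isT); rewrite /= mulf_eq0 orbb.
Qed.

Lemma mulmx_bounded M : exists2 K : R, 0 < K &
  forall u, dotp (u *m M) (u *m M) <= K * dotp u u.
Proof.
exists (1 + \sum_j dotp (row j M^T) (row j M^T)).
  by rewrite ltr_pwDl// sumr_ge0// => j _; exact: dotp_ge0.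
move=> u; apply: (@le_trans _ _ ((\sum_j dotp (row j M^T) (row j M^T)) * dotp u u)).
  rewrite -sqr_nrm nrmM_sqr mulr_suml; apply: ler_sum => j _; exact: dotp_CS.
by apply: ler_wpM2r; [exact: dotp_ge0|rewrite lerDr].
Qed.

Lemma psd_CS M u v : M^T = M -> (forall w, 0 <= dotp (w *m M) w) ->
  dotp (u *m M) v ^+ 2 <= dotp (u *m M) u * dotp (v *m M) v.
Proof.
move=> Ms M0; apply: quad_disc (M0 v) _ => t; have := M0 (u + (- t) *: v).
rewrite mulmxDl -scalemxAl dotpDl !dotpDr !dotpZl !dotpZr.
rewrite (_ : dotp (v *m M) u = dotp (u *m M) v); last by rewrite dotp_mulmx Ms dotpC.
move=> h.
by rewrite (_ : _ + _ = dotp (u *m M) u + - t * dotp (u *m M) v +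
  (- t * dotp (u *m M) v + - t * (- t * dotp (v *m M) v)))//; ring.
Qed.

(* With v = u M, Cauchy-Schwarz for the form M bounds |v|^2 by a multiple of
   u M u^T, and |u| is bounded by a multiple of |v|. *)
Lemma psd_unit_coercive M : M^T = M -> (forall w, 0 <= dotp (w *m M) w) ->
  M \in unitmx -> exists2 c : R, 0 < c & forall u, c * dotp u u <= dotp (u *m M) u.
Proof.
move=> Ms M0 Mu.
have [K K0 HK] := mulmx_bounded M; have [L L0 HL] := mulmx_bounded (invmx M).
(* The constant comes from 2 (v M) . v <= |v M|^2 + |v|^2 <= (K + 1) |v|^2. *)
have T0 : 0 < (K + 1) / 2 by rewrite divr_gt0// ltr_pwDr// ltW.
exists (L * ((K + 1) / 2))^-1; first by rewrite invr_gt0 mulr_gt0.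
have LT : 0 < L * ((K + 1) / 2) by rewrite mulr_gt0.
move=> u; rewrite mulrC ler_pdivrMr// mulrC -mulrA.
have h1 : dotp u u <= L * dotp (u *m M) (u *m M).
  by rewrite -{1 2}[u](mulmxK Mu); exact: HL.
apply: (le_trans h1); apply: ler_wpM2l; first exact: ltW.
set v := u *m M.
have h2 : dotp (v *m M) v <= (K + 1) / 2 * dotp v v.
  have := HK v; have := dotp_ge0 (v *m M + (-1) *: v).
  by rewrite dotpDl !dotpDr !dotpZl !dotpZr (dotpC v (v *m M)); nra.
have h3 := psd_CS u v Ms M0; rewrite -/v in h3.
have [v0|v0] := eqVneq (dotp v v) 0; first by rewrite v0; apply: mulr_ge0; [exact: ltW|exact: M0].
have vp : 0 < dotp v v by rewrite lt_def v0 dotp_ge0.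
rewrite -(ler_pM2r vp) -expr2; apply: (le_trans h3).
rewrite [leRHS](_ : _ = dotp v u * ((K + 1) / 2 * dotp v v)); last by ring.
by apply: ler_wpM2l => //; exact: M0.
Qed.

Lemma not_unit_eigenvalue S (a : R) : S - a%:M \notin unitmx -> eigenvalue S a.
Proof. by rewrite /eigenvalue /eigenspace kermx_eq0 row_free_unit. Qed.

(* The largest t with t |u|^2 <= u S u^T for all u is an eigenvalue of S: otherwise
   S - t would be coercive. *)
Lemma min_eigenvalue_quad S (a : R) : S^T = S -> (forall u, 0 <= dotp (u *m S) u) ->
  is_min_eigenvalue S a -> forall u, a * dotp u u <= dotp (u *m S) u.
Proof.
move=> Ss S0 [ea amin] u.
have [->|u0] := eqVneq u 0.
  by rewrite mul0mx dotpC /dotp !big1 ?mulr0// => i _; rewrite mxE mul0r.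
have posd (w : 'rV[R]_m) : w != 0 -> 0 < dotp w w.
  by move=> w0; rewrite lt_def dotp_ge0 andbT; apply: contraNneq w0 => /dotp_eq0 /eqP.
pose E := [set t : R | forall u, t * dotp u u <= dotp (u *m S) u].
have E0 : E 0 by move=> w; rewrite mul0r.
have supE : has_sup E.
  split; first by exists 0.
  by exists (dotp (u *m S) u / dotp u u) => t Et; rewrite ler_pdivlMr ?posd.
have Es : E (sup E).
  move=> w; have [->|w0] := eqVneq w 0.
    by rewrite mul0mx dotpC /dotp !big1 ?mulr0// => i _; rewrite mxE mul0r.
  rewrite -ler_pdivlMr ?posd//; apply: ge_sup; first by exists 0.
  by move=> t Et; rewrite ler_pdivlMr ?posd.
have eigs : eigenvalue S (sup E).
  apply: not_unit_eigenvalue; apply/negP => Su.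
  have MS : (S - (sup E)%:M)^T = S - (sup E)%:M by rewrite linearB/= tr_scalar_mx Ss.
  have ME w : dotp (w *m (S - (sup E)%:M)) w = dotp (w *m S) w - sup E * dotp w w.
    by rewrite mulmxBr mul_mx_scalar dotpDl -scaleN1r !dotpZl mulN1r.
  have M0 w : 0 <= dotp (w *m (S - (sup E)%:M)) w by rewrite ME subr_ge0; exact: Es.
  have [c c0 Hc] := psd_unit_coercive MS M0 Su.
  have : E (sup E + c) by move=> w; have := Hc w; rewrite ME; lra.
  by move=> /(ub_le_sup supE.2); rewrite gerDl leNgt c0.
by apply: le_trans (Es u); apply: ler_wpM2r; [exact: dotp_ge0|exact: amin].
Qed.

Lemma min_eigenvalue_unit S (a : R) : 0 < a -> is_min_eigenvalue S a -> S \in unitmx.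
Proof.
move=> a0 [_ amin]; apply/negPn/negP => Su.
have := amin 0; rewrite leNgt a0 => /(_ _)/negP; apply => //.
by apply: not_unit_eigenvalue; rewrite raddf0 subr0.
Qed.

(** With y = v S^-1, the hypothesis reads a |y|^2 <= y . v; insert it in (y . v)^2 <= |y|^2 |v|^2
    and divide by y . v. *)
Lemma quad_inv_le S (a : R) v : 0 < a -> S^T = S ->
  (forall u, a * dotp u u <= dotp (u *m S) u) -> S \in unitmx ->
  dotp (v *m invmx S) v <= dotp v v / a.
Proof.
move=> a0 Ss Sa Su; set y := v *m invmx S.
have yS : v = y *m S by rewrite mulmxKV.
have h1 := Sa y; rewrite -yS in h1; have h2 := dotp_CS y v.
rewrite ler_pdivlMr//; rewrite (dotpC v y) in h1.
have y0 := dotp_ge0 y; have v0 := dotp_ge0 v.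
have d0 : 0 <= dotp y v by apply: le_trans h1; apply: mulr_ge0 => //; exact: ltW.
move: d0; rewrite le_eqVlt => /predU1P[<-|d0]; first by rewrite mul0r.
rewrite -(ler_pM2l d0) mulrA -expr2.
apply: (@le_trans _ _ (dotp y y * dotp v v * a)); first by apply: ler_wpM2r => //; exact: ltW.
by rewrite mulrAC (mulrC _ a); apply: ler_wpM2r.
Qed.

Lemma nrmD (p : nat) (b c : 'rV[R]_p) : nrm (b + c) <= nrm b + nrm c.
Proof.
rewrite -(@ler_pXn2r _ 2)// ?nnegrE ?addr_ge0 ?nrm_ge0// sqrrD !sqr_nrm.
rewrite dotpDl !dotpDr (dotpC c b).
have h : dotp b c <= nrm b * nrm c.
  apply: le_trans (ler_norm _) _.
  rewrite -(@ler_pXn2r _ 2)// ?nnegrE ?mulr_ge0 ?nrm_ge0//.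
  by rewrite real_normK ?num_real// exprMn !sqr_nrm dotp_CS.
by rewrite -[leRHS]addrAC; lra.
Qed.

End quadratic_form.

(** * The three comparisons for the product law *)

Section core.
Context {R : realType} {k : nat} {I : finType}.
Variables (i0 : 'I_k) (p : I -> 'I_k -> R).
Local Notation m := k.-1.
Local Notation V := 'rV[R]_m.
Local Notation evec := (evec i0).
Local Notation psum := (psum i0).
Local Notation pmu := (pmu i0 p).
Local Notation W := (@wcst R).

Definition rd (x : V) : V := \row_j (Num.floor (x 0 j + 2^-1))%:~R.

(** The sum has integer coordinates, so after rounding any perturbation acts as an integer shift. *)
Lemma rd_shift (f : {ffun I -> 'I_k}) v : rd (psum f + v) = psum f + rd v.
Proof.
apply/rowP => j; rewrite !mxE.
have -> : psum f 0 j = (\sum_(i : I) (lift i0 j == f i)%:Z)%:~R :> R.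
  by rewrite summxE rmorph_sum; apply: eq_bigr => i _; rewrite mxE.
by rewrite -addrA floorDzr ?intr_int// intrKfloor rmorphD.
Qed.

Lemma rd_psum (f : {ffun I -> 'I_k}) : rd (psum f) = psum f.
Proof.
rewrite -[psum f]addr0 rd_shift; congr (_ + _); apply/rowP => j; rewrite !mxE add0r.
by have -> : Num.floor (2^-1 : R) = 0 by apply: floor_def; rewrite add0r; apply/andP; split; lra.
Qed.

Hypothesis p_ge0 : forall i a, 0 <= p i a.
Hypothesis p_sum1 : forall i, \sum_a p i a = 1.

Definition crv_law i : seq (R * V) := [seq (p i a, evec a - pmu i) | a <- enum 'I_k].

Lemma lawE_crv i g : lawE (crv_law i) g = \sum_a p i a * g (evec a - pmu i).
Proof. by rewrite /lawE /crv_law big_map big_enum. Qed.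

Lemma is_law_crv i : is_law (crv_law i).
Proof.
split; first by apply/allP => _ /mapP[a _ ->] /=.
by rewrite /crv_law big_map big_enum/=.
Qed.

(** [pE_upd] draws the head coordinate, and [uniq] ensures that updating it leaves the remaining
    terms unchanged. *)
Lemma pE_crv (r : seq I) (g : V -> R) x : uniq r ->
  pE p (fun f => g (x + \sum_(i <- r) (evec (f i) - pmu i))) =
  law_shift (bigconv [seq crv_law i | i <- r]) g x.
Proof.
rewrite /law_shift; elim: r x => [|i r IH] x /=.
  by rewrite lawE_law0 => _; under eq_pE do rewrite big_nil; rewrite pE_cst.
move=> /andP[ir ur]; rewrite lawE_conv lawE_crv (pE_upd p_sum1 i).
apply: eq_bigr => a _; congr (_ * _).
under eq_lawE do rewrite addrA.
rewrite -IH//; apply: eq_pE => f; rewrite big_cons updE addrA; congr (g (_ + _)).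
rewrite big_seq [RHS]big_seq; apply: eq_bigr => j jr; rewrite upd_neq//.
by apply: contraNneq ir => <-.
Qed.

Lemma pE_psum (g : V -> R) :
  pE p (fun f => g (psum f)) = law_shift (bigconv [seq crv_law i | i <- enum I]) g (\sum_i pmu i).
Proof.
rewrite -pE_crv ?enum_uniq//; apply: eq_pE => f; congr g.
by rewrite big_enum/= sumrB addrC subrK.
Qed.

Lemma centered_crv i : centered (crv_law i).
Proof.
move=> j; rewrite lawE_crv.
transitivity ((\sum_a p i a *: (evec a - pmu i)) 0 j).
  by rewrite summxE; apply: eq_bigr => a _; rewrite [RHS]mxE.
under eq_bigr do rewrite scalerBr.
by rewrite sumrB -scaler_suml p_sum1 scale1r subrr mxE.
Qed.

Lemma law_cov_crv : \sum_(i <- enum I) law_cov (crv_law i) = pcov i0 p.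
Proof.
rewrite big_enum/=; apply: eq_bigr => i _; apply/matrixP => a b; rewrite mxE lawE_crv summxE.
by apply: eq_bigr => c _; rewrite [RHS]mxE; congr (_ * _);
  rewrite [RHS]mxE big_ord1 [_^T _ _]mxE.
Qed.

Variables (l : nat) (A : 'M[R]_(l, m)) (B : 'M[R]_(m, l)) (kap : R).
Hypothesis covA : A^T *m A = pcov i0 p.
Hypothesis BA : B *m A = 1%:M.
Hypothesis BBcov : B *m B^T *m pcov i0 p = 1%:M.
Hypothesis kap0 : 0 < kap.
Hypothesis nb_kap : forall a b, bnorm B (evec a - evec b) <= kap.
Local Notation nb := (bnorm B).

(** e_a - pmu i is a convex combination of the differences e_a - e_b. *)
Lemma nb_crv i a : a \in crv_law i -> nb a.2 <= kap.
Proof.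
move=> /mapP[{}a _ ->] /=.
have -> : evec a - pmu i = \sum_b p i b *: (evec a - evec b).
  under eq_bigr do rewrite scalerBr.
  by rewrite sumrB -scaler_suml p_sum1 scale1r.
apply: (@le_trans _ _ (\sum_b p i b * nb (evec a - evec b))).
  elim/big_ind2 : _ => [|u x v y ux vy|b _].
  - by rewrite /bnorm mul0mx /nrm /dotp big1 ?sqrtr0// => j _; rewrite mxE mul0r.
  - by rewrite /bnorm mulmxDl; apply: le_trans (nrmD _ _) _; exact: lerD.
  - by rewrite bnormZ ger0_norm.
rewrite -[leRHS]mul1r -(p_sum1 i) mulr_suml; apply: ler_sum => b _.
exact: ler_wpM2l.
Qed.

Lemma EG_nbA2 : EG (fun z => nb (z *m A) ^+ 2) = m%:R.
Proof.
rewrite (eq_EG (G := fun z => nrm (z *m (A *m B)) ^+ 2)); last by move=> z; rewrite /bnorm mulmxA.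
rewrite EG_nrmM2 trmx_mul -mulmxA mxtrace_mulC -!mulmxA (mulmxA A^T) covA.
by rewrite mxtrace_mulC BBcov mxtrace1.
Qed.

Lemma Gi_nbA2 : Gi (fun z => nb (z *m A) ^+ 2).
Proof.
apply: (eq_Gi (F := fun z => nrm (z *m (A *m B)) ^+ 2)); last exact: Gi_nrmM2.
by move=> z; rewrite /bnorm mulmxA.
Qed.

Variable G : V -> R.
Hypothesis mG : meas01 (fun x => G (rd x)).
Hypothesis G01 : forall x, `|G x| <= 1.
Local Notation f := (fun x => G (rd x)).

(** For fixed [z], [rd_shift] turns the perturbation e z A into an integer shift of the sum; its
    cost is then averaged over [z]. *)
Lemma pE_smooth_le (e : R) : 0 < e ->
  `|pE p (fun w => smooth A e f (psum w)) - pE p (fun w => f (psum w))| <=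
  Num.sqrt k%:R * (e * m%:R + kap * (k%:R ^+ 2 + m%:R * (2^-1 + k%:R ^+ 2))).
Proof.
move=> e0.
have gi w : Gi (fun z : 'rV[R]_l => pw p w * f (psum w + e *: (z *m A))).
  by apply: GiZ; exact: (Gi_smooth_arg A e (psum w) mG).
have gi2 : Gi (fun z : 'rV[R]_l => pE p (fun w => f (psum w + e *: (z *m A)))).
  by apply: Gi_sum.
have -> : pE p (fun w => smooth A e f (psum w)) =
    EG (fun z => pE p (fun w => f (psum w + e *: (z *m A)))).
  rewrite [RHS]EG_sum//; apply: eq_bigr => w _.
  by rewrite EGZ//; exact: (Gi_smooth_arg A e (psum w) mG).
rewrite -(@EG_cst R l (pE p (fun w => f (psum w)))) -EGB//; last exact: Gi_cst.
set c := kap * _.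
(* [shift_cost_row] is used with eta = e and v = e z A, so that both halves of its AM-GM term have
   mean e m / 2. *)
pose bd (z : 'rV[R]_l) := Num.sqrt k%:R * (e * m%:R / 2 + c) + (Num.sqrt k%:R * (e / 2)) * nb (z *m A) ^+ 2.
have gb : Gi bd by apply: GiD; [exact: Gi_cst|apply: GiZ; exact: Gi_nbA2].
have <- : EG bd = Num.sqrt k%:R * (e * m%:R + c).
  rewrite EGD; [|exact: Gi_cst|by apply: GiZ; exact: Gi_nbA2].
  by rewrite EG_cst EGZ ?EG_nbA2; [field|exact: Gi_nbA2].
apply: EG_norm_le => //; first by apply: GiB => //; exact: Gi_cst.
move=> z; set v := e *: (z *m A).
have Hz j : `|(Num.floor (v 0 j + 2^-1))%:~R - v 0 j| <= 2^-1.
  have /andP[h1 h2] := floor_itv (v 0 j + 2^-1); rewrite intrD1 in h2.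
  by rewrite ler_norml; apply/andP; split; lra.
have := shift_cost_row p_ge0 p_sum1 BBcov e0 nb_kap Hz.
rewrite -/c -/(rd v) => /(_ G G01) h.
under eq_pE do rewrite rd_shift.
under [X in _ - X]eq_pE do rewrite rd_psum.
apply: le_trans h _; rewrite /bd /v bnormZ gtr0_norm//.
by rewrite le_eqVlt; apply/orP; left; apply/eqP; field; rewrite gt_eqF.
Qed.

Lemma pE_gauss_le (e : R) : 0 < e ->
  `|pE p (fun w => f (psum w)) - smooth A 1 f (\sum_i pmu i)| <=
  Num.sqrt k%:R * (e * m%:R + kap * (k%:R ^+ 2 + m%:R * (2^-1 + k%:R ^+ 2))) +
  5 * kap * W / e ^+ 3 * m%:R + W * e * ((1 + m%:R) / 2).
Proof.
move=> e0; set mu := \sum_i pmu i.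
apply: le_trans (ler_distD (smooth A 1 (smooth A e f) mu) _ _) _; apply: lerD.
  apply: le_trans (ler_distD (pE p (fun w => smooth A e f (psum w))) _ _) _; apply: lerD.
    by rewrite distrC; exact: pE_smooth_le.
  rewrite pE_psum -/mu.
  have := lindeberg BA mu kap0 e0 mG is_law_crv centered_crv nb_crv (L := enum I).
  rewrite law_cov_crv -covA => /(_ erefl).
  rewrite (trace_law_cov B (A := A)) ?law_cov_crv//.
  by rewrite covA BBcov mxtrace1.
(* The two smoothings are exchanged so that the Lipschitz bound is the one of G_1, whose constant is
   free of e. *)
rewrite smooth_stable// [1 ^+ 2 + _]addrC -smooth_stable//.
rewrite [smooth A e _ _]/smooth -(@EG_cst R l (smooth A 1 f mu)) -EGB; [|exact: Gi_smooth_arg (smooth01 A 1 mG)|exact: Gi_cst].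
(* |u| <= (1 + |u|^2) / 2 reduces the mean norm to the second moment, which is the dimension m. *)
have gb : Gi (fun z : 'rV[R]_l => W * e * (2^-1 + 2^-1 * nb (z *m A) ^+ 2)).
  by apply: GiZ; apply: GiD; [exact: Gi_cst|apply: GiZ; exact: Gi_nbA2].
have <- : EG (fun z : 'rV[R]_l => W * e * (2^-1 + 2^-1 * nb (z *m A) ^+ 2)) = W * e * ((1 + m%:R) / 2).
  rewrite EGZ; last by apply: GiD; [exact: Gi_cst|apply: GiZ; exact: Gi_nbA2].
  rewrite EGD; [|exact: Gi_cst|by apply: GiZ; exact: Gi_nbA2].
  by rewrite EG_cst EGZ ?EG_nbA2; [field|exact: Gi_nbA2].
apply: EG_norm_le => //.
  by apply: GiB; [exact: Gi_smooth_arg (smooth01 A 1 mG)|exact: Gi_cst].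
move=> z; apply: le_trans (smooth_lipschitz BA _ _ ltr01 mG) _.
rewrite divr1 bnormZ gtr0_norm// -mulrA; apply: ler_wpM2l; first exact: ltW (wcst_gt0 R).
apply: ler_wpM2l; first exact: ltW.
by have := sqr_ge0 (nb (z *m A) - 1); nra.
Qed.

End core.

(** * Laws on tuples, determined by boxes *)

Section tuple_laws.
Context {R : realType}.

Definition box l (E : 'I_l -> set R) : set (l.-tuple R) := [set t | forall i, E i (tnth t i)].

Lemma boxE l (E : 'I_l -> set R) : box E = \bigcap_(i in [set: 'I_l]) ((fun t => tnth t i) @^-1` E i).
Proof. by apply/seteqP; split => t /= H i; [move=> _; exact: H|exact: H]. Qed.

Lemma measurable_box l (E : 'I_l -> set R) : (forall i, measurable (E i)) -> measurable (box E).
Proof.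
move=> mE; rewrite boxE; apply: fin_bigcap_measurable; first exact: finite_finset.
move=> i _; rewrite -[X in measurable X]setTI.
by apply: measurable_tnth.
Qed.

Lemma measurable_tuple1 l (t : l.-tuple R) : measurable [set t].
Proof.
rewrite (_ : [set t] = box (fun i => [set tnth t i])); first by apply: measurable_box.
by apply/seteqP; split => [u ->//|u H]; apply/eq_from_tnth.
Qed.

(** Boxes are stable under intersection and generate the sigma-algebra. *)
Lemma tuple_measure_unique l (m1 m2 : {measure set (l.-tuple R) -> \bar R}) :
  (m1 setT < +oo)%E -> (forall E : 'I_l -> set R, (forall i, measurable (E i)) -> m1 (box E) = m2 (box E)) ->
  forall S, measurable S -> m1 S = m2 S.
Proof.
move=> m1oo m12 S mS.
pose G := [set box E | E in [set E : 'I_l -> set R | forall i, measurable (E i)]].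
have GT : G setT by exists (fun=> setT) => //=; apply/seteqP; split.
apply: (measure_unique G (fun=> setT)) => //.
- rewrite eqEsubset; split; last first.
    apply: smallest_sub; first exact: sigma_algebra_measurable.
    by move=> _ [E mE <-]; exact: measurable_box.
  apply: smallest_sub; first exact: smallest_sigma_algebra.
  rewrite -bigcup_seq/= => _ [i _ [B mB <-]]; apply: sub_sigma_algebra.
  exists (fun j => if j == i then B else setT) => [j|]; first by case: ifP.
  rewrite setTI; apply/seteqP; split => t /= H; first by have := H i; rewrite eqxx.
  by move=> j; case: eqP => [->|].
- move=> _ _ [E mE <-] [F mF <-]; exists (fun i => E i `&` F i) => [i|].
    exact: measurableI.
  apply/seteqP; split => t /=; first by move=> H; split => i; have [] := H i.
  by move=> [H1 H2] i; split.
- by rewrite bigcup_const.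
- by move=> _ [E mE <-]; exact: m12.
Qed.

Lemma gaussT_box l (E : 'I_l -> set R) : (forall i, measurable (E i)) ->
  gaussT R l (box E) = (\prod_i gaussR (E i))%E.
Proof.
elim: l E => [|l IH] E mE.
  rewrite big_ord0 /= diracE mem_set//.
  by move=> [[]].
rewrite big_ord_recl/= /distribution/= /pushforward.
rewrite (_ : _ @^-1` _ = E ord0 `*` box (fun i : 'I_l => E (lift ord0 i))).
  have mE' i : measurable (E (lift ord0 i)) by [].
  rewrite -(IH _ mE'); apply: product_measure1E => //.
  exact: measurable_box.
apply/seteqP; split => -[x t] /=.
  move=> H; split; first exact: H ord0.
  by move=> i; have := H (lift ord0 i); rewrite tnthS.
by move=> [H0 H] i; case: (unliftP ord0 i) => [j ->|->//]; rewrite tnthS; exact: H.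
Qed.

(** Independence over the full index set gives the product formula on boxes, where it matches
    [gaussT_box]. *)
Lemma gaussian_law d (T : measurableType d) (P : probability T R) l (Z : 'I_l -> {RV P >-> R}) :
  mutually_independent Z ->
  (forall i (B : set R), measurable B -> distribution P (Z i) B = normal_prob 0 1 B) ->
  forall S, measurable S -> P ((fun w => [tuple Z i w | i < l]) @^-1` S) = gaussT R l S.
Proof.
move=> indep HZ.
have mZ : measurable_fun setT (fun w => [tuple Z i w | i < l]).
  apply/measurable_fun_tnthP => i.
  by rewrite (_ : _ \o _ = Z i)//; apply/funext => w /=; rewrite tnth_mktuple.
move=> S mS; apply: (tuple_measure_unique (m1 := push_measure P mZ) (m2 := gaussT R l)) => //.
  by rewrite /push_measure/= /pushforward preimage_setT probability_setT ltry.
move=> E mE; apply: (etrans _ (esym (gaussT_box mE))).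
rewrite /push_measure/= /pushforward.
have := indep [set: 'I_l]%SET E mE.
under [in X in _ = X]eq_bigl do rewrite inE.
rewrite (_ : \bigcap_(i in _) _ = (fun w => [tuple Z i w | i < l]) @^-1` box E); last first.
  apply/seteqP; split => w /= H i.
    by rewrite tnth_mktuple; apply: H; rewrite /= inE.
  by move=> _; have := H i; rewrite tnth_mktuple.
move=> ->; apply: eq_bigr => i _; exact: HZ.
Qed.

End tuple_laws.

(** * Random variables with finitely many values *)

Section finite_laws.
Context {R : realType} d (T : measurableType d) (P : probability T R).

Lemma sum_measure_bigcup (F : finType) (E : F -> set T) (Q : pred F) :
  (forall f, measurable (E f)) -> (forall f g, f != g -> E f `&` E g = set0) ->
  (\sum_(f | Q f) P (E f) = P (\bigcup_(f in [set` Q]) E f))%E.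
Proof.
move=> mE dE; rewrite bigfs ?index_enum_uniq//; last by move=> f _; rewrite mem_index_enum.
rewrite -measure_fin_bigcup//.
by apply/trivIsetP => i j _ _ ij; exact: dE.
Qed.

Lemma sum_measure_le (F : finType) (E : F -> set T) (Q : pred F) (A : set T) :
  (forall f, measurable (E f)) -> measurable A ->
  (forall f g, f != g -> E f `&` E g = set0) ->
  (forall f, Q f -> E f `<=` A) ->
  (\sum_(f | Q f) P (E f) <= P A)%E.
Proof.
move=> mE mA dE EA; rewrite sum_measure_bigcup//.
have fQ : finite_set [set` Q] by exact: finite_finset.
apply: le_measure; rewrite ?inE//; first exact: fin_bigcup_measurable.
by apply: bigcup_sub => f /EA.
Qed.

(* The events [E f] cover almost everything, so the lower bounds on [P A] and on
   [P (~` A)] they provide are both sharp. *)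
Lemma partition_law (F : finType) (E : F -> set T) (w : F -> R) (Q : pred F) (A : set T) :
  (forall f, measurable (E f)) -> measurable A ->
  (forall f g, f != g -> E f `&` E g = set0) ->
  (forall f, P (E f) = (w f)%:E) -> \sum_f w f = 1 ->
  (forall f, E f `<=` if Q f then A else ~` A) ->
  P A = (\sum_f w f * (Q f)%:R)%:E.
Proof.
move=> mE mA dE PE w1 EA.
have wQ (S : pred F) : (\sum_(f | S f) P (E f))%E = (\sum_(f | S f) w f)%:E.
  by rewrite -sumEFin; apply: eq_bigr => f _; rewrite PE.
have -> : \sum_f w f * (Q f)%:R = \sum_(f | Q f) w f.
  by rewrite [RHS]big_mkcond; apply: eq_bigr => f _; case: (Q f); rewrite ?mulr1 ?mulr0.
have h1 : (\sum_(f | Q f) P (E f) <= P A)%E.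
  by apply: sum_measure_le => // f Qf; have := EA f; rewrite Qf.
have h2 : (\sum_(f | ~~ Q f) P (E f) <= P (~` A))%E.
  apply: sum_measure_le => //; first exact: measurableC.
  by move=> f /negbTE Qf; have := EA f; rewrite Qf.
rewrite wQ in h1; rewrite wQ probability_setC// in h2.
have /fineK PAE : P A \is a fin_num by exact: fin_num_measure.
rewrite -PAE lee_fin in h1; rewrite -PAE -EFinB lee_fin in h2.
rewrite -PAE; congr EFin; apply/eqP; rewrite eq_le h1 andbT.
by rewrite (bigID Q)/= in w1; lra.
Qed.

(** Almost surely X takes a value in [s], so g o X agrees almost everywhere with a finite
    combination of indicators. Several indices may give the same point, hence [undup]. *)
Lemma finite_law_expectation l (X : {RV P >-> l.-tuple R}) (F : finType) (w : F -> R) (x : F -> l.-tuple R) :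
  (forall S, measurable S -> P (X @^-1` S) = (\sum_f w f * \1_S (x f))%:E) ->
  forall g : l.-tuple R -> R, measurable_fun setT g ->
  expectation P (g \o X) = (\sum_f w f * g (x f))%:E.
Proof.
move=> HX g mg.
pose s := undup [seq x f | f <- enum F].
have xs f : x f \in s by rewrite mem_undup map_f// mem_enum.
pose h w0 : R := \sum_(y <- s) g y * \1_(X @^-1` [set y]) w0.
have mX1 y : measurable (X @^-1` [set y]).
  by rewrite -[X in measurable X]setTI; apply: measurable_funPT => //; exact: measurable_tuple1.
have ms : measurable [set` s].
  rewrite (_ : [set` s] = \bigcup_(y in [set` s]) [set y]).
    by apply: fin_bigcup_measurable => // y _; exact: measurable_tuple1.
  by apply/seteqP; split => [y ys|y [z zs ->]]//; exists y.
have hE : ae_eq P setT (EFin \o (g \o X)) (EFin \o h).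
  exists (X @^-1` (~` [set` s])); split.
  - rewrite -[X in measurable X]setTI; apply: measurable_funPT => //.
    exact: measurableC.
  - apply: (etrans (HX _ (measurableC ms))).
    by rewrite big1// => f _; rewrite indicE memNset ?mulr0//=; apply.
  - move=> t /= nE Xs; apply: nE => _; congr EFin.
    rewrite /h (bigD1_seq (X t))//= ?undup_uniq// indicE mem_set// mulr1 big1 ?addr0// => y /eqP yX.
    by rewrite indicE memNset ?mulr0// => /esym.
have i1 y : P.-integrable setT (EFin \o \1_(X @^-1` [set y])).
  exact: integrable_indic.
have ih y : P.-integrable setT (fun w0 => (g y * \1_(X @^-1` [set y]) w0)%:E).
  under eq_fun do rewrite EFinM.
  by apply: integrableZl => //; exact: i1.
have mh : measurable_fun setT (EFin \o h).
  by apply/measurable_EFinP; apply: measurable_sum => y; exact: measurable_funM.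
have mgX : measurable_fun setT (EFin \o (g \o X)).
  by apply/measurable_EFinP; exact: measurableT_comp.
rewrite unlock (ae_eq_integral _ _ measurableT mgX mh hE).
transitivity (\sum_(y <- s) \int[P]_w0 (g y * \1_(X @^-1` [set y]) w0)%:E)%E.
  rewrite -integral_sum//; apply: eq_integral => t _.
  by rewrite /h/= sumEFin.
transitivity (\sum_(y <- s) (g y * \sum_f w f * (x f == y)%:R)%:E)%E.
  apply: eq_bigr => y _; under eq_integral do rewrite EFinM.
  rewrite integralZl//; last exact: i1.
  rewrite EFinM; congr (_ * _)%E; rewrite integral_indic// setIT.
  apply: (etrans (HX _ (measurable_tuple1 y))); congr EFin; apply: eq_bigr => f _; congr (_ * _).
  rewrite indicE; have [->|/eqP ne] := eqVneq (x f) y; first by rewrite mem_set.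
  by rewrite memNset.
rewrite sumEFin; congr EFin.
rewrite (eq_bigr (fun y => \sum_f w f * (g y * (x f == y)%:R))); last first.
  by move=> y _; rewrite mulr_sumr; apply: eq_bigr => f _; ring.
rewrite exchange_big/=; apply: eq_bigr => f _; rewrite -mulr_sumr; congr (_ * _).
rewrite (bigD1_seq (x f))//= ?undup_uniq// eqxx mulr1 big1 ?addr0// => y.
by rewrite eq_sym => /negbTE ->; rewrite mulr0.
Qed.

End finite_laws.

(** * From the definition of a GMD to the product law *)

Section gmd_link.
Context {R : realType}.

Lemma std_basis_inj k : injective (@std_basis R k).
Proof.
move=> a b /(congr1 (fun t => tnth t a)); rewrite !tnth_mktuple eqxx => /eqP.
by case: (a =P b) => // _; rewrite oner_eq0.
Qed.

(** The categorical vectors take basis values only almost surely, so the space is split up to a null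
    set by the joint outcomes; independence gives each of them the weight [pw p f]. *)
Lemma gmd_law_finite n k (nu : set ((k.-1).-tuple R) -> \bar R) : is_GMD n nu ->
  exists (i0 : 'I_k) (p : 'I_n -> 'I_k -> R),
    [/\ forall i a, 0 <= p i a, forall i, \sum_a p i a = 1 &
      forall S, measurable S -> nu S = (\sum_f pw p f * \1_S (tp (psum i0 f)))%:E].
Proof.
move=> [i0 [rho [[d [T [P [X [indep crv HX]]]]] Hnu]]].
have mE i (A : set (k.-tuple R)) : measurable A -> measurable (X i @^-1` A).
  by move=> mA; rewrite -[X in measurable X]setTI; exact: measurable_funPT.
have m1 a : measurable [set @std_basis R k a] by exact: measurable_tuple1.
pose p i a := fine (P (X i @^-1` [set std_basis R a])).
have PE i a : P (X i @^-1` [set std_basis R a]) = (p i a)%:E.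
  by rewrite fineK// fin_num_measure//; exact: mE.
have p0 i a : 0 <= p i a by rewrite -lee_fin -PE.
have p1 i : \sum_a p i a = 1.
  apply: EFin_inj; rewrite -(crv i) -sumEFin.
  under eq_bigr do rewrite -PE.
  rewrite sum_measure_bigcup => [|a|a b ab]; last 2 first.
  - exact: mE.
  - by rewrite -subset0 => w [/= -> /std_basis_inj abE]; rewrite abE eqxx in ab.
  congr (P _); apply/seteqP; split => [w [a _ /= ->]|w [a _ /= /esym aE]]; by exists a.
exists i0, p; split => // S mS.
pose E (f : {ffun 'I_n -> 'I_k}) := \bigcap_(i in [set` [set: 'I_n]%SET]) (X i @^-1` [set std_basis R (f i)]).
have EP f w : E f w <-> forall i, X i w = std_basis R (f i).
  by split => [H i|H i _]; [apply: H; rewrite /= inE|exact: H].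
have msum : measurable_fun setT (sum_vec (fun i => X i : T -> k.-tuple R)).
  apply/measurable_fun_tnthP => j.
  rewrite (_ : _ \o _ = fun w => \sum_(i < n) tnth (X i w) j); last first.
    by apply/funext => w /=; rewrite tnth_mktuple.
  apply: measurable_sum => i; apply: (measurableT_comp (measurable_tnth j)); exact: measurable_funPT.
have mdrop : measurable (drop_coord i0 @^-1` S).
  rewrite -[X in measurable X]setTI; suff : measurable_fun setT (@drop_coord R k i0) by apply.
  apply/measurable_fun_tnthP => j.
  rewrite (_ : _ \o _ = fun w => tnth w (lift i0 j)); first exact: measurable_tnth.
  by apply/funext => w /=; rewrite tnth_mktuple.
rewrite Hnu// HX// /pushforward.
rewrite (partition_law (P := P) (E := E) (w := pw p) (Q := fun f => tp (psum i0 f) \in S)).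
- by congr EFin.
- by move=> f; apply: fin_bigcap_measurable => [|i _]; [exact: finite_finset|exact: mE].
- by rewrite -[X in measurable X]setTI; exact: msum.
- move=> f g fg; rewrite -subset0 => w [/EP Hf /EP Hg]; move/eqP: fg; apply; apply/ffunP => i.
  by apply: std_basis_inj; rewrite -Hf -Hg.
- move=> f; rewrite /E (indep [set: 'I_n]%SET (fun i => [set std_basis R (f i)]))//.
  under eq_bigl do rewrite inE.
  rewrite /pw (eq_bigr (fun i => (p i (f i))%:E)) => [|i _]; last exact: PE.
  by rewrite prodEFin.
- exact: pw_sum1.
- move=> f w /EP Hf.
  have <- : drop_coord i0 (sum_vec (fun i => X i : T -> k.-tuple R) w) = tp (psum i0 f).
    apply: eq_from_tnth => j; rewrite !tnth_mktuple summxE; apply: eq_bigr => i _.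
    by rewrite Hf tnth_mktuple mxE.
  by case: ifPn => [/set_mem|/negP h]//= Sw; apply: h; rewrite inE.
Qed.

End gmd_link.

(** * Mean and covariance of a GMD *)

Section moments.
Context {R : realType} {n k : nat} (i0 : 'I_k) (p : 'I_n -> 'I_k -> R).
Context d (T : measurableType d) (P : probability T R) (X : {RV P >-> (k.-1).-tuple R}).
Hypothesis p_ge0 : forall i a, 0 <= p i a.
Hypothesis p_sum1 : forall i, \sum_a p i a = 1.
Hypothesis HX : forall S, measurable S ->
  P (X @^-1` S) = (\sum_f pw p f * \1_S (tp (psum i0 f)))%:E.

Lemma gmd_expectation (g : (k.-1).-tuple R -> R) : measurable_fun setT g ->
  expectation P (g \o X) = (pE p (fun f => g (tp (psum i0 f))))%:E.
Proof. by move=> mg; exact: (finite_law_expectation HX). Qed.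

Lemma pE_psum_coord j : pE p (fun f => psum i0 f 0 j) = (\sum_i pmu i0 p i) 0 j.
Proof.
under eq_pE do rewrite /psum summxE.
rewrite pE_sum summxE; apply: eq_bigr => i _.
rewrite (pE_marg p_sum1 i (fun a => evec i0 a 0 j)) summxE.
by apply: eq_bigr => a _; rewrite [RHS]mxE.
Qed.

Lemma gmd_expectation_coord j :
  expectation P (fun w => tnth (X w) j) = ((\sum_i pmu i0 p i) 0 j)%:E.
Proof.
rewrite (gmd_expectation (measurable_tnth j)) -pE_psum_coord; congr EFin.
by apply: eq_pE => f; rewrite tnth_mktuple.
Qed.

Lemma gmd_mean : mean_vec P X = \sum_i pmu i0 p i.
Proof. by apply/rowP => j; rewrite mxE gmd_expectation_coord. Qed.

Lemma gmd_cov : cov_mx P X = pcov i0 p.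
Proof.
apply/matrixP => a b; rewrite mxE unlock !gmd_expectation_coord.
set mu := \sum_i pmu i0 p i.
pose g (t : (k.-1).-tuple R) := (tnth t a - mu 0 a) * (tnth t b - mu 0 b).
have mg : measurable_fun setT g.
  by apply: measurable_funM; apply: measurable_funB => //; exact: measurable_tnth.
rewrite (_ : _ * _ = g \o X)// (gmd_expectation mg) /=.
pose h (j : 'I_k.-1) i c := (evec i0 c - pmu i0 p i) 0 j.
have hc j i : \sum_c p i c * h j i c = 0.
  transitivity ((\sum_c p i c *: (evec i0 c - pmu i0 p i)) 0 j).
    by rewrite summxE; apply: eq_bigr => c _; rewrite [RHS]mxE.
  under eq_bigr do rewrite scalerBr.
  by rewrite sumrB -scaler_suml p_sum1 scale1r subrr mxE.
transitivity (pE p (fun f => (\sum_i h a i (f i)) * (\sum_i h b i (f i)))).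
  apply: eq_pE => f; rewrite /g !tnth_mktuple.
  have E j : psum i0 f 0 j - mu 0 j = \sum_i h j i (f i).
    rewrite /mu !summxE -sumrB; apply: eq_bigr => i _.
    by rewrite /h [RHS]mxE; congr (_ + _); rewrite [RHS]mxE.
  by rewrite !E.
rewrite (pE_prod_sum p_sum1 (h b) (hc a)) summxE; apply: eq_bigr => i _.
rewrite summxE; apply: eq_bigr => c _; rewrite [RHS]mxE; congr (_ * _).
by rewrite [RHS]mxE big_ord1 [_^T _ _]mxE.
Qed.

End moments.

(** The bound is a perfect square, so that the norm bound deduced from it is 2 / sigma. *)
Lemma evec_dist_le4 (R : realType) k (i0 a b : 'I_k) :
  dotp (evec i0 a - evec i0 b : 'rV[R]__) (evec i0 a - evec i0 b) <= 4.
Proof.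
have H c : \sum_(j < k.-1) (lift i0 j == c)%:R <= 1 :> R.
  case: (unliftP i0 c) => [j ->|->].
    rewrite (bigD1 j)//= eqxx big1 ?addr0// => j' jj'.
    by rewrite (inj_eq lift_inj) (negbTE jj').
  by rewrite big1// => j _; rewrite eq_sym (negbTE (neq_lift _ _)).
apply: (@le_trans _ _ (\sum_(j < k.-1) (lift i0 j == a)%:R + \sum_(j < k.-1) (lift i0 j == b)%:R)).
  rewrite -big_split; apply: ler_sum => j _; rewrite !mxE.
  by case: (_ == a); case: (_ == b); rewrite /=; lra.
by have := H a; have := H b; lra.
Qed.

(** * The bound in terms of the smallest eigenvalue *)

Section core_spectral.
Context {R : realType} {k : nat} {I : finType}.
Variables (i0 : 'I_k) (p : I -> 'I_k -> R).
Local Notation m := k.-1.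
Hypothesis p_ge0 : forall i a, 0 <= p i a.
Hypothesis p_sum1 : forall i, \sum_a p i a = 1.
Variables (l : nat) (A : 'M[R]_(l, m)) (sigma : R).
Hypothesis covA : A^T *m A = pcov i0 p.
Hypothesis sigma0 : 0 < sigma.
Hypothesis sigmaP : is_min_eigenvalue (pcov i0 p) (sigma ^+ 2).

Lemma pE_gauss_spectral_le (G : 'rV[R]_m -> R) (e : R) : 0 < e ->
  meas01 (fun x => G (rd x)) -> (forall x, `|G x| <= 1) ->
  `|pE p (fun w => G (rd (psum i0 w))) - smooth A 1 (fun x => G (rd x)) (\sum_i pmu i0 p i)| <=
  Num.sqrt k%:R * (e * m%:R + 2 / sigma * (k%:R ^+ 2 + m%:R * (2^-1 + k%:R ^+ 2))) +
  5 * (2 / sigma) * (@wcst R) / e ^+ 3 * m%:R + (@wcst R) * e * ((1 + m%:R) / 2).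
Proof.
move=> e0 mG G1; pose S := pcov i0 p.
have covS : A^T *m A = S := covA.
have SP : is_min_eigenvalue S (sigma ^+ 2) := sigmaP.
have s20 : 0 < sigma ^+ 2 by rewrite exprn_gt0.
have Ss : S^T = S by rewrite -covS trmx_mul trmxK.
have S0 u : 0 <= dotp (u *m S) u.
  by rewrite -covS mulmxA dotp_mulmx; exact: dotp_ge0.
have Squad := min_eigenvalue_quad Ss S0 SP.
have Su := min_eigenvalue_unit s20 SP.
(* [A] may be rectangular; this [B] satisfies B A = 1 and B B^T = S^-1 at once. *)
pose B := invmx S *m A^T.
have BA : B *m A = 1%:M by rewrite /B -mulmxA covS mulVmx.
have BB : B *m B^T = invmx S.
  by rewrite /B trmx_mul trmxK -mulmxA (mulmxA A^T) covS trmx_inv Ss mulmxV// mulmx1.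
have BBcov : B *m B^T *m pcov i0 p = 1%:M by rewrite BB mulVmx.
have kap0 : 0 < 2 / sigma by rewrite divr_gt0.
have nbk a b : bnorm B (evec i0 a - evec i0 b) <= 2 / sigma.
  rewrite -(@ler_pXn2r _ 2)// ?nnegrE ?nrm_ge0 ?(ltW kap0)// nb_dotp BB.
  apply: le_trans (quad_inv_le _ s20 Ss Squad Su) _.
  rewrite expr_div_n ler_pM2r ?invr_gt0//.
  by apply: le_trans (evec_dist_le4 _ _ _ _) _; rewrite expr2; lra.
exact: (pE_gauss_le p_ge0 p_sum1 covA BA BBcov kap0 nbk mG G1 e0).
Qed.

End core_spectral.

(** Here e = 1 / s and sigma = s^10. The shift costs give 7 = 1 + 2 * 3, the Lindeberg term 10 W and
    the Lipschitz term W; k^3 q, with q = sqrt k, dominates every power of k that occurs. *)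
Lemma rate_le (R : realType) (s k q W : R) : 1 <= s -> 1 <= k -> 1 <= q -> 0 <= W ->
  q * (s^-1 * (k - 1) + 2 / s ^+ 10 * (k ^+ 2 + (k - 1) * (2^-1 + k ^+ 2))) +
  5 * (2 / s ^+ 10) * W / s^-1 ^+ 3 * (k - 1) + W * s^-1 * ((1 + (k - 1)) / 2) <=
  (7 + 11 * W) * (k ^+ 3 * q) / s.
Proof.
move=> s1 k1 q1 W0.
have s0 : 0 < s by apply: lt_le_trans s1.
set t := s^-1; have e10 : (s ^+ 10)^-1 = t ^+ 10 by rewrite exprVn.
rewrite e10.
have t0 : 0 < t by rewrite invr_gt0.
have t1 : t <= 1 by rewrite invf_le1.
have -> : 5 * (2 * t ^+ 10) * W / t ^+ 3 * (k - 1) = 10 * t ^+ 7 * W * (k - 1).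
  by field; rewrite gt_eqF.
have t10 : t ^+ 10 <= t by rewrite exprS ler_piMr ?exprn_ile1// ltW.
have t7 : t ^+ 7 <= t by rewrite exprS ler_piMr ?exprn_ile1// ltW.
have kk : k <= k ^+ 3 by rewrite exprS ler_peMr ?exprn_ege1//; lra.
have kk2 : k ^+ 2 <= k ^+ 3 by rewrite [leRHS]exprS ler_peMl// sqr_ge0.
have kkq : k ^+ 3 <= k ^+ 3 * q by rewrite ler_peMr// exprn_ge0//; lra.
have k30 : 0 <= k ^+ 3 by rewrite exprn_ge0//; lra.
have h1 : q * (t * (k - 1) + 2 * t ^+ 10 * (k ^+ 2 + (k - 1) * (2^-1 + k ^+ 2))) <= q * (7 * t * k ^+ 3).
  apply: ler_wpM2l; first by lra.
  have a1 : t * (k - 1) <= t * k ^+ 3 by apply: ler_wpM2l; [exact: ltW|lra].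
  have a2 : k ^+ 2 + (k - 1) * (2^-1 + k ^+ 2) <= 3 * k ^+ 3.
    by rewrite (_ : _ + _ = (k - 1) / 2 + k ^+ 3); [lra|field].
  have a3 : 2 * t ^+ 10 * (k ^+ 2 + (k - 1) * (2^-1 + k ^+ 2)) <= 2 * t * (3 * k ^+ 3).
    apply: ler_pM => //; last by lra.
    - by rewrite mulr_ge0// exprn_ge0// ltW.
    - apply: addr_ge0 (sqr_ge0 _) _; apply: mulr_ge0; first by lra.
      by apply: addr_ge0 (sqr_ge0 _); lra.
  lra.
have h2 : 10 * t ^+ 7 * W * (k - 1) <= 10 * t * W * (k ^+ 3 * q).
  apply: ler_pM; [| lra | | lra].
  - by apply: mulr_ge0 W0; apply: mulr_ge0 => //; rewrite exprn_ge0// ltW.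
  - by apply: ler_wpM2r => //; lra.
have h3 : W * t * ((1 + (k - 1)) / 2) <= W * t * (k ^+ 3 * q).
  by apply: ler_wpM2l; [rewrite mulr_ge0// ltW|lra].
apply: le_trans (lerD (lerD h1 h2) h3) _.
by rewrite le_eqVlt; apply/orP; left; apply/eqP; ring.
Qed.

(** * The rounded Gaussian and the total variation bound *)

Section main.
Context {R : realType}.

Lemma measurable_round_vec l : measurable_fun setT (@round_vec R l).
Proof.
apply/measurable_fun_tnthP => j.
rewrite (_ : _ \o _ = fun t => (Num.floor (tnth t j + 2^-1))%:~R); last first.
  by apply/funext => t /=; rewrite tnth_mktuple.
have mf : measurable_fun setT (fun x : R => (Num.floor x)%:~R : R).
  apply: nondecreasing_measurable => // x y xy.
  by rewrite ler_int; exact: le_floor.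
apply: (measurableT_comp mf); apply: measurable_funD => //; exact: measurable_tnth.
Qed.

Lemma tp_rd k (x : 'rV[R]_(k.-1)) : tp (rd x) = round_vec (tp x).
Proof. by apply: eq_from_tnth => j; rewrite !tnth_mktuple mxE. Qed.

Lemma meas01_round k (S : set ((k.-1).-tuple R)) : measurable S ->
  meas01 (fun x : 'rV[R]_(k.-1) => \1_S (tp (rd x)) : R).
Proof.
move=> mS; split; last by move=> x; rewrite indicE; case: (_ \in _); rewrite ?lexx ?ler01.
rewrite /mrv (_ : (fun t => _) = \1_S \o @round_vec R k.-1); last first.
  by apply/funext => t /=; rewrite tp_rd rvK.
by apply: measurableT_comp; [exact: measurable_indic|exact: measurable_round_vec].
Qed.

(** The smoothing operator is defined from a factor of [Sigma], so the factor [A] of the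
    representation is returned together with the law. *)
Lemma mvnormal_round k (mu : 'rV[R]_(k.-1)) (Sigma : 'M[R]_(k.-1))
    d (T : measurableType d) (P : probability T R) (Y : {RV P >-> (k.-1).-tuple R}) :
  is_mvnormal mu Sigma (distribution P Y) ->
  exists l (A : 'M[R]_(l, k.-1)), A^T *m A = Sigma /\
    forall S, measurable S -> pushforward P (@round_vec R k.-1 \o Y) S =
      (smooth A 1 (fun x => \1_S (tp (rd x))) mu)%:E.
Proof.
move=> [l [A [AA [d' [T' [P' [Z [indep HZ HY]]]]]]]]; exists l, A; split => // S mS.
have mS' : measurable (@round_vec R k.-1 @^-1` S).
  by rewrite -[X in measurable X]setTI; exact: measurable_round_vec.
rewrite (_ : pushforward _ _ S = distribution P Y (@round_vec R k.-1 @^-1` S))// HY//.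
pose a (t : l.-tuple R) := affine_tuple mu A (rv t).
have ma : measurable_fun setT a.
  apply/measurable_fun_tnthP => j.
  rewrite (_ : _ \o _ = fun t => (mu + rv t *m A) 0 j); last by apply/funext => t /=; rewrite tnth_mktuple.
  have : mvec (fun t : l.-tuple R => mu + rv t *m A).
    by apply: mvecD; [exact: mvec_cst|apply: mvecM; exact: mvec_id].
  exact.
have maS : measurable (a @^-1` (@round_vec R k.-1 @^-1` S)).
  by rewrite -[X in measurable X]setTI; exact: ma.
rewrite (_ : pushforward _ _ _ = P' ((fun w => [tuple Z i w | i < l]) @^-1` (a @^-1` (@round_vec R k.-1 @^-1` S)))).
  rewrite (gaussian_law indep HZ maS) EFin_smooth; last exact: meas01_round.
  transitivity (\int[gaussT R l]_z (\1_(a @^-1` (@round_vec R k.-1 @^-1` S)) z)%:E)%E.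
    by rewrite integral_indic// setIT.
  by apply: eq_integral => t _; rewrite tp_rd scale1r.
rewrite /pushforward; congr (P' _); apply/seteqP; split => w /=.
all: rewrite /a (_ : rv _ = \row_i Z i w)//; by apply/rowP => i; rewrite !mxE tnth_mktuple.
Qed.

Lemma abse_probB_le1 d d' (T : measurableType d) (T' : measurableType d')
    (P : probability T R) (Q : probability T' R) (A : set T) (B : set T') :
  measurable A -> measurable B -> (`|P A - Q B| <= 1)%E.
Proof.
move=> mA mB.
have H d0 (T0 : measurableType d0) (P0 : probability T0 R) A0 : measurable A0 ->
    P0 A0 = (fine (P0 A0))%:E /\ 0 <= fine (P0 A0) <= 1.
  move=> mA0; have PE : P0 A0 = (fine (P0 A0))%:E by rewrite fineK// fin_num_measure.
  by split; rewrite // -!lee_fin -PE measure_ge0 probability_le1.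
have [-> /andP[a0 a1]] := H _ _ P _ mA; have [-> /andP[b0 b1]] := H _ _ Q _ mB.
by rewrite -EFinB abse_EFin lee_fin ler_norml; apply/andP; split; lra.
Qed.

Lemma gmd_round_tv_le n k
    d1 (T1 : measurableType d1) (P1 : probability T1 R) (X : {RV P1 >-> (k.-1).-tuple R})
    d2 (T2 : measurableType d2) (P2 : probability T2 R) (Y : {RV P2 >-> (k.-1).-tuple R})
    (s : R) (S : set ((k.-1).-tuple R)) :
  is_GMD n (distribution P1 X) ->
  is_mvnormal (mean_vec P1 X) (cov_mx P1 X) (distribution P2 Y) ->
  1 <= s -> is_min_eigenvalue (cov_mx P1 X) ((s ^+ 10) ^+ 2) -> measurable S ->
  (`|distribution P1 X S - pushforward P2 (@round_vec R k.-1 \o Y) S| <=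
    ((7 + 11 * wcst R) * (k%:R ^+ 3 * Num.sqrt k%:R) / s)%:E)%E.
Proof.
move=> /gmd_law_finite[i0 [p [p0 p1 HX]]] HY s1 sP mS.
have covE := gmd_cov p1 HX; rewrite covE in HY sP.
have [l [A [covA HA]]] := mvnormal_round HY.
rewrite HX// HA// (gmd_mean p1 HX).
pose G (x : 'rV[R]_(k.-1)) : R := \1_S (tp x).
have G1 x : `|G x| <= 1 by rewrite /G indicE; case: (_ \in _); rewrite ?normr0 ?normr1.
have s0 : 0 < s by apply: lt_le_trans s1.
have e0 : 0 < s^-1 by rewrite invr_gt0.
have s10 : 0 < s ^+ 10 by rewrite exprn_gt0.
have := pE_gauss_spectral_le p0 p1 covA s10 sP e0 (meas01_round mS) G1.
have k1 : 1 <= k%:R :> R by rewrite ler1n; exact: leq_ltn_trans (leq0n i0) (ltn_ord i0).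
have -> : (k.-1)%:R = k%:R - 1 :> R.
  by rewrite -subn1 natrB//; exact: leq_ltn_trans (leq0n i0) (ltn_ord i0).
have q1 : 1 <= Num.sqrt k%:R :> R by rewrite -[leLHS]sqrtr1 ler_sqrt// (lt_le_trans _ k1).
have := rate_le s1 k1 q1 (ltW (wcst_gt0 R)).
move=> h1 h2; rewrite -EFinB abse_EFin lee_fin; apply: le_trans h1; apply: le_trans h2.
rewrite le_eqVlt; apply/orP; left; apply/eqP; congr `|_ - _|.
by apply: eq_bigr => f _; rewrite rd_psum.
Qed.

End main.

(* In \bar R, r%:E / 0 = +oo for r > 0: the bound is void when sigma = 0. *)
Theorem theorem1 (R : realType) :
  exists C : R, 0 < C /\
  forall (n k : nat)
    (d1 : measure_display) (T1 : measurableType d1) (P1 : probability T1 R)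
    (X : {RV P1 >-> (k.-1).-tuple R})
    (d2 : measure_display) (T2 : measurableType d2) (P2 : probability T2 R)
    (Y : {RV P2 >-> (k.-1).-tuple R})
    (mu : 'rV[R]_(k.-1)) (Sigma : 'M[R]_(k.-1)) (sigma : R),
  is_GMD n (distribution P1 X) ->
  mu = mean_vec P1 X ->
  Sigma = cov_mx P1 X ->
  is_mvnormal mu Sigma (distribution P2 Y) ->
  0 <= sigma ->
  is_min_eigenvalue Sigma (sigma ^+ 2) ->
  (dTV (distribution P1 X) (pushforward P2 (@round_vec R k.-1 \o Y)) <=
    (C * k%:R `^ (7 / 2))%:E / (sigma `^ (1 / 10))%:E)%E.
Proof.
have W0 := wcst_gt0 R.
have C1 : 1 <= 7 + 11 * wcst R by lra.
exists (7 + 11 * wcst R); split; first by lra.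
move=> n k d1 T1 P1 X d2 T2 P2 Y mu Sigma sigma gmd -> -> HY sg0 sP.
(* The dropped coordinate provides k > 0. *)
have [i0 _] := gmd.
have k0 : (0 < k)%N by exact: leq_ltn_trans (leq0n i0) (ltn_ord i0).
have k1 : 1 <= k%:R :> R by rewrite ler1n.
have k72 : k%:R `^ (7 / 2) = k%:R ^+ 3 * Num.sqrt k%:R :> R.
  rewrite (_ : 7 / 2 = 3%:R + 2^-1); last by field.
  rewrite powRD; last by apply/implyP => _; rewrite pnatr_eq0 -lt0n.
  by rewrite powR_mulrn ?ler0n// powR12_sqrt.
have k72_ge1 : 1 <= k%:R `^ (7 / 2) :> R.
  by rewrite -[leLHS](powRr0 k%:R) ler_powR// divr_ge0.
have C72 : 1 <= (7 + 11 * wcst R) * k%:R `^ (7 / 2) by rewrite mulr_ege1.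
move: sg0; rewrite le_eqVlt => /predU1P[<-|sg0].
  rewrite powR0 ?div1r ?invr_eq0 ?pnatr_eq0// inve0 gt0_muley ?leey// lte_fin.
  exact: lt_le_trans C72.
pose s := sigma `^ (1 / 10).
have s0 : 0 < s by rewrite powR_gt0.
have s10 : s ^+ 10 = sigma.
  by rewrite -powR_mulrn ?ltW// -powRrM (_ : 1 / 10 * 10%:R = 1) ?powRr1 ?ltW//; field.
rewrite -/s -(gtr0_norm s0) inver gt_eqF ?normr_gt0 ?gt_eqF// gtr0_norm// -EFinM.
apply: ge_ereal_sup => _ [S mS <-].
(* When s < 1 the right-hand side is at least 1, because C k^(7/2) is, and a difference of
   probabilities never exceeds 1. *)
have [s1|s1] := leP 1 s.
  by rewrite k72; apply: gmd_round_tv_le gmd HY s1 _ mS; rewrite s10.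
apply: (@le_trans _ _ 1%E); last first.
  by rewrite lee_fin ler_pdivlMr// mul1r (le_trans (ltW s1)).
apply: abse_probB_le1 => //; rewrite -[X in measurable X]setTI.
suff : measurable_fun setT (@round_vec R k.-1 \o Y) by exact.
apply: (measurableT_comp (f := @round_vec R k.-1)) => //; first exact: measurable_round_vec.
Qed.
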